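(* It is consistent with ZFC that CH holds, $2^{\aleph_1}>\aleph_2$, and every locally countable Hausdorff space $X$ of size $\le\aleph_2$ such that for every open neighbourhood assignment $U^*$ of $X$ there is a finer open neighbourhood assignment $U$ of $X$ with respect to which every open subspace of $X$ of size $\le\aleph_1$ is strongly $D$, is a $D$-space.
   Context: An open neighbourhood assignment (ONA) in a topological space $(X,\tau)$ is a function $U:X\to\tau$ such that $x\in U(x)$ for all $x\in X$. For $D\subseteq X$ write $\bigcup U``D=\bigcup\{U(x):x\in D\}$. $X$ is a $D$-space (is $D$) iff for every ONA $U$ of $X$ there is a closed discrete $D\subseteq X$ with $\bigcup U``D=X$. An ONA $V$ is finer than $U$ iff $V(x)\subseteq U(x)$ for all $x\in X$. $X$ is locally countable iff there is an ONA $U$ of $X$ with $|U(x)|<\aleph_1$ for all $x\in X$. A subset $D\subseteq X$ is $U$-sticky iff $D$ is closed discrete in $X$ and for all $x\in X$, $U(x)\cap D\ne\emptyset$ implies $x\in\bigcup U``D$. $\mathbb{P}^{\aleph_1}_U(X)$ is the set of all countable $U$-sticky $D\subseteq X$, ordered by: $D\le D'$ iff $D\subseteq D'$ and $(D'\setminus D)\cap\bigcup U``D=\emptyset$. $X$ is strongly $D$ (i.e. $\aleph_1$-$D$) with respect to an ONA $U$ of $X$ iff for every $D\in\mathbb{P}^{\aleph_1}_U(X)$ and every $x\in X$ there is $D'\ge D$ in $\mathbb{P}^{\aleph_1}_U(X)$ with $x\in\bigcup U``D'$. If $U$ is an ONA of $X$ and $Y\subseteq X$ is a subspace, then ''$Y$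 is strongly $D$ with respect to $U$'' means that $Y$, with the subspace topology, is strongly $D$ with respect to the ONA $y\mapsto U(y)\cap Y$ of $Y$. *)

(* Defs.v *)
From Stdlib Require Import List.

(** * First-order logic over the language {=, ∈} *)

(** De Bruijn indices; the only terms of the language are variables. *)
Inductive form : Type :=
| fBot : form
| fEq  : nat -> nat -> form
| fIn  : nat -> nat -> form
| fImp : form -> form -> form
| fAll : form -> form.

Definition scons (x : nat) (r : nat -> nat) (i : nat) : nat :=
  match i with 0 => x | S j => r j end.

Fixpoint ren (r : nat -> nat) (A : form) : form :=
  match A with
  | fBot => fBot
  | fEq i j => fEq (r i) (r j)
  | fIn i j => fIn (r i) (r j)
  | fImp B C => fImp (ren r B) (ren r C)
  | fAll B => fAll (ren (scons 0 (fun i => S (r i))) B)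
  end.

(** Since terms are variables, instantiating index 0 by a term is a renaming. *)
Definition inst (x : nat) (A : form) : form := ren (scons x (fun i => i)) A.

(** [free_below n A]: every free index of [A] is smaller than [n]. *)
Fixpoint free_below (n : nat) (A : form) : Prop :=
  match A with
  | fBot => True
  | fEq i j | fIn i j => i < n /\ j < n
  | fImp B C => free_below n B /\ free_below n C
  | fAll B => free_below (S n) B
  end.

Fixpoint fAlls (n : nat) (A : form) : form :=
  match n with 0 => A | S m => fAll (fAlls m A) end.

(** Classical natural deduction with equality. *)
Inductive prv : list form -> form -> Prop :=
| prv_hyp G A : In A G -> prv G A
| prv_impI G A B : prv (A :: G) B -> prv G (fImp A B)
| prv_impE G A B : prv G (fImp A B) -> prv G A -> prv G B
| prv_raa G A : prv (fImp A fBot :: G) fBot -> prv G A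
| prv_allI G A : prv (map (ren S) G) A -> prv G (fAll A)
| prv_allE G A x : prv G (fAll A) -> prv G (inst x A)
| prv_eq_refl G x : prv G (fEq x x)
| prv_eq_subst G A x y : prv G (fEq x y) -> prv G (inst x A) -> prv G (inst y A).

Definition theory : Type := form -> Prop.

Definition proves (T : theory) (A : form) : Prop :=
  exists G, (forall B, In B G -> T B) /\ prv G A.

Definition consistent (T : theory) : Prop := ~ proves T fBot.

Definition extend (T : theory) (A : form) : theory := fun B => T B \/ B = A.

(** * Writing formulas with named variables

    A [fm] is a formula placed under [d] binders, as a function of [d]; a [var]
    gives the index of a fixed variable as seen from under [d] binders. A
    variable bound under exactly [d] binders has index [e - S d] under [e > d]
    binders. *)
Definition var : Type := nat -> nat.
Definition fm : Type := nat -> form.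

Definition Bot : fm := fun _ => fBot.
Definition Eq (x y : var) : fm := fun d => fEq (x d) (y d).
Definition Mem (x y : var) : fm := fun d => fIn (x d) (y d).
Definition Imp (A B : fm) : fm := fun d => fImp (A d) (B d).
Definition All (A : var -> fm) : fm :=
  fun d => fAll (A (fun e => e - S d) (S d)).

Definition Not (A : fm) : fm := Imp A Bot.
Definition And (A B : fm) : fm := Not (Imp A (Not B)).
Definition Or (A B : fm) : fm := Imp (Not A) B.
Definition Iff (A B : fm) : fm := And (Imp A B) (Imp B A).
Definition Ex (A : var -> fm) : fm := Not (All (fun x => Not (A x))).

Definition sentence (A : fm) : form := A 0.

Declare Scope zf_scope.
Delimit Scope zf_scope with zf.
Bind Scope zf_scope with fm.

Notation "x ≐ y" := (Eq x y) (at level 70, no associativity) : zf_scope.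
Notation "x ∈ y" := (Mem x y) (at level 70, no associativity) : zf_scope.
Notation "¬ A" := (Not A) (at level 75, right associativity) : zf_scope.
Notation "A ∧ B" := (And A B) (at level 80, right associativity) : zf_scope.
Notation "A ∨ B" := (Or A B) (at level 85, right associativity) : zf_scope.
Notation "A ⇒ B" := (Imp A B) (at level 90, right associativity) : zf_scope.
Notation "A ⇔ B" := (Iff A B) (at level 95, no associativity) : zf_scope.
Notation "∀ x , A" := (All (fun x => A))
  (at level 200, x name, A at level 200, right associativity) : zf_scope.
Notation "∃ x , A" := (Ex (fun x => A))
  (at level 200, x name, A at level 200, right associativity) : zf_scope.
Notation "∀ x ∈ a , A" := (All (fun x => Imp (Mem x a) A))
  (at level 200, x name, a at level 69, A at level 200,
   right associativity) : zf_scope.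
Notation "∃ x ∈ a , A" := (Ex (fun x => And (Mem x a) A))
  (at level 200, x name, a at level 69, A at level 200,
   right associativity) : zf_scope.

Local Open Scope zf_scope.

(** * Basic set theory *)

Definition Subset (a b : var) : fm := ∀ x ∈ a, x ∈ b.
Definition IsEmpty (a : var) : fm := ∀ x, ¬ x ∈ a.
Definition IsPair (p a b : var) : fm := ∀ x, x ∈ p ⇔ (x ≐ a ∨ x ≐ b).
Definition IsInter (c a b : var) : fm := ∀ x, x ∈ c ⇔ (x ∈ a ∧ x ∈ b).
Definition IsDiff (c a b : var) : fm := ∀ x, x ∈ c ⇔ (x ∈ a ∧ ¬ x ∈ b).
Definition IsUnion (u s : var) : fm := ∀ x, x ∈ u ⇔ (∃ a ∈ s, x ∈ a).
Definition IsPower (p a : var) : fm := ∀ x, x ∈ p ⇔ Subset x a.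
(** s = a ∪ {a} *)
Definition IsSucc (s a : var) : fm := ∀ x, x ∈ s ⇔ (x ∈ a ∨ x ≐ a).

(** p = (a, b), the Kuratowski pair *)
Definition IsOPair (p a b : var) : fm :=
  ∃ u, ∃ v, IsPair u a a ∧ IsPair v a b ∧ IsPair p u v.
(** f(a) = b, for f a function *)
Definition Maps (f a b : var) : fm := ∃ p ∈ f, IsOPair p a b.

Definition IsFunc (f A B : var) : fm :=
  (∀ p ∈ f, ∃ a ∈ A, ∃ b ∈ B, IsOPair p a b)
  ∧ (∀ a ∈ A, ∃ b, Maps f a b)
  ∧ (∀ a, ∀ b, ∀ c, Maps f a b ⇒ Maps f a c ⇒ b ≐ c).
Definition IsInj (f A B : var) : fm :=
  IsFunc f A B ∧ (∀ a, ∀ b, ∀ c, Maps f a c ⇒ Maps f b c ⇒ a ≐ b).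
Definition IsBij (f A B : var) : fm :=
  IsInj f A B ∧ (∀ b ∈ B, ∃ a, Maps f a b).

Definition CardLe (A B : var) : fm := ∃ f, IsInj f A B.
Definition CardEq (A B : var) : fm := ∃ f, IsBij f A B.
Definition CardLt (A B : var) : fm := CardLe A B ∧ ¬ CardEq A B.

Definition Transitive (a : var) : fm := ∀ x ∈ a, Subset x a.
(** By Foundation, a transitive set of transitive sets is well-ordered by ∈. *)
Definition Ordinal (a : var) : fm := Transitive a ∧ (∀ x ∈ a, Transitive x).
Definition Limit (a : var) : fm :=
  Ordinal a ∧ (∃ x, x ∈ a) ∧ (∀ x ∈ a, ∃ s ∈ a, IsSucc s x).
Definition Cardinal (k : var) : fm := Ordinal k ∧ (∀ a ∈ k, ¬ CardEq a k).
Definition IsCardSucc (l k : var) : fm :=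
  Cardinal l ∧ k ∈ l ∧ (∀ m, Cardinal m ⇒ k ∈ m ⇒ Subset l m).

(** ω is the least nonzero limit ordinal. *)
Definition IsAleph0 (w : var) : fm := Limit w ∧ (∀ a ∈ w, ¬ Limit a).
Definition IsAleph1 (k : var) : fm := ∃ w, IsAleph0 w ∧ IsCardSucc k w.
Definition IsAleph2 (k : var) : fm := ∃ l, IsAleph1 l ∧ IsCardSucc k l.

Definition Countable (A : var) : fm := ∃ w, IsAleph0 w ∧ CardLe A w.
Definition CardLtAleph1 (A : var) : fm := ∃ k, IsAleph1 k ∧ CardLt A k.
Definition CardLeAleph1 (A : var) : fm := ∃ k, IsAleph1 k ∧ CardLe A k.
Definition CardLeAleph2 (A : var) : fm := ∃ k, IsAleph2 k ∧ CardLe A k.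

Definition CH : fm :=
  ∃ w, ∃ k, ∃ p, IsAleph0 w ∧ IsAleph1 k ∧ IsPower p w ∧ CardEq p k.
Definition TwoToAleph1GtAleph2 : fm :=
  ∃ k, ∃ l, ∃ p, IsAleph1 k ∧ IsAleph2 l ∧ IsPower p k ∧ CardLt l p.

(** * The axioms of ZFC *)

Definition Extensionality : fm :=
  ∀ a, ∀ b, (∀ x, x ∈ a ⇔ x ∈ b) ⇒ a ≐ b.
Definition Foundation : fm :=
  ∀ a, (∃ x, x ∈ a) ⇒ ∃ x ∈ a, ∀ y ∈ x, ¬ y ∈ a.
Definition Pairing : fm := ∀ a, ∀ b, ∃ p, IsPair p a b.
Definition Union : fm := ∀ s, ∃ u, IsUnion u s.
Definition PowerSet : fm := ∀ a, ∃ p, IsPower p a.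
Definition Infinity : fm :=
  ∃ i, (∃ e ∈ i, IsEmpty e) ∧ (∀ x ∈ i, ∃ s ∈ i, IsSucc s x).
(** Every set of nonempty pairwise disjoint sets has a transversal. *)
Definition Choice : fm :=
  ∀ s, (∀ a ∈ s, ∃ x, x ∈ a)
    ⇒ (∀ a ∈ s, ∀ b ∈ s, (∃ x, x ∈ a ∧ x ∈ b) ⇒ a ≐ b)
    ⇒ ∃ c, ∀ a ∈ s, ∃ x, ∀ y, (y ∈ a ∧ y ∈ c) ⇔ y ≐ x.

(** In [A], index 0 stands for [x] (resp. 0 and 1 for [x] and [y]); the
    remaining indices are parameters, left free here. *)
Definition apply1 (A : form) (x : var) : fm :=
  fun d => ren (scons (x d) (fun i => i + d)) A.
Definition apply2 (A : form) (x y : var) : fm :=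
  fun d => ren (scons (x d) (scons (y d) (fun i => i + d))) A.

Definition Separation (A : form) : fm :=
  ∀ a, ∃ b, ∀ x, x ∈ b ⇔ (x ∈ a ∧ apply1 A x).
Definition Replacement (A : form) : fm :=
  (∀ x, ∀ y, ∀ z, apply2 A x y ⇒ apply2 A x z ⇒ y ≐ z)
  ⇒ ∀ a, ∃ b, ∀ y, y ∈ b ⇔ (∃ x ∈ a, apply2 A x y).

Inductive ZFC : theory :=
| zfc_extensionality : ZFC (sentence Extensionality)
| zfc_foundation : ZFC (sentence Foundation)
| zfc_pairing : ZFC (sentence Pairing)
| zfc_union : ZFC (sentence Union)
| zfc_power_set : ZFC (sentence PowerSet)
| zfc_infinity : ZFC (sentence Infinity)
| zfc_choice : ZFC (sentence Choice)
| zfc_separation n A :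
    free_below (S n) A -> ZFC (fAlls n (sentence (Separation A)))
| zfc_replacement n A :
    free_below (S (S n)) A -> ZFC (fAlls n (sentence (Replacement A))).

(** * Topology, in the language of set theory *)

(** [X] is the underlying set and [t] the set of open sets. *)
Definition IsTopology (X t : var) : fm :=
  (∀ u ∈ t, Subset u X)
  ∧ X ∈ t
  ∧ (∃ e ∈ t, IsEmpty e)
  ∧ (∀ u ∈ t, ∀ v ∈ t, ∃ w ∈ t, IsInter w u v)
  ∧ (∀ s, Subset s t ⇒ ∃ u ∈ t, IsUnion u s).

Definition Hausdorff (X t : var) : fm :=
  ∀ x ∈ X, ∀ y ∈ X, ¬ x ≐ y ⇒
    ∃ u ∈ t, ∃ v ∈ t, x ∈ u ∧ y ∈ v ∧ ¬ (∃ z, z ∈ u ∧ z ∈ v).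

Definition ClosedDiscrete (D X t : var) : fm :=
  Subset D X
  ∧ (∃ c ∈ t, IsDiff c X D)
  ∧ (∀ x ∈ D, ∃ u ∈ t, ∀ y, (y ∈ u ∧ y ∈ D) ⇔ y ≐ x).

Definition IsSubspaceTopology (s Y t : var) : fm :=
  ∀ v, v ∈ s ⇔ (∃ u ∈ t, IsInter v u Y).

(** * Open neighbourhood assignments and D-spaces *)

Definition ONA (U X t : var) : fm :=
  IsFunc U X t ∧ (∀ x ∈ X, ∀ u, Maps U x u ⇒ x ∈ u).

(** y ∈ ⋃ U``D *)
Definition InUnionImage (y U D : var) : fm :=
  ∃ x ∈ D, ∃ u, Maps U x u ∧ y ∈ u.

Definition IsDSpace (X t : var) : fm :=
  ∀ U, ONA U X t ⇒
    ∃ D, ClosedDiscrete D X t ∧ (∀ y, InUnionImage y U D ⇔ y ∈ X).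

Definition Finer (V U X : var) : fm :=
  ∀ x ∈ X, ∀ v, ∀ u, Maps V x v ⇒ Maps U x u ⇒ Subset v u.

Definition LocallyCountable (X t : var) : fm :=
  ∃ U, ONA U X t ∧ (∀ x ∈ X, ∀ u, Maps U x u ⇒ CardLtAleph1 u).

Definition Sticky (U D X t : var) : fm :=
  ClosedDiscrete D X t
  ∧ (∀ x ∈ X, (∃ u, Maps U x u ∧ ∃ y, y ∈ u ∧ y ∈ D) ⇒ InUnionImage x U D).

(** D ∈ ℙ^{ℵ₁}_U(X) *)
Definition InPoset (D U X t : var) : fm := Countable D ∧ Sticky U D X t.

(** D ≤ D' in ℙ^{ℵ₁}_U(X) *)
Definition PosetLe (U D D' : var) : fm :=
  Subset D D' ∧ ¬ (∃ x ∈ D', ¬ x ∈ D ∧ InUnionImage x U D).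

Definition StronglyD (X t U : var) : fm :=
  ∀ D, InPoset D U X t ⇒
    ∀ x ∈ X, ∃ D', InPoset D' U X t ∧ PosetLe U D D' ∧ InUnionImage x U D'.

(** V is the function y ↦ U(y) ∩ Y on Y *)
Definition IsTraceONA (V U Y : var) : fm :=
  ∀ p, p ∈ V ⇔
    (∃ y ∈ Y, ∃ u, ∃ v, Maps U y u ∧ IsInter v u Y ∧ IsOPair p y v).

Definition SubspaceStronglyD (Y t U : var) : fm :=
  ∃ s, ∃ V, IsSubspaceTopology s Y t ∧ IsTraceONA V U Y ∧ StronglyD Y s V.

(* Main.v *)
(** Rocq's own universe of types serves as the ground model, and the required model is the class
    of names over a poset, with forcing read as Kripke semantics in regular predicates.

    Under CH, a space [X] as in the theorem is strongly D: a set of size aleph_1 that is closed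
    under [U] and contains a witness for every countable subset which is not sticky is an open
    subspace, and countable sets sticky in it are sticky in [X]. So [X] is D as soon as some
    filter of countable sticky sets meets aleph_2 dense sets. Coding a countable sticky set [D]
    by the function on [U``D] that is 1 on [D] and 0 elsewhere turns the order on sticky sets
    into extension of countable partial functions, and these posets are closed under unions of
    countable compatible families.

    The forcing adds filters for all such posets at once. A coordinate is a name for a set of
    countable partial functions; names refer to earlier coordinates, so coordinates form a W-type,
    and every name of the final model is itself a coordinate: no bookkeeping is needed. A
    condition is a countable partial function on coordinates times ordinals whose value at each
    coordinate is a union of functions which the condition itself puts into the named set.
    Compatible functions then have a union which is a condition, so the forcing is
    sigma-closed, and antichains have size at most 2^omega. Hence omega_1 is preserved, the
    cardinal successor of 2^omega becomes aleph_2, the generic functions at unrestricted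
    coordinates enumerate the reals in type omega_1, and there are more than aleph_2 of them. *)

From Stdlib Require Import List Arith Lia FinFun Cantor.
From Stdlib Require Import Classical ClassicalEpsilon FunctionalExtensionality PropExtensionality.
From Corelib Require Import ssreflect.
From mathcomp Require ssrbool eqtype boolp wochoice.
Require Import Defs.
Set Implicit Arguments.
Unset Strict Implicit.
Unset Printing Implicit Defensive.

(** The obstacle is genericity at a coordinate [c] whose set is only named: a condition forcing a
    larger function [e] into the set may itself have given [c] values that contradict [e].
    Membership, however, is certified by values below [c] alone. So the stronger condition is used
    below [c], [e] is put at [c], and the old condition is kept elsewhere; well-foundedness makes
    this amalgam a condition.

    A single node can name an arbitrary set of pieces because of the chain condition: each
    membership is generated by a family of countable conditions indexed by reals.

    CH is not assumed in the ground model, so ground sizes are measured by surjections from [real].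
    A set of continuum many ground ordinals has size at most aleph_1 in the extension, and the
    closing-off argument can therefore admit every possible value of a forced neighbourhood or
    witness. Closing under ground sequences is enough, since sigma-closure adds no new countable
    sequences. *)

(** * Choice and well-orderings in the ground model *)

Lemma choice_fun A B (R : A -> B -> Prop) : (forall a, exists b, R a b) -> exists f, forall a, R a (f a).
Proof.
move=> h; exists (fun a => proj1_sig (constructive_indefinite_description _ (h a))) => a.
exact: proj2_sig (constructive_indefinite_description _ (h a)).
Qed.

Section WellOrder.
Import ssrbool eqtype boolp wochoice.

(** Mathcomp's well-ordering principle, freed from boolean predicates and eqTypes by the classical
    wrappers. *)
Lemma minimum_principle T : exists R : T -> T -> bool,
  forall A : T -> Prop, (exists x, A x) -> exists! z, A z /\ forall x, A x -> R z x.
Proof.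
have [R wo] := @well_ordering_principle {classic T}.
exists R => A [x Ax].
have [|z [[Az lb] uz]] := wo (fun y : {classic T} => `[< A y >]).
  by exists x; apply/asboolP.
exists z; split.
  by split=> [|y Ay]; [exact/asboolP|apply: lb; apply/asboolP].
move=> y [Ay hy]; apply: uz; split; first exact/asboolP.
by move=> w /asboolP; apply: hy.
Qed.
End WellOrder.

(** Every order law comes from the unique minimum of a set with at most three elements;
    well-foundedness comes from the minimum of the inaccessible points. *)
Lemma well_ordering T : exists lt : T -> T -> Prop,
  well_founded lt /\ (forall x y z, lt x y -> lt y z -> lt x z) /\
  (forall x y, lt x y \/ x = y \/ lt y x).
Proof.
have [R mp] := minimum_principle T.
have two x y : R x y = true \/ R y x = true.
  have [|z [[[->|->] h] _]] := mp (fun z => z = x \/ z = y); first by exists x; left.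
  - by left; apply: h; right.
  - by right; apply: h; left.
have rr x : R x x = true by case: (two x x).
have anti x y : R x y = true -> R y x = true -> x = y.
  move=> h1 h2; have [|z [_ u]] := mp (fun z => z = x \/ z = y); first by exists x; left.
  have <- := u x; last by split; [left|move=> w [->|->]].
  by apply: u; split; [right|move=> w [->|->]].
exists (fun x y => R x y = true /\ x <> y); split.
  move=> x; apply: NNPP => n.
  have [|z [[nz h] _]] := mp (fun z => ~ Acc (fun x y => R x y = true /\ x <> y) z).
    by exists x.
  apply: nz; constructor=> y [yz ne]; apply: NNPP => ny; apply: ne; apply: anti => //; exact: h.
split; last first.
  move=> x y; case: (classic (x = y)) => [|ne]; first by right; left.
  case: (two x y) => h; [left|right; right]; split=> // e; exact: ne.
move=> x y z [xy ne] [yz ne']; split.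
  have [|w [[[->|[->|->]] h] _]] := mp (fun w => w = x \/ w = y \/ w = z).
  - by exists x; left.
  - by apply: h; auto.
  - have -> : x = y by apply: anti => //; apply: h; auto.
    done.
  have e : y = z by apply: anti => //; apply: h; auto.
  by rewrite -e.
move=> e; subst z; apply: ne; exact: anti.
Qed.

(** * Surjections from the reals and closure under countable operations *)

Definition onto A B := exists f : A -> B, forall b, exists a, f a = b.

Lemma onto_refl A : onto A A.
Proof. by exists (fun a => a) => a; exists a. Qed.

Lemma onto_comp A B C : onto A B -> onto B C -> onto A C.
Proof.
move=> [f hf] [g hg]; exists (fun a => g (f a)) => c.
by have [b <-] := hg c; have [a <-] := hf b; exists a.
Qed.

Lemma onto_prod A A' B B' : onto A A' -> onto B B' -> onto (A * B) (A' * B').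
Proof.
move=> [f hf] [g hg]; exists (fun x => (f (fst x), g (snd x))) => -[a b].
by have [x <-] := hf a; have [y <-] := hg b; exists (x, y).
Qed.

Lemma onto_fun I A B : onto A B -> onto (I -> A) (I -> B).
Proof.
move=> [f hf]; exists (fun s i => f (s i)) => t.
have [s hs] := choice_fun (fun i => hf (t i)).
by exists s; apply: functional_extensionality.
Qed.

Definition real := nat -> bool.

Lemma onto_real_seq : onto real (nat -> real).
Proof.
exists (fun r n k => r (to_nat (n, k))) => s.
exists (fun z => s (fst (of_nat z)) (snd (of_nat z))).
by apply: functional_extensionality => n; apply: functional_extensionality => k; rewrite cancel_of_to.
Qed.

Lemma onto_real_prod : onto real (real * real).
Proof.
apply: onto_comp onto_real_seq _; exists (fun s => (s 0, s 1)) => -[a b].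
by exists (fun n => match n with 0 => a | _ => b end).
Qed.

Lemma onto_real_nat : onto real nat.
Proof.
exists (fun r => epsilon (inhabits 0) (fun n => r n = true)) => n.
exists (fun k => k =? n).
have := epsilon_spec (inhabits 0) (fun k => (k =? n) = true).
by move=> h; apply/Nat.eqb_eq; apply: h; exists n; apply: Nat.eqb_refl.
Qed.

Lemma onto_real_bool : onto real bool.
Proof. by exists (fun r => r 0) => b; exists (fun _ => b). Qed.

Lemma onto_real_pair A B : onto real A -> onto real B -> onto real (A * B).
Proof. move=> hA hB; exact: onto_comp onto_real_prod (onto_prod hA hB). Qed.

Lemma onto_real_option A : onto real A -> onto real (option A).
Proof.
move=> h; apply: onto_comp (onto_real_pair onto_real_bool h) _.
exists (fun x => if fst x then Some (snd x) else None) => -[a|]; first by exists (true, a).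
by have [f _] := h; exists (false, f (fun _ => true)).
Qed.

Lemma onto_real_fun A : onto real A -> onto real (nat -> A).
Proof. move=> h; exact: onto_comp onto_real_seq (onto_fun nat h). Qed.

Section Closure.
Context {T J : Type} (st : real -> T) (op : J -> (nat -> T) -> T).

(** A real decodes to a constant or to an operation with a sequence of argument codes. Codes whose
    unfolding is ill-founded evaluate to nothing. *)
Inductive evaluates (d : real -> real + J * (nat -> real)) : real -> T -> Prop :=
| ev_st r i : d r = inl i -> evaluates d r (st i)
| ev_op r j rs f : d r = inr (j, rs) -> (forall n, evaluates d (rs n) (f n)) -> evaluates d r (op j f).

(* Reals code the terms built from [st] and [op], whence the bound on the closure. *)
Lemma closure : onto real J -> exists A : T -> Prop,
  (forall i, A (st i)) /\ (forall j f, (forall n, A (f n)) -> A (op j f)) /\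
  (forall B : T -> Prop, (forall i, B (st i)) ->
     (forall j f, (forall n, B (f n)) -> B (op j f)) -> forall t, A t -> B t) /\
  exists g : real -> T, forall t, A t <-> exists r, g r = t.
Proof.
move=> hJ.
have [d hd] : onto real (real + J * (nat -> real)).
  apply: onto_comp (onto_real_pair onto_real_bool (onto_real_pair onto_real_prod (onto_real_pair hJ onto_real_seq))) _.
  exists (fun x => if fst x then inl (fst (fst (snd x))) else inr (snd (snd x))) => -[r|y].
    by have [f _] := hJ; exists (true, ((r, r), (f r, fun _ => r))).
  by exists (false, ((fun _ => true, fun _ => true), y)).
have fn r t : evaluates d r t -> forall t', evaluates d r t' -> t = t'.
  elim=> {r t} [r i e t' h|r j rs f e hf IH t' h].
    by case: h e => [r' i' ->|r' j' rs' f' -> _] // [->].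
  case: h e => [r' i' ->|r' j' rs' f' -> hf'] // [ej ers]; subst j' rs'.
  congr op; apply: functional_extensionality => n; exact: IH (hf' n).
exists (fun t => exists r, evaluates d r t); split; [|split; [|split]].
- by move=> i; have [r e] := hd (inl i); exists r; apply: ev_st.
- move=> j f /choice_fun [rs hrs]; have [r e] := hd (inr (j, rs)); exists r; exact: ev_op e hrs.
- move=> B B1 B2 t [r]; elim=> // r' j rs f _ _; exact: B2.
have [r0 e0] := hd (inl (fun _ => true)).
(* Codes without a value are sent to a constant, which keeps [g] total with its range inside the
   closure. *)
pose Q r t := evaluates d r t \/ (~ (exists t', evaluates d r t') /\ t = st (fun _ => true)).
have [g hg] : exists g, forall r, Q r (g r).
  apply: choice_fun => r; case: (classic (exists t', evaluates d r t')) => [[t h]|n].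
    by exists t; left.
  by exists (st (fun _ => true)); right.
exists g => t; split=> -[r hr].
  exists r; apply: (fn r (g r) _ t hr); case: (hg r) => // -[n _].
  by case: n; exists t.
rewrite -hr; case: (hg r) => [h|[_ ->]]; first by exists r.
by exists r0; apply: ev_st.
Qed.
End Closure.

(** * Countable partial functions *)

Section PartialFunctions.
Context {K V : Type}.
Implicit Types a b : K -> option V.

Definition enumerates (e : nat -> option K) a := forall k, a k <> None -> exists n, e n = Some k.
Definition countable a := exists e, enumerates e a.
Definition sub a b := forall k v, a k = Some v -> b k = Some v.
Definition compat a b := forall k u v, a k = Some u -> b k = Some v -> u = v.

Lemma sub_refl a : sub a a. Proof. by []. Qed.
Lemma sub_trans a b c : sub a b -> sub b c -> sub a c.
Proof. by move=> h1 h2 k v /h1 /h2. Qed.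
End PartialFunctions.

(** An elementary-submodel argument in place of a delta-system lemma. [A] is closed under a choice
    of solutions in [D] to countable prescriptions on the domains of countably many of its members.
    Given [a], prescribe its values at those points of its domain that lie in the domain of some
    member of [A]. Since [a] itself solves this, [A] contains a solution, and that solution can meet
    the domain of [a] only where it was prescribed. *)
Lemma predense K (D : (K -> option real) -> Prop) a0 : D a0 -> (forall a, D a -> countable a) ->
  exists g : real -> K -> option real, (forall r, D (g r)) /\
    forall a, D a -> exists r, compat a (g r).
Proof.
move=> D0 cD.
have [en hen] : exists en : (K -> option real) -> nat -> option K, forall a, D a -> enumerates (en a) a.
  apply: (choice_fun (R := fun a e => D a -> enumerates e a)) => a.
  case: (classic (D a)) => [/cD [e he]|n]; first by exists e.
  by exists (fun _ => None).
pose ok (j : nat -> nat -> option real) (f : nat -> K -> option real) d :=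
  D d /\ forall n l k u, en (f n) l = Some k -> j n l = Some u -> d k = Some u.
pose op j f := match excluded_middle_informative (exists d, ok j f d) with
  | left _ => epsilon (inhabits a0) (ok j f) | right _ => a0 end.
have opD j f : D (op j f).
  rewrite /op; case: excluded_middle_informative => // h; by case: (epsilon_spec (inhabits a0) _ h).
have [A [Ast [Aop [Amin [g hg]]]]] := @closure _ _ (fun _ => a0) op
  (onto_real_fun (onto_real_fun (onto_real_option (onto_refl real)))).
have AD d : A d -> D d by apply: Amin => // j f _; apply: opD.
exists g; split; first by move=> r; apply: AD; apply/hg; exists r.
move=> a Da.
have [f hf] : exists f : nat -> K -> option real, forall n, A (f n) /\
    forall k, en a n = Some k -> (exists d, A d /\ d k <> None) -> f n k <> None.
  apply: (choice_fun (R := fun n d => A d /\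
    forall k, en a n = Some k -> (exists d, A d /\ d k <> None) -> d k <> None)) => n.
  case: (classic (exists k, en a n = Some k /\ exists d, A d /\ d k <> None)) => [[k [e [d [Ad dk]]]]|h].
    by exists d; split=> // k'; rewrite e => -[<-].
  exists a0; split; first exact: (Ast (fun _ => true)).
  by move=> k e d; case: h; exists k.
pose j n l := match en (f n) l with Some k =>
  match excluded_middle_informative (en a n = Some k) with left _ => a k | right _ => None end
  | None => None end.
have okd : ok j f (op j f).
  rewrite /op; case: excluded_middle_informative => [h|n]; first exact: epsilon_spec.
  case: n; exists a; split=> // n l k u; rewrite /j => ->.
  by case: excluded_middle_informative.
have /hg [r er] : A (op j f) by apply: Aop => n; case: (hf n).
exists r => k u v ak; rewrite er => dk.
have [n en1] : exists n, en a n = Some k by apply: (hen a Da); rewrite ak.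
have fk : f n k <> None.
  by apply: (proj2 (hf n)) => //; exists (op j f); split; [apply/hg; exists r|rewrite dk].
have [l el] := hen (f n) (AD _ (proj1 (hf n))) k fk.
have := proj2 okd n l k u el; rewrite /j el; case: excluded_middle_informative => // _ /(_ ak).
by rewrite dk => -[].
Qed.

(** * Ordinals *)

Record ordinals := Ordinals {
  ord :> Type;
  lt : ord -> ord -> Prop;
  lt_wf : well_founded lt;
  lt_trans : forall x y z, lt x y -> lt y z -> lt x z;
  lt_total : forall x y, lt x y \/ x = y \/ lt y x }.
Arguments lt {o} : rename.

Lemma lt_irr (L : ordinals) (x : L) : ~ lt x x.
Proof. elim: x / (lt_wf x) => x _ IH h; exact: (IH x). Qed.

Definition covered (L : ordinals) A (x : L) := exists f : A -> L, forall y, lt y x -> exists a, f a = y.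

Lemma covered_onto (L : ordinals) A B (x : L) : onto A B -> covered B x -> covered A x.
Proof.
move=> [g hg] [f hf]; exists (fun a => f (g a)) => y /hf [b <-].
by have [a <-] := hg b; exists a.
Qed.

Lemma covered_le (L : ordinals) A (x y : L) : ~ lt x y -> covered A x -> covered A y.
Proof.
move=> n [f hf]; exists f => z zy; apply: hf.
case: (lt_total x y) => [//|[->//|h]]; exact: lt_trans h.
Qed.

Lemma least (L : ordinals) (Q : L -> Prop) x : Q x -> exists y, Q y /\ forall z, lt z y -> ~ Q z.
Proof.
elim: x / (lt_wf x) => x _ IH Qx; case: (classic (exists y, lt y x /\ Q y)) => [[y [h /IH]]|n].
  exact.
by exists x; split=> // z h Qz; apply: n; exists z.
Qed.

Lemma least_uncovered (L : ordinals) A (x : L) : ~ covered A x ->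
  exists y : L, forall z, lt z y <-> covered A z.
Proof.
move=> h; have [y [ny min]] := least (Q := fun y => ~ covered A y) h; exists y => z.
split=> [/min /NNPP //|c]; apply: NNPP => n; apply: ny; exact: covered_le c.
Qed.

Lemma cantor A : ~ onto A (A -> bool).
Proof.
move=> [f hf]; have [a e] := hf (fun a => negb (f a a)).
have := f_equal (fun g => g a) e; by case: (f a a).
Qed.

(** [om1] is the first uncountable ordinal and [om2] the initial ordinal of the successor of
    2^omega, which need not be the second uncountable cardinal of the ground model. *)
Record scale := Scale {
  sord :> ordinals;
  fin : nat -> sord;
  om0 : sord;
  om1 : sord;
  om2 : sord;
  lt_fin : forall i j, lt (fin i) (fin j) <-> i < j;
  lt_om0 : forall x, lt x om0 <-> exists n, x = fin n;
  lt_om1 : forall x, lt x om1 <-> covered nat x;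
  lt_om2 : forall x, lt x om2 <-> covered real x }.
Arguments fin {s}.
Arguments om0 {s}.
Arguments om1 {s}.
Arguments om2 {s}.

Lemma om0_om1 (L : scale) : lt (@om0 L) om1.
Proof. by apply/lt_om1; exists fin => y /lt_om0 [n ->]; exists n. Qed.

(** The countable ordinals are generated from 0 by strict suprema of sequences, so [closure] makes
    them an image of the reals. *)
Lemma om1_om2 (L : scale) : lt (@om1 L) om2.
Proof.
apply/lt_om2.
pose sup (_ : unit) (f : nat -> L) := epsilon (inhabits om0)
  (fun y => (forall n, lt (f n) y) /\ forall z, lt z y -> exists n, ~ lt (f n) z).
have [|A [A0 [As [_ [g hg]]]]] := @closure L unit (fun _ => fin 0) sup.
  by exists (fun _ => tt) => -[]; exists (fun _ => true).
exists g; suff h x : lt x om1 -> A x by move=> y /h /hg.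
elim: x / (lt_wf x) => x _ IH /lt_om1 [f hf].
case: (classic (exists z, lt z x)) => [[z zx]|n]; last first.
  have -> : x = fin 0; last exact: (A0 (fun _ => true)).
  case: (lt_total x (fin 0)) => [h|[//|h]]; last by case: n; exists (fin 0).
  have /lt_om0 [k e] : lt x om0 by apply: lt_trans h _; apply/lt_om0; exists 0.
  by move: h; rewrite e => /lt_fin; lia.
pose f' n := match excluded_middle_informative (lt (f n) x) with left _ => f n | right _ => z end.
have f'x n : lt (f' n) x by rewrite /f'; case: excluded_middle_informative.
have lx : lt x om1 by apply/lt_om1; exists f.
have <- : sup tt f' = x; last by apply: As => n; apply: IH => //; exact: lt_trans lx.
have [|h1 h2] := epsilon_spec (inhabits om0) (fun y => (forall n, lt (f' n) y) /\ forall z, lt z y -> exists n, ~ lt (f' n) z).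
  exists x; split=> // y yx; have [n e] := hf y yx; exists n; rewrite /f' e.
  by case: excluded_middle_informative => // _; apply: lt_irr.
rewrite -/(sup tt f') in h1 h2.
case: (lt_total (sup tt f') x) => [h|[//|h]].
  have [n e] := hf _ h; case: (lt_irr (x := sup tt f')); rewrite -{1}e.
  by have := h1 n; rewrite /f' e; case: excluded_middle_informative.
by have [n []] := h2 x h.
Qed.

(** A well-order of [real -> bool], with a copy of [nat] below it and a top point above it. By
    Cantor the reals do not cover the top, so the least uncovered points exist. *)
Lemma scale_exists : inhabited scale.
Proof.
have [lt0 [wf [tr tot]]] := well_ordering (real -> bool).
pose T := (nat + option (real -> bool))%type.
pose lto (x y : T) := match x, y with
  | inl i, inl j => i < j | inl _, inr _ => True | inr _, inl _ => False
  | inr (Some a), inr (Some b) => lt0 a b | inr (Some a), inr None => True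
  | inr None, _ => False end.
have a1 n : Acc lto (inl n).
  elim/(well_founded_induction Wf_nat.lt_wf): n => n IH; constructor=> -[i|[b|]] h; [exact: IH|exfalso; exact h|exfalso; exact h].
have a2 a : Acc lto (inr (Some a)).
  elim: a / (wf a) => a _ IH; constructor=> -[i|[b|]] h; [exact: a1|exact: IH|exfalso; exact h].
have wfL : well_founded lto.
  move=> [n|[a|]]; [exact: a1|exact: a2|].
  by constructor=> -[i|[b|]] h; [exact: a1|exact: a2|exfalso; exact h].
have trL x y z : lto x y -> lto y z -> lto x z.
  case: x y z => [i|[a|]] [j|[b|]] [k|[c|]] //=; [lia|exact: tr].
have totL x y : lto x y \/ x = y \/ lto y x.
  case: x y => [i|[a|]] [j|[b|]] /=; try tauto.
    by have [|[->|]] := Nat.lt_trichotomy i j; tauto.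
  by have [|[->|]] := tot a b; tauto.
pose L := Ordinals wfL trL totL.
have top : ~ covered real (inr None : L).
  move=> [f hf]; apply: (@cantor real).
  exists (fun r => match f r with inr (Some g) => g | _ => fun _ => true end) => g.
  by have [|r e] := hf (inr (Some g)) => //; exists r; rewrite e.
have [m2 h2] := least_uncovered top.
have [m1 h1] : exists y : L, forall z, lt z y <-> covered nat z.
  by apply: (@least_uncovered L nat (inr None)) => c; apply: top; exact: covered_onto onto_real_nat c.
have [m0 [[x0 e0] min]] : exists y : L, (exists o, y = inr o) /\ forall z : L, lt z y -> ~ exists o, z = inr o.
  by apply: (least (x := inr None : L)); exists None.
constructor; refine (@Scale L inl m0 m1 m2 _ _ h1 h2) => // x.
split=> [|[n ->]]; last by rewrite e0.
case: x => [n|o] h; first by exists n.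
by case: (min _ h); exists o.
Qed.

(** * Order types of sets of ordinals *)

Section OrderType.
Context {L : ordinals}.
Implicit Types (x y z : L) (Z : L -> Prop).

(** The least strict upper bound of the values at the members of [Z] below [x], that is, the order
    type of [Z] below [x]. *)
Definition otype Z : L -> L := Fix (@lt_wf L) (fun _ => L) (fun x rec =>
  epsilon (inhabits x) (fun y => (forall z (h : lt z x), Z z -> lt (rec z h) y) /\
    forall w, lt w y -> ~ (forall z (h : lt z x), Z z -> lt (rec z h) w))).

(** All three parts share one induction: the last one, at smaller arguments, makes [x] itself a
    bound, so that the least bound sought by [epsilon] exists. *)
Lemma otypeP Z x : (forall z, lt z x -> Z z -> lt (otype Z z) (otype Z x)) /\
  (forall w, lt w (otype Z x) -> exists z, lt z x /\ Z z /\ ~ lt (otype Z z) w) /\ ~ lt x (otype Z x).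
Proof.
elim: x / (lt_wf x) => x _ IH.
pose Q y := (forall z (h : lt z x), Z z -> lt (otype Z z) y).
have E : otype Z x = epsilon (inhabits x) (fun y => Q y /\ forall w, lt w y -> ~ Q w).
  rewrite {1}/otype Fix_eq // => y f g h; congr epsilon.
  by have -> : f = g by apply: functional_extensionality_dep => z; apply: functional_extensionality_dep.
have Qx : Q x.
  move=> z zx _; have [_ [_ n]] := IH z zx.
  by case: (lt_total (otype Z z) x) => [//|[e|h]]; case: n; rewrite ?e //; apply: lt_trans h.
have [|h1 h2] := epsilon_spec (inhabits x) (fun y => Q y /\ forall w, lt w y -> ~ Q w).
  exact: least Qx.
rewrite -E in h1 h2; split; first exact: h1; split; last by move=> /h2.
move=> w /h2 n; apply: NNPP => n'; apply: n => z zx Zz; apply: NNPP => n; apply: n'.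
by exists z.
Qed.

Lemma otype_onto Z x y : lt y (otype Z x) -> exists z, lt z x /\ Z z /\ otype Z z = y.
Proof.
elim: x / (lt_wf x) => x _ IH /(proj1 (proj2 (otypeP Z x))) [z [zx [Zz n]]].
case: (lt_total (otype Z z) y) => [//|[e|/IH h]]; first by exists z.
have [w [wz ?]] := h zx; exists w; split=> //; exact: lt_trans zx.
Qed.

Lemma otype_ext Z Z' x : (forall z, lt z x -> (Z z <-> Z' z)) -> otype Z x = otype Z' x.
Proof.
elim: x / (lt_wf x) => x _ IH h.
have e z : lt z x -> otype Z z = otype Z' z.
  by move=> zx; apply: IH => // w wz; apply: h; apply: lt_trans zx.
case: (lt_total (otype Z x) (otype Z' x)) => [k|[//|k]].
  have [z [zx [/h Zz n]]] := proj1 (proj2 (otypeP Z' x)) _ k.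
  by case: n; rewrite -e //; apply: (proj1 (otypeP Z x)) => //; apply: Zz.
have [z [zx [/h Zz n]]] := proj1 (proj2 (otypeP Z x)) _ k.
by case: n; rewrite e //; apply: (proj1 (otypeP Z' x)) => //; apply: Zz.
Qed.
End OrderType.

(** * Regular predicates as truth values *)

Record poset := Poset {
  car :> Type;
  le : car -> car -> Prop;
  le_refl : forall x, le x x;
  le_trans : forall x y z, le x y -> le y z -> le x z }.
Arguments le {p} : rename.
Arguments le_refl {p} x : rename.
Arguments le_trans {p x y z} : rename.

(** Larger is stronger: [q] extends [p]. *)
Notation "p ⊑ q" := (le p q) (at level 70, no associativity).

Section Forcing.
Context {P : poset}.
Implicit Types p q r : P.

(** A truth value is a regular open set in the topology of up-sets. [reg] admits every condition
    above which the set is dense, and this makes the logic classical. *)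
Record om := Om {
  val : P -> Prop;
  mono : forall p q, p ⊑ q -> val p -> val q;
  reg : forall p, (forall q, p ⊑ q -> exists r, q ⊑ r /\ val r) -> val p }.

Program Definition oBot : om := @Om (fun _ => False) _ _.
Next Obligation.
have [r [_ []]] := H p (le_refl p).
Qed.

Program Definition oLift (A : Prop) : om := @Om (fun _ => A) _ _.
Next Obligation. by have [r [_ ?]] := H p (le_refl p). Qed.

Program Definition oImp (A B : om) : om :=
  @Om (fun p => forall q, p ⊑ q -> val A q -> val B q) _ _.
Next Obligation. apply: H0 => //; exact: le_trans H1. Qed.
Next Obligation.
apply: reg => r qr; have [s [rs h]] := H r (le_trans H0 qr).
exists s; split=> //; apply: h (le_refl s) _.
apply: mono H1; exact: le_trans rs.
Qed.

Program Definition oAll (T : Type) (A : T -> om) : om :=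
  @Om (fun p => forall t, val (A t) p) _ _.
Next Obligation. exact: mono (H0 t). Qed.
Next Obligation.
apply: reg => r qr; have [s [rs h]] := H r qr; by exists s.
Qed.

(** The regular open set generated by an arbitrary [S]: the conditions above which the extensions of
    members of [S] are dense. *)
Program Definition oGen (S : P -> Prop) : om :=
  @Om (fun p => forall q, p ⊑ q -> exists r s, q ⊑ r /\ s ⊑ r /\ S s) _ _.
Next Obligation. apply: H0; exact: le_trans H1. Qed.
Next Obligation.
have [r [qr h]] := H _ H0; have [r' [s [rr' [sr' ?]]]] := h r (le_refl _).
exists r', s; split => //; exact: le_trans rr'.
Qed.

(** These are built from implication, falsity and universal quantification exactly as the named
    formulas are, so that [sem] of a formula converts to its shallow form. *)
Definition oNot A := oImp A oBot.
Definition oAnd A B := oNot (oImp A (oNot B)).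
Definition oOr A B := oImp (oNot A) B.
Definition oIff A B := oAnd (oImp A B) (oImp B A).
Definition oEx (T : Type) (A : T -> om) := oNot (oAll (fun x => oNot (A x))).

Lemma dn A p : (forall q, p ⊑ q -> ~ (forall r, q ⊑ r -> ~ val A r)) -> val A p.
Proof.
move=> h; apply: reg => q pq; apply: NNPP => n; apply: (h _ pq) => r qr Ar.
by apply: n; exists r.
Qed.

Lemma oAndP A B p : val (oAnd A B) p <-> val A p /\ val B p.
Proof.
split; last first.
  move=> [a b] q pq h; apply: (h _ (le_refl _) (mono pq a) _ (le_refl _) (mono pq b)).
move=> h; split; apply: dn => q pq n; apply: (h _ pq) => r qr Ar; first by case: (n _ qr).
move=> s rs Bs; apply: (n s) => //; exact: le_trans rs.
Qed.

Lemma oAndI A B p : val A p -> val B p -> val (oAnd A B) p.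
Proof. by move=> *; apply/oAndP. Qed.

Lemma oIffP A B p : val (oIff A B) p <-> val (oImp A B) p /\ val (oImp B A) p.
Proof. exact: oAndP. Qed.

Lemma oIffI A B p : (forall q, p ⊑ q -> (val A q <-> val B q)) -> val (oIff A B) p.
Proof. by move=> h; apply: oAndI => q pq; case: (h q pq). Qed.

Lemma oIffE A B p : val (oIff A B) p -> (val A p <-> val B p).
Proof. move=> /oIffP [h1 h2]; split; [exact: h1 (le_refl _)|exact: h2 (le_refl _)]. Qed.

Lemma oAllE T (A : T -> om) p : val (oAll A) p -> forall t, val (A t) p.
Proof. exact. Qed.

Lemma oImpE A B p : val (oImp A B) p -> val A p -> val B p.
Proof. move=> h; exact: h (le_refl _). Qed.

Lemma oExI T (A : T -> om) x p : val (A x) p -> val (oEx A) p.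
Proof. by move=> h q pq n; apply: (n x q (le_refl _)); exact: mono h. Qed.

Lemma oExE T (A : T -> om) C p :
  val (oEx A) p -> (forall q, p ⊑ q -> forall x, val (A x) q -> val C q) -> val C p.
Proof.
move=> h k; apply: dn => q pq n; apply: (h _ pq) => x r qr Ax.
apply: (n r qr); apply: k Ax; exact: le_trans qr.
Qed.

Lemma oEx_dense T (A : T -> om) p :
  val (oEx A) p -> exists q, p ⊑ q /\ exists x, val (A x) q.
Proof.
move=> h; apply: NNPP => n; apply: (h _ (le_refl _)) => x q pq Ax; apply: n.
by exists q; split=> //; exists x.
Qed.

Lemma oExD T (A : T -> om) p :
  (forall q, p ⊑ q -> exists r, q ⊑ r /\ exists x, val (A x) r) -> val (oEx A) p.
Proof.
move=> h; apply: reg => q pq; have [r [qr [x Ax]]] := h q pq.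
by exists r; split=> //; apply: oExI Ax.
Qed.

Lemma oOrI1 A B p : val A p -> val (oOr A B) p.
Proof. by move=> a q pq n; case: (n q (le_refl _)); exact: mono a. Qed.

Lemma oOrI2 A B p : val B p -> val (oOr A B) p.
Proof. by move=> b q pq _; exact: mono b. Qed.

Lemma oEm A C p : (forall q, p ⊑ q -> val A q -> val C q) ->
  (forall q, p ⊑ q -> val (oNot A) q -> val C q) -> val C p.
Proof.
move=> h1 h2; apply: dn => q pq n; apply: (n q (le_refl _)); apply: h2 => // r qr Ar.
apply: (n r qr); apply: h1 => //; exact: le_trans qr.
Qed.

Lemma oOrE A B C p : val (oOr A B) p -> (forall q, p ⊑ q -> val A q -> val C q) ->
  (forall q, p ⊑ q -> val B q -> val C q) -> val C p.
Proof.
move=> h hA hB; apply: (oEm (A := A)) => // q pq nA; apply: hB => //; exact: h.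
Qed.

Lemma oDec A p : exists q, p ⊑ q /\ (val A q \/ val (oNot A) q).
Proof.
case: (classic (exists q, p ⊑ q /\ val A q)) => [[q [pq Aq]]|n].
  by exists q; split; [|left].
by exists p; split; [exact: le_refl|right] => q pq Aq; apply: n; exists q.
Qed.

Lemma oLiftI (A : Prop) p : A -> val (oLift A) p.
Proof. by []. Qed.

Lemma oLiftE (A : Prop) p : val (oLift A) p -> A.
Proof. by []. Qed.

Lemma oNotE A p : val (oNot A) p -> val A p -> False.
Proof. move=> h; exact: h (le_refl _). Qed.

Lemma oGenI (S : P -> Prop) p s : S s -> s ⊑ p -> val (oGen S) p.
Proof. by move=> Ss sp q pq; exists q, s; split; [exact: le_refl|split=> //; exact: le_trans pq]. Qed.

(** * Names *)

(** The name [el i] is an element with truth value [S i]. Index types range over a universe, which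
    thereby acts as the class of ground sets. *)
Inductive name := mk (I : Type) (el : I -> name) (S : I -> om).
Arguments mk : clear implicits.

Fixpoint oEq (x y : name) {struct x} : om :=
  match x, y with
  | mk K a U, mk J b V =>
    oAnd (oAll (fun i => oImp (U i) (oEx (fun j => oAnd (V j) (oEq (a i) (b j))))))
         (oAll (fun j => oImp (V j) (oEx (fun i => oAnd (U i) (oEq (a i) (b j))))))
  end.

Definition oMem (x y : name) : om :=
  match y with mk J b V => oEx (fun j => oAnd (V j) (oEq x (b j))) end.
End Forcing.

Arguments om P : clear implicits.
Arguments name P : clear implicits.
Arguments mk {P}.
(* Conversion must compare formulas before unfolding the connectives; otherwise the link between
   [sem] and the forced notions below does not reduce in reasonable time. *)
Strategy 1000 [oImp oAll oBot oLift oEq oMem oGen].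
Arguments oImp : simpl never.
Arguments oAll : simpl never.
Arguments oNot : simpl never.
Arguments oAnd : simpl never.
Arguments oOr : simpl never.
Arguments oIff : simpl never.
Arguments oEx : simpl never.
Arguments val : simpl never.

Declare Scope om_scope.
Delimit Scope om_scope with om.
Bind Scope om_scope with om.
Notation "p ⊩ A" := (val A%om p) (at level 94, no associativity).
Notation "⌜ A ⌝" := (oLift A%type) : om_scope.
Notation "⊥" := oBot : om_scope.
Notation "x ≐ y" := (oEq x y) (at level 70, no associativity) : om_scope.
Notation "x ∈ y" := (oMem x y) (at level 70, no associativity) : om_scope.
Notation "¬ A" := (oNot A) (at level 75, right associativity) : om_scope.
Notation "A ∧ B" := (oAnd A B) (at level 80, right associativity) : om_scope.
Notation "A ∨ B" := (oOr A B) (at level 85, right associativity) : om_scope.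
Notation "A ⇒ B" := (oImp A B) (at level 90, right associativity) : om_scope.
Notation "A ⇔ B" := (oIff A B) (at level 95, no associativity) : om_scope.
Notation "∀ x , A" := (oAll (fun x => A))
  (at level 200, x name, A at level 200, right associativity) : om_scope.
Notation "∃ x , A" := (oEx (fun x => A))
  (at level 200, x name, A at level 200, right associativity) : om_scope.
Notation "∀ x ∈ a , A" := (oAll (fun x => oImp (oMem x a) A))
  (at level 200, x name, a at level 69, A at level 200,
   right associativity) : om_scope.
Notation "∃ x ∈ a , A" := (oEx (fun x => oAnd (oMem x a) A))
  (at level 200, x name, a at level 69, A at level 200,
   right associativity) : om_scope.
Local Open Scope om_scope.

(* [lift l], for [l : p ⊑ q], moves all forced hypotheses from [p] to the stronger condition
   [q] and renames [q] to [p]. *)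
Ltac lift l :=
  lazymatch type of l with
  | le ?p ?q =>
    repeat match goal with
    | h : val _ p |- _ => apply (mono l) in h
    | h : le ?z p |- _ => apply (fun a => le_trans a l) in h
    | h : forall a : ?T, val (@?A a) p |- _ =>
      let k := fresh in pose proof (fun a => mono l (h a)) as k; cbv beta in k; clear h; rename k into h
    | h : forall (a : ?T) (b : @?U a), val (@?A a b) p |- _ =>
      let k := fresh in pose proof (fun a b => mono l (h a b)) as k; cbv beta in k; clear h; rename k into h
    | h : forall (a : ?T) (b : @?U a) (c : @?V a b), val (@?A a b c) p |- _ =>
      let k := fresh in pose proof (fun a b c => mono l (h a b c)) as k; cbv beta in k; clear h; rename k into h
    end;
    try (clear l; clear p; rename q into p)
  end.

Ltac drop H := try match goal with h : _ |- _ => constr_eq h H; clear h end.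

(* These tactics introduce an implication, or eliminate an existential, a disjunction or a case
   distinction. Each passes to a stronger condition, and [lift] hides the passage. *)
Tactic Notation "oi" simple_intropattern(h) :=
  let q := fresh "q" in let l := fresh "l" in
  intros q l; lift l; intros h; cbv beta in *.
Tactic Notation "oa" ident(x) simple_intropattern(h) := intros x; cbv beta; oi h.
Tactic Notation "oex" constr(H) "as" simple_intropattern(x) simple_intropattern(h) :=
  let q := fresh "q" in let l := fresh "l" in
  refine (oExE H _); drop H; intros q l; cbv beta; lift l; intros x h.
Tactic Notation "oor" constr(H) "as" simple_intropattern(h) :=
  let q := fresh "q" in let l := fresh "l" in
  refine (oOrE H _ _); drop H; intros q l; lift l; intros h.
Tactic Notation "oem" uconstr(A) "as" simple_intropattern(h) :=
  let q := fresh "q" in let l := fresh "l" in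
  refine (oEm (A := A) _ _); intros q l; lift l; intros h.

Section Names.
Context {P : poset}.
Implicit Types p q r : P.
Implicit Types x y z a b c : name P.

Lemma feq_refl x p : p ⊩ x ≐ x.
Proof.
elim: x p => I a IH S p /=; apply: oAndI => i; oi h; apply: (oExI (x := i)); exact: oAndI h (IH _ _).
Qed.

Lemma feq_sym x y p : p ⊩ x ≐ y -> p ⊩ y ≐ x.
Proof.
elim: x y p => I a IH S [J b T] p /= /oAndP [h1 h2]; apply: oAndI => i; oi hi.
  oex (oImpE (h2 i) hi) as j [hj e]%oAndP; apply: (oExI (x := j)); apply: oAndI => //; exact: IH.
oex (oImpE (h1 i) hi) as j [hj e]%oAndP; apply: (oExI (x := j)); apply: oAndI => //; exact: IH.
Qed.

Lemma feq_trans x y z p : p ⊩ x ≐ y -> p ⊩ y ≐ z -> p ⊩ x ≐ z.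
Proof.
elim: x y z p => I a IH S [J b T] [K c U] p /= /oAndP [h1 h2] /oAndP [k1 k2].
apply: oAndI => i; oi hi.
  oex (oImpE (h1 i) hi) as j [hj e]%oAndP; oex (oImpE (k1 j) hj) as k [hk e']%oAndP.
  apply: (oExI (x := k)); apply: oAndI => //; exact: IH e e'.
oex (oImpE (k2 i) hi) as j [hj e]%oAndP; oex (oImpE (h2 j) hj) as k [hk e']%oAndP.
apply: (oExI (x := k)); apply: oAndI => //; exact: IH e' e.
Qed.

Lemma mem_el I (el : I -> name P) S i p : p ⊩ S i -> p ⊩ el i ∈ mk I el S.
Proof. move=> h; apply: (oExI (x := i)); apply: oAndI => //; exact: feq_refl. Qed.

Lemma mem_eql x x' y p : p ⊩ x ≐ x' -> p ⊩ x ∈ y -> p ⊩ x' ∈ y.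
Proof.
case: y => J b T e h; oex h as j [hj e']%oAndP; apply: (oExI (x := j)).
apply: oAndI => //; exact: feq_trans (feq_sym e) e'.
Qed.

Lemma mem_eqr x y y' p : p ⊩ y ≐ y' -> p ⊩ x ∈ y -> p ⊩ x ∈ y'.
Proof.
case: y => J b T; case: y' => K c U /= /oAndP [e _] h; oex h as j [hj e']%oAndP.
oex (oImpE (e j) hj) as k [hk e'']%oAndP; apply: (oExI (x := k)); apply: oAndI => //.
exact: feq_trans e' e''.
Qed.

Lemma ext_eq a b p :
  (forall q, p ⊑ q -> forall x, q ⊩ x ∈ a -> q ⊩ x ∈ b) ->
  (forall q, p ⊑ q -> forall x, q ⊩ x ∈ b -> q ⊩ x ∈ a) -> p ⊩ a ≐ b.
Proof.
case: a => I a S; case: b => J b T h1 h2; apply: oAndI => i q pq hi.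
  exact: (h1 q pq (a i) (mem_el hi)).
have h := h2 q pq (b i) (mem_el hi); refine (oExE h _) => r qr j /oAndP [hj e].
by apply: (oExI (x := j)); apply: oAndI => //; apply: feq_sym.
Qed.

(** * Semantics of formulas *)

Definition econs (x : name P) (e : nat -> name P) (i : nat) : name P :=
  match i with 0 => x | S j => e j end.

Fixpoint sem (A : form) (e : nat -> name P) : om P :=
  match A with
  | fBot => ⊥
  | fEq i j => e i ≐ e j
  | fIn i j => e i ∈ e j
  | fImp B C => sem B e ⇒ sem C e
  | fAll B => ∀ x, sem B (econs x e)
  end.

Lemma sem_ren f A e : sem (ren f A) e = sem A (fun i => e (f i)).
Proof.
elim: A f e => //= [B IHB C IHC|B IH] f e; first by rewrite IHB IHC.
congr oAll; apply: functional_extensionality => x; rewrite IH; congr sem.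
by apply: functional_extensionality; case.
Qed.

Lemma sem_ext A e e' p : (forall i, p ⊩ e i ≐ e' i) -> p ⊩ sem A e -> p ⊩ sem A e'.
Proof.
elim: A e e' p => //= [i j|i j|B IHB C IHC|B IH] e e' p h.
- move=> k; apply: feq_trans (h j); apply: feq_trans k; exact: feq_sym.
- move=> k; apply: mem_eqr (h j) _; exact: mem_eql k.
- move=> k q pq hB; apply: IHC (k q pq _) => [i|]; first exact: mono (h i).
  apply: IHB hB => i; apply: feq_sym; exact: mono (h i).
- by move=> k x; apply: IH (k x) => -[|i] //=; apply: feq_refl.
Qed.

Lemma sem_inst n A e : sem (inst n A) e = sem A (econs (e n) e).
Proof. by rewrite sem_ren; congr sem; apply: functional_extensionality; case. Qed.

Lemma soundness G A : prv G A ->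
  forall e p, (forall B, In B G -> p ⊩ sem B e) -> p ⊩ sem A e.
Proof.
elim=> {G A} /=.
- by move=> G A h e p; apply.
- move=> G A B _ IH e p h q pq hA; apply: IH => C [<-|] // hC; exact: mono (h _ hC).
- move=> G A B _ IH1 _ IH2 e p h; exact: oImpE (IH1 _ _ h) (IH2 _ _ h).
- move=> G A _ IH e p h; apply: dn => q pq n; apply: (IH e q) => C [<-|hC] /=.
    by move=> r qr Ar; apply: (n r).
  exact: mono (h _ hC).
- move=> G A _ IH e p h x; apply: IH => B /in_map_iff [C [<- hC]].
  rewrite sem_ren; exact: h.
- by move=> G A x _ IH e p h; rewrite sem_inst; apply: IH.
- by move=> *; apply: feq_refl.
- move=> G A x y _ IH1 _ IH2 e p h; move: (IH2 e p h); rewrite !sem_inst.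
  by apply: sem_ext => -[|i] /=; [exact: IH1|apply: feq_refl].
Qed.

Lemma sem_fAlls n A e p : (forall e', p ⊩ sem A e') -> p ⊩ sem (fAlls n A) e.
Proof. by elim: n e => //= n IH e h x; apply: IH. Qed.

Lemma soundness_consistent (T : theory) (p0 : P) (e0 : nat -> name P) :
  (forall A, T A -> forall e, p0 ⊩ sem A e) -> consistent T.
Proof.
by move=> h [G [hG /soundness pf]]; apply: (pf e0 p0) => B /hG /h.
Qed.

(** * Building names *)

(** Congruence for forced equality, the requirement under which [sep] has the intended elements. *)
Definition Ext (F : name P -> om P) := forall p x y, p ⊩ x ≐ y -> p ⊩ F x -> p ⊩ F y.

Definition sep (a : name P) (F : name P -> om P) : name P :=
  match a with mk K el U => mk K el (fun i => U i ∧ F (el i)) end.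

Lemma sepP a F p x : Ext F -> p ⊩ x ∈ sep a F <-> (p ⊩ x ∈ a) /\ (p ⊩ F x).
Proof.
case: a => I el S eF; split.
  move=> h; split; oex h as i [[hi hF]%oAndP e]%oAndP.
    by apply: (oExI (x := i)); apply: oAndI.
  exact: eF (feq_sym e) hF.
move=> [h hF]; oex h as i [hi e]%oAndP; apply: (oExI (x := i)).
apply: oAndI => //; apply: oAndI => //; exact: eF e hF.
Qed.

Definition upair a b : name P := mk bool (fun i => if i then a else b) (fun _ => ⌜True⌝).

Lemma upairP a b x p : p ⊩ x ∈ upair a b <-> p ⊩ x ≐ a ∨ x ≐ b.
Proof.
split=> h.
  by oex h as [] [_ e]%oAndP; [apply: oOrI1|apply: oOrI2].
oor h as e; [apply: (oExI (x := true))|apply: (oExI (x := false))]; exact: oAndI.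
Qed.

Definition ix a : Type := match a with mk K _ _ => K end.
Definition el a : ix a -> name P := match a with mk _ el _ => el end.
Definition ixv a : ix a -> om P := match a with mk _ _ V => V end.

Arguments el {a}.
Arguments ixv {a}.

Lemma memP x a p : p ⊩ x ∈ a <-> p ⊩ (∃ i, @ixv a i ∧ x ≐ el i).
Proof. by case: a. Qed.

Definition bigU a : name P :=
  mk {i : ix a & ix (el i)} (fun k => el (projT2 k))
     (fun k => ixv (projT1 k) ∧ ixv (projT2 k)).

Lemma bigUP a x p : p ⊩ x ∈ bigU a <-> p ⊩ (∃ y ∈ a, x ∈ y).
Proof.
split=> h.
  oex h as [i j] [[hi hj]%oAndP e]%oAndP; apply: (oExI (x := el i)); apply: oAndI.
    apply/memP; apply: (oExI (x := i)); apply: oAndI => //; exact: feq_refl.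
  apply/memP; apply: (oExI (x := j)); exact: oAndI.
oex h as y [hy%memP hx]%oAndP; oex hy as i [hi e]%oAndP.
move: hx => /(mem_eqr e)/memP hx; oex hx as j [hj e']%oAndP.
by apply: (oExI (x := existT _ i j)); apply: oAndI => //; apply: oAndI.
Qed.

(** Every subset of [a] is forced equal to one given by truth values on the indices of [a], so these
    functions suffice as indices of the power set. *)
Definition pow a : name P := mk (ix a -> om P) (fun V => mk (ix a) el (fun i => ixv i ∧ V i)) (fun _ => ⌜True⌝).

Lemma powP a x p : p ⊩ x ∈ pow a <-> p ⊩ (∀ y ∈ x, y ∈ a).
Proof.
split=> h.
  oa y hy; oex h as V [_ e]%oAndP.
  move: hy => /(mem_eqr e) hy; oex hy as i [[hi _]%oAndP e']%oAndP.
  by apply/memP; apply: (oExI (x := i)); apply: oAndI.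
apply: (oExI (x := fun i => el i ∈ x)); apply: oAndI => //=; apply: ext_eq => q pq y hy.
  have /memP hy' := h y q pq hy; refine (oExE hy' _) => r qr i /oAndP [hi e].
  apply: (oExI (x := i)); apply: oAndI => //; apply: oAndI => //.
  exact: mem_eql e (mono qr hy).
by refine (oExE hy _) => r qr i /oAndP [/oAndP [hi hx] e]; apply: mem_eql (feq_sym e) hx.
Qed.

Definition succ a : name P := mk (option (ix a)) (fun i => match i with None => a | Some j => el j end)
  (fun i => match i with None => ⌜True⌝ | Some j => ixv j end).

Lemma succP a x p : p ⊩ x ∈ succ a <-> p ⊩ x ∈ a ∨ x ≐ a.
Proof.
split=> h.
  oex h as [i|] [hi e]%oAndP; [apply: oOrI1|exact: oOrI2].
  by apply/memP; apply: (oExI (x := i)); apply: oAndI.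
oor h as hx; last by apply: (oExI (x := None)); apply: oAndI.
move: hx => /memP hx; oex hx as i hi; exact: (oExI (x := Some i)).
Qed.
End Names.
Arguments el {P a}.
Arguments ixv {P a}.
Arguments ix {P}.

(** * Forced set-theoretic notions *)

Section Shallow.
Context {P : poset}.
(** These copies of the formulas take names as arguments; forcing a formula converts to forcing its
    copy, which avoids index bookkeeping. *)
Definition sSubset (a b : name P) : om P := ∀ x ∈ a, x ∈ b.
Definition sIsEmpty (a : name P) : om P := ∀ x, ¬ x ∈ a.
Definition sIsPair (p a b : name P) : om P := ∀ x, x ∈ p ⇔ (x ≐ a ∨ x ≐ b).
Definition sIsInter (c a b : name P) : om P := ∀ x, x ∈ c ⇔ (x ∈ a ∧ x ∈ b).
Definition sIsDiff (c a b : name P) : om P := ∀ x, x ∈ c ⇔ (x ∈ a ∧ ¬ x ∈ b).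
Definition sIsUnion (u s : name P) : om P := ∀ x, x ∈ u ⇔ (∃ a ∈ s, x ∈ a).
Definition sIsPower (p a : name P) : om P := ∀ x, x ∈ p ⇔ sSubset x a.
Definition sIsSucc (s a : name P) : om P := ∀ x, x ∈ s ⇔ (x ∈ a ∨ x ≐ a).
Definition sIsOPair (p a b : name P) : om P :=
  ∃ u, ∃ v, sIsPair u a a ∧ sIsPair v a b ∧ sIsPair p u v.
Definition sMaps (f a b : name P) : om P := ∃ p ∈ f, sIsOPair p a b.
Definition sIsFunc (f A B : name P) : om P :=
  (∀ p ∈ f, ∃ a ∈ A, ∃ b ∈ B, sIsOPair p a b)
  ∧ (∀ a ∈ A, ∃ b, sMaps f a b)
  ∧ (∀ a, ∀ b, ∀ c, sMaps f a b ⇒ sMaps f a c ⇒ b ≐ c).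
Definition sIsInj (f A B : name P) : om P :=
  sIsFunc f A B ∧ (∀ a, ∀ b, ∀ c, sMaps f a c ⇒ sMaps f b c ⇒ a ≐ b).
Definition sIsBij (f A B : name P) : om P :=
  sIsInj f A B ∧ (∀ b ∈ B, ∃ a, sMaps f a b).
Definition sCardLe (A B : name P) : om P := ∃ f, sIsInj f A B.
Definition sCardEq (A B : name P) : om P := ∃ f, sIsBij f A B.
Definition sCardLt (A B : name P) : om P := sCardLe A B ∧ ¬ sCardEq A B.
Definition sTransitive (a : name P) : om P := ∀ x ∈ a, sSubset x a.
Definition sOrdinal (a : name P) : om P := sTransitive a ∧ (∀ x ∈ a, sTransitive x).
Definition sLimit (a : name P) : om P :=
  sOrdinal a ∧ (∃ x, x ∈ a) ∧ (∀ x ∈ a, ∃ s ∈ a, sIsSucc s x).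
Definition sCardinal (k : name P) : om P := sOrdinal k ∧ (∀ a ∈ k, ¬ sCardEq a k).
Definition sIsCardSucc (l k : name P) : om P :=
  sCardinal l ∧ k ∈ l ∧ (∀ m, sCardinal m ⇒ k ∈ m ⇒ sSubset l m).
Definition sIsAleph0 (w : name P) : om P := sLimit w ∧ (∀ a ∈ w, ¬ sLimit a).
Definition sIsAleph1 (k : name P) : om P := ∃ w, sIsAleph0 w ∧ sIsCardSucc k w.
Definition sIsAleph2 (k : name P) : om P := ∃ l, sIsAleph1 l ∧ sIsCardSucc k l.
Definition sCountable (A : name P) : om P := ∃ w, sIsAleph0 w ∧ sCardLe A w.
Definition sCardLtAleph1 (A : name P) : om P := ∃ k, sIsAleph1 k ∧ sCardLt A k.
Definition sCardLeAleph1 (A : name P) : om P := ∃ k, sIsAleph1 k ∧ sCardLe A k.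
Definition sCardLeAleph2 (A : name P) : om P := ∃ k, sIsAleph2 k ∧ sCardLe A k.
Definition sCH : om P :=
  ∃ w, ∃ k, ∃ p, sIsAleph0 w ∧ sIsAleph1 k ∧ sIsPower p w ∧ sCardEq p k.
Definition sTwoToAleph1GtAleph2 : om P :=
  ∃ k, ∃ l, ∃ p, sIsAleph1 k ∧ sIsAleph2 l ∧ sIsPower p k ∧ sCardLt l p.
Definition sExtensionality : om P :=
  ∀ a, ∀ b, (∀ x, x ∈ a ⇔ x ∈ b) ⇒ a ≐ b.
Definition sFoundation : om P :=
  ∀ a, (∃ x, x ∈ a) ⇒ ∃ x ∈ a, ∀ y ∈ x, ¬ y ∈ a.
Definition sPairing : om P := ∀ a, ∀ b, ∃ p, sIsPair p a b.
Definition sUnion : om P := ∀ s, ∃ u, sIsUnion u s.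
Definition sPowerSet : om P := ∀ a, ∃ p, sIsPower p a.
Definition sInfinity : om P :=
  ∃ i, (∃ e ∈ i, sIsEmpty e) ∧ (∀ x ∈ i, ∃ s ∈ i, sIsSucc s x).
Definition sChoice : om P :=
  ∀ s, (∀ a ∈ s, ∃ x, x ∈ a)
    ⇒ (∀ a ∈ s, ∀ b ∈ s, (∃ x, x ∈ a ∧ x ∈ b) ⇒ a ≐ b)
    ⇒ ∃ c, ∀ a ∈ s, ∃ x, ∀ y, (y ∈ a ∧ y ∈ c) ⇔ y ≐ x.
Definition sIsTopology (X t : name P) : om P :=
  (∀ u ∈ t, sSubset u X)
  ∧ X ∈ t
  ∧ (∃ e ∈ t, sIsEmpty e)
  ∧ (∀ u ∈ t, ∀ v ∈ t, ∃ w ∈ t, sIsInter w u v)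
  ∧ (∀ s, sSubset s t ⇒ ∃ u ∈ t, sIsUnion u s).
Definition sHausdorff (X t : name P) : om P :=
  ∀ x ∈ X, ∀ y ∈ X, ¬ x ≐ y ⇒
    ∃ u ∈ t, ∃ v ∈ t, x ∈ u ∧ y ∈ v ∧ ¬ (∃ z, z ∈ u ∧ z ∈ v).
Definition sClosedDiscrete (D X t : name P) : om P :=
  sSubset D X
  ∧ (∃ c ∈ t, sIsDiff c X D)
  ∧ (∀ x ∈ D, ∃ u ∈ t, ∀ y, (y ∈ u ∧ y ∈ D) ⇔ y ≐ x).
Definition sIsSubspaceTopology (s Y t : name P) : om P :=
  ∀ v, v ∈ s ⇔ (∃ u ∈ t, sIsInter v u Y).
Definition sONA (U X t : name P) : om P :=
  sIsFunc U X t ∧ (∀ x ∈ X, ∀ u, sMaps U x u ⇒ x ∈ u).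
Definition sInUnionImage (y U D : name P) : om P :=
  ∃ x ∈ D, ∃ u, sMaps U x u ∧ y ∈ u.
Definition sIsDSpace (X t : name P) : om P :=
  ∀ U, sONA U X t ⇒
    ∃ D, sClosedDiscrete D X t ∧ (∀ y, sInUnionImage y U D ⇔ y ∈ X).
Definition sFiner (V U X : name P) : om P :=
  ∀ x ∈ X, ∀ v, ∀ u, sMaps V x v ⇒ sMaps U x u ⇒ sSubset v u.
Definition sLocallyCountable (X t : name P) : om P :=
  ∃ U, sONA U X t ∧ (∀ x ∈ X, ∀ u, sMaps U x u ⇒ sCardLtAleph1 u).
Definition sSticky (U D X t : name P) : om P :=
  sClosedDiscrete D X t
  ∧ (∀ x ∈ X, (∃ u, sMaps U x u ∧ ∃ y, y ∈ u ∧ y ∈ D) ⇒ sInUnionImage x U D).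
Definition sInPoset (D U X t : name P) : om P := sCountable D ∧ sSticky U D X t.
Definition sPosetLe (U D D' : name P) : om P :=
  sSubset D D' ∧ ¬ (∃ x ∈ D', ¬ x ∈ D ∧ sInUnionImage x U D).
Definition sStronglyD (X t U : name P) : om P :=
  ∀ D, sInPoset D U X t ⇒
    ∀ x ∈ X, ∃ D', sInPoset D' U X t ∧ sPosetLe U D D' ∧ sInUnionImage x U D'.
Definition sIsTraceONA (V U Y : name P) : om P :=
  ∀ p, p ∈ V ⇔
    (∃ y ∈ Y, ∃ u, ∃ v, sMaps U y u ∧ sIsInter v u Y ∧ sIsOPair p y v).
Definition sSubspaceStronglyD (Y t U : name P) : om P :=
  ∃ s, ∃ V, sIsSubspaceTopology s Y t ∧ sIsTraceONA V U Y ∧ sStronglyD Y s V.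
End Shallow.

(** * The axioms of ZFC are forced *)

Section ZF.
Context {P : poset}.
Implicit Types p q r : P.
Implicit Types x y z a b c : name P.

Lemma forced_extensionality p : p ⊩ sExtensionality.
Proof.
move=> a b; oi h; apply: ext_eq => q pq x hx;
  have [h1 h2] := oIffE (mono pq (oAllE h x)); auto.
Qed.

(** Induction on the name of an element of [a]: either one of its own elements lies in [a], and the
    induction descends, or it is minimal. *)
Lemma forced_foundation p : p ⊩ sFoundation.
Proof.
move=> a; oi h; oex h as x hx.
suff H : forall x p, p ⊩ x ∈ a -> p ⊩ (∃ x ∈ a, ∀ y ∈ x, ¬ y ∈ a) by exact: H hx.
clear x p hx; elim=> I f IH S p h.
oem (∃ i, S i ∧ f i ∈ a) as k.
  oex k as i [_ hi]%oAndP; exact: IH hi.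
apply: (oExI (x := mk I f S)); apply: oAndI => //; oa y hy; oi hya.
oex hy as i [hi e']%oAndP; apply: (k p (le_refl _)); apply: (oExI (x := i)).
apply: oAndI => //; exact: mem_eql hya.
Qed.

Lemma forced_pairing p : p ⊩ sPairing.
Proof.
move=> a b; apply: (oExI (x := upair a b)) => x; apply: oIffI => q pq; exact: upairP.
Qed.

Lemma forced_union p : p ⊩ sUnion.
Proof.
move=> a; apply: (oExI (x := bigU a)) => x; apply: oIffI => q pq; exact: bigUP.
Qed.

Lemma forced_power p : p ⊩ sPowerSet.
Proof.
move=> a; apply: (oExI (x := pow a)) => x; apply: oIffI => q pq; exact: powP.
Qed.

Fixpoint numeral n : name P :=
  match n with 0 => mk Empty_set (fun i => match i with end) (fun _ => ⊥)
  | S k => succ (numeral k) end.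

Lemma forced_infinity p : p ⊩ sInfinity.
Proof.
apply: (oExI (x := mk nat numeral (fun _ => ⌜True⌝))); apply: oAndI.
  apply: (oExI (x := numeral 0)); apply: oAndI; first exact: mem_el.
  by move=> x; oi h; oex h as [] _.
move=> x; oi h; oex h as n [_ e']%oAndP.
apply: (oExI (x := numeral (S n))); apply: oAndI; first exact: mem_el.
move=> y; apply: oIffI => q pq; move: (mono pq e') => {}e'.
split=> [/succP|] k.
  oor k as k; [apply: oOrI1|apply: oOrI2]; first exact: mem_eqr (feq_sym e') k.
  exact: feq_trans k (feq_sym e').
apply/succP; oor k as k; [apply: oOrI1|apply: oOrI2]; first exact: mem_eqr e' k.
exact: feq_trans k e'.
Qed.

Lemma Ext_sem A e : Ext (fun x => sem A (econs x e)).
Proof. by move=> p x y h; apply: sem_ext => -[|i] //=; apply: feq_refl. Qed.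

Lemma forced_separation A e p : p ⊩ sem (sentence (Separation A)) e.
Proof.
(* The index 3 counts the binders [a], [b] and [x] around [A]. *)
change (p ⊩ (∀ a, ∃ b, ∀ x, x ∈ b ⇔
  (x ∈ a ∧ sem (apply1 A (fun e => e - 3) 3) (econs x (econs b (econs a e)))))).
have E x b a : sem (apply1 A (fun e => e - 3) 3) (econs x (econs b (econs a e))) = sem A (econs x e).
  rewrite sem_ren; congr sem; apply: functional_extensionality => -[|i] //=.
  by rewrite Nat.add_comm.
move=> a; apply: (oExI (x := sep a (fun x => sem A (econs x e)))) => x.
apply: oIffI => q pq; rewrite E.
split=> [/(sepP _ _ _ (@Ext_sem A e)) [h1 h2]|/oAndP [h1 h2]]; first exact: oAndI.
by apply/sepP => //; exact: Ext_sem.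
Qed.

(** One chosen value per pair of an index of [a] and a condition is enough: functionality forces any
    other value to equal the chosen one. *)
Lemma forced_replacement A e p : p ⊩ sem (sentence (Replacement A)) e.
Proof.
change (p ⊩ ((∀ x, ∀ y, ∀ z,
    sem (apply2 A (fun e => e - 1) (fun e => e - 2) 3) (econs z (econs y (econs x e)))
    ⇒ sem (apply2 A (fun e => e - 1) (fun e => e - 3) 3) (econs z (econs y (econs x e))) ⇒ y ≐ z)
  ⇒ ∀ a, ∃ b, ∀ y, y ∈ b ⇔ (∃ x ∈ a,
    sem (apply2 A (fun e => e - 4) (fun e => e - 3) 4) (econs x (econs y (econs b (econs a e))))))).
pose F x y := sem A (econs x (econs y e)).
have app2 (x y : var) d e' : (forall i, e' (i + d) = e i) -> sem (apply2 A x y d) e' = F (e' (x d)) (e' (y d)).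
  move=> h; rewrite sem_ren; congr sem; apply: functional_extensionality => -[|[|i]] //=.
have EF : forall q x x' y y', q ⊩ x ≐ x' -> q ⊩ y ≐ y' -> q ⊩ F x y -> q ⊩ F x' y'.
  move=> q x x' y y' h h'; apply: sem_ext => -[|[|i]] //=; exact: feq_refl.
have e3 x y z i : econs z (econs y (econs x e)) (i + 3) = e i by rewrite Nat.add_comm.
have e4 w x y z i : econs z (econs y (econs x (econs w e))) (i + 4) = e i by rewrite Nat.add_comm.
oi funF; move=> a.
pose K := (ix a * P)%type.
pose v (k : K) := epsilon (inhabits a) (fun y => val (F (el (fst k)) y) (snd k)).
pose b := mk K v (fun k => ixv (fst k) ∧ F (el (fst k)) (v k)).
apply: (oExI (x := b)) => y; apply: oIffI => q pq.
move: (mono pq funF) => {pq} {}funF.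
split=> h.
  oex h as [i r] [[hi hF]%oAndP ey]%oAndP.
  apply: (oExI (x := el i)); apply: oAndI.
    apply/memP; apply: (oExI (x := i)); apply: oAndI => //; exact: feq_refl.
  rewrite app2 //; apply: EF hF; [exact: feq_refl|exact: feq_sym].
oex h as x [hx%memP hF]%oAndP; oex hx as i [hi e']%oAndP.
rewrite app2 //= in hF.
have hF' : q ⊩ F (el i) y by apply: EF hF => //; exact: feq_refl.
have hv : q ⊩ F (el i) (v (i, q)).
  apply: (epsilon_spec (inhabits a) (fun y => q ⊩ F (el i) y)); by exists y.
apply: (oExI (x := (i, q))); apply: oAndI; first exact: oAndI.
have := oAllE (oAllE (oAllE funF (el i)) y) (v (i, q)).
by rewrite !app2 //= => h1; apply: (oImpE (oImpE h1 hF') hv).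
Qed.
End ZF.

(** * The forcing notion *)

Section Conditions.
Context {L : Type}.

Definition piece := L -> option real.

(* A [node] is a name for a set of pieces: [f] belongs to the set when, for some [i] with
   [live f i], the generic function at coordinate [kids f i n] takes the value [r] at [x]
   whenever [data f i n = Some (x, r)]. A [leaf] is a coordinate carrying no restriction. *)
Inductive coord :=
| leaf (l : L * real -> bool)
| node (live : piece -> real -> bool) (kids : piece -> real -> nat -> coord)
       (data : piece -> real -> nat -> option (L * real)).

Definition pcond := coord * L -> option real.
Definition at_ (p : pcond) c : piece := fun x => p (c, x).

(** The real [i] numbers the certificates for [f]; the condition [p] contains the one numbered
    [i]. *)
Definition listed live kids data (f : piece) (i : real) (p : pcond) := live f i = true /\
  forall (n : nat) (x : L) (r : real), data f i n = Some (x, r) -> p (kids f i n, x) = Some r.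

Definition valid (p : pcond) := forall c x r, p (c, x) = Some r ->
  match c with leaf _ => True | node live kids data =>
    exists f i, sub f (at_ p c) /\ f x = Some r /\ listed live kids data f i p end.

Definition cond := {p : pcond | countable p /\ valid p}.
Definition cond_le (p q : cond) := sub (proj1_sig p) (proj1_sig q).

Definition Cond : poset := @Poset cond cond_le (fun p => @sub_refl _ _ _)
  (fun p q r h1 h2 => sub_trans h1 h2).
Definition fn (p : Cond) : pcond := proj1_sig p.
Implicit Types p q : Cond.

Lemma fn_mono p q k v : p ⊑ q -> fn p k = Some v -> fn q k = Some v.
Proof. by move=> h; apply: h. Qed.

Lemma listed_mono live kids data f i (u v : pcond) : sub u v ->
  listed live kids data f i u -> listed live kids data f i v.
Proof. by move=> h [h1 h2]; split=> // n x r /h2 /h. Qed.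

(** Certificates ask only for the presence of values, so they survive enlargement of the
    condition. *)
Lemma valid_union (u : pcond) : (forall k r, u k = Some r -> exists p : pcond, sub p u /\ valid p /\ p k = Some r) ->
  valid u.
Proof.
move=> h c x r /h [p [pu [vp /vp]]]; case: c => // live kids data [f [i [fp [fx l]]]].
exists f, i; split; last by split=> //; exact: listed_mono l.
by move=> y s /fp; apply: pu.
Qed.

Definition join K V (a b : K -> option V) k := match a k with Some v => Some v | None => b k end.

Lemma join_l K V (a b : K -> option V) : sub a (join a b).
Proof. by move=> k v; rewrite /join => ->. Qed.

Lemma join_r K V (a b : K -> option V) : compat a b -> sub b (join a b).
Proof. by move=> c k v e; rewrite /join; case ea : (a k) => [u|] //; rewrite (c k u v). Qed.

Lemma countable_cover K V V' (u : K -> option V) (a : nat -> K -> option V') :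
  (forall n, countable (a n)) -> (forall k, u k <> None -> exists n, a n k <> None) -> countable u.
Proof.
move=> /choice_fun [e he] h.
exists (fun z => let (n, l) := of_nat z in e n l) => k /h [n /(he n) [l el]].
by exists (to_nat (n, l)); rewrite cancel_of_to.
Qed.

Lemma countable_join K V (a b : K -> option V) : countable a -> countable b -> countable (join a b).
Proof.
move=> ca cb; apply: (countable_cover (a := fun n => match n with 0 => a | _ => b end)).
  by case.
move=> k; rewrite /join; case e : (a k) => [v|] h; last by exists 1.
by exists 0; rewrite e.
Qed.

Lemma cond_join p q : compat (fn p) (fn q) -> exists r, p ⊑ r /\ q ⊑ r.
Proof.
case: p q => p [cp vp] [q [cq vq]] /= c.
have v : valid (join p q).
  apply: valid_union => k r; rewrite /join; case e : (p k) => [u|] e'.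
    by exists p; split; [exact: join_l|rewrite e].
  by exists q; split; [exact: join_r|].
exists (exist (fun p : pcond => countable p /\ valid p) (join p q) (conj (countable_join cp cq) v) : Cond).
by split; [exact: join_l|exact: join_r].
Qed.

Lemma cond_chain (s : nat -> Cond) : (forall n, s n ⊑ s (S n)) -> exists q, forall n, s n ⊑ q.
Proof.
move=> h.
have mon n m : n <= m -> s n ⊑ s m.
  by elim=> [|k _ IH]; [exact: le_refl|exact: le_trans IH (h k)].
have [u hu] : exists u : pcond, forall k, (forall r, u k = Some r <-> exists n, fn (s n) k = Some r).
  apply: (choice_fun (R := fun k v => forall r, v = Some r <-> exists n, fn (s n) k = Some r)) => k.
  case: (classic (exists r n, fn (s n) k = Some r)) => [[r [n e]]|no]; last first.
    by exists None => r; split=> // -[n e]; case: no; exists r, n.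
  exists (Some r) => r'; split=> [[<-]|[m e']]; first by exists n.
  have := fn_mono (mon _ _ (Nat.le_max_l n m)) e.
  by rewrite (fn_mono (mon _ _ (Nat.le_max_r n m)) e').
have su n : sub (fn (s n)) u by move=> k r e; apply/hu; exists n.
have cu : countable u.
  apply: (countable_cover (a := fun n => fn (s n))) => [n|k]; first by case: (s n) => ? [].
  case e : (u k) => [r|] // _; have [n e'] := proj1 (hu k r) e.
  by exists n; rewrite e'.
have vu : valid u.
  apply: valid_union => k r /hu [n e]; exists (fn (s n)); split=> //; split=> //.
  by case: (s n) => ? [].
by exists (exist (fun p : pcond => countable p /\ valid p) u (conj cu vu) : Cond).
Qed.

Lemma cond_predense (D : Cond -> Prop) p0 : D p0 -> exists g : real -> Cond, (forall i, D (g i)) /\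
  forall a, D a -> exists i b, a ⊑ b /\ g i ⊑ b.
Proof.
move=> D0.
have [||g [gD gp]] := @predense _ (fun f => exists p, D p /\ fn p = f) (fn p0).
- by exists p0.
- by move=> a [[p hp] [_ <-]]; case: hp.
have [g' hg'] := choice_fun gD.
exists g'; split=> [i|a Da]; first by case: (hg' i).
have [|i c] := gp (fn a); first by exists a.
by exists i; apply: cond_join; case: (hg' i) => _ ->.
Qed.

(** * Naming sets by nodes, and genericity at a node *)

Fixpoint below (d c : coord) : Prop := match c with leaf _ => False
  | node _ kids _ => exists f i n, d = kids f i n \/ below d (kids f i n) end.

Lemma below_kid live kids data f i n : below (kids f i n) (node live kids data).
Proof. by exists f, i, n; left. Qed.

Lemma below_down live kids data f i n c : below (node live kids data) c -> below (kids f i n) c.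
Proof.
elim: c => [l []|live' kids' IH data' [g [j [m [e|/IH h]]]]]; exists g, j, m; right=> //.
rewrite -e; exact: below_kid.
Qed.

Lemma below_irr c : ~ below c c.
Proof.
elim: c => [l []|live kids IH data [f [i [n h]]]]; apply: (IH f i n); case: h => [e|h].
  by rewrite -{2}e; apply: below_kid.
exact: below_down h.
Qed.

(** The certificates for [f] are the members of a predense family of conditions forcing [S f], which
    the chain condition lets the reals index; [kids] and [data] together spell out the countable
    graph of such a condition. Where nothing forces [S f], [live] is false. *)
Lemma code_exists (S : piece -> om Cond) : exists live kids data,
  (forall f i p, listed live kids data f i (fn p) -> p ⊩ S f) /\
  (forall f p, p ⊩ S f -> exists i q, p ⊑ q /\ listed live kids data f i (fn q)).
Proof.
have [w hw] : exists w : piece -> bool * (real -> Cond), forall f,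
    (fst (w f) = true -> forall i, snd (w f) i ⊩ S f) /\
    (forall p, p ⊩ S f -> fst (w f) = true /\ exists i q, p ⊑ q /\ snd (w f) i ⊑ q).
  apply: (choice_fun (R := fun f w => (fst w = true -> forall i, snd w i ⊩ S f) /\
    (forall p, p ⊩ S f -> fst w = true /\ exists i q, p ⊑ q /\ snd w i ⊑ q))) => f.
  case: (classic (exists p, p ⊩ S f)) => [[p0 h]|no].
    have [g [gD gp]] := cond_predense h; exists (true, g); split=> // p /gp [i [b hb]]; split=> //; by exists i, b.
  have v : countable (fun _ : coord * L => @None real) /\ valid (fun _ => None).
    by split=> [|k y r] //; exists (fun _ => None) => k [].
  exists (false, fun _ => exist (fun p : pcond => countable p /\ valid p) (fun _ => None) v : Cond); split=> // p h; by case: no; exists p.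
have [en hen] : exists en : Cond -> nat -> option (coord * L), forall p, enumerates (en p) (fn p).
  by apply: (choice_fun (R := fun (p : Cond) e => enumerates e (fn p))) => -[p [? ?]].
pose dat f i n := match en (snd (w f) i) n with Some k =>
  match fn (snd (w f) i) k with Some r => Some (snd k, r) | None => None end | None => None end.
pose kid f i n := match en (snd (w f) i) n with Some k => fst k | None => leaf (fun _ => true) end.
exists (fun f _ => fst (w f)), kid, dat.
have meet f i p : snd (w f) i ⊑ p <-> forall n x r, dat f i n = Some (x, r) -> fn p (kid f i n, x) = Some r.
  rewrite /dat /kid; split=> [h n x r|h [c x] r e].
    case: (en _ n) => // -[c y] /=; case e : (fn _ _) => [s|] // -[<- <-].
    exact: fn_mono h e.
  have [|n e'] := hen (snd (w f) i) (c, x); first by rewrite -/(fn _) in e; rewrite e.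
  have := h n x r; rewrite e' /= -/(fn _) in e *; rewrite e; exact.
split=> [f i p [/(proj1 (hw f)) h /meet l]|f p /(proj2 (hw f)) [h [i [q [pq iq]]]]].
  exact: mono (h i).
by exists i, q; split=> //; split=> //; apply/meet.
Qed.

Section Genericity.
Context (S : piece -> om Cond) (x : L) (p : Cond).
Context (live : piece -> real -> bool) (kids : piece -> real -> nat -> coord)
        (data : piece -> real -> nat -> option (L * real)).
Local Notation c := (node live kids data).
Context (code1 : forall f i q, listed live kids data f i (fn q) -> q ⊩ S f).
Context (code2 : forall f q, q ⊩ S f -> exists i r, q ⊑ r /\ listed live kids data f i (fn r)).
Context (closed : forall e, countable e ->
  (forall y r, e y = Some r -> exists f, sub f e /\ f y = Some r /\ (p ⊩ S f)) -> p ⊩ S e).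

(** By validity the piece of [p] at [c] is a union of certified pieces, so the closure of the named
    set under countable unions applies. *)
Lemma generic_piece : p ⊩ S (at_ (fn p) c).
Proof.
case: p closed => u [cu vu] cl; rewrite /fn /=; apply: cl.
  have [e he] := cu.
  exists (fun n => match e n with Some k => Some (snd k) | None => None end) => y /he [n en].
  by exists n; rewrite en.
move=> y r /vu [f [i [h1 [h2 h3]]]]; exists f; split=> //; split=> //.
by apply: (code1 (i := i)).
Qed.

Context (dense : forall e q, p ⊑ q -> q ⊩ S e -> exists r e', q ⊑ r /\ sub e e' /\ (r ⊩ S e') /\ countable e' /\ e' x <> None).

Lemma generic_step : exists q, p ⊑ q /\ fn q (c, x) <> None.
Proof.
have [r [e [pr [se [re [ce ex]]]]]] := dense (le_refl p) generic_piece.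
have [i [r' [rr' l]]] := code2 re.
have pr' : p ⊑ r' by exact: le_trans rr'.
(* The condition [r'] extends [p] but may contradict [e] at [c]. Only its values below [c], where
   the certificate of [e] lives, are taken over. *)
pose u : pcond := fun k => match excluded_middle_informative (below (fst k) c) with
  | left _ => fn r' k
  | right _ => match excluded_middle_informative (fst k = c) with
    | left _ => e (snd k) | right _ => fn p k end end.
have ub d y : below d c -> u (d, y) = fn r' (d, y).
  by rewrite /u /=; case: excluded_middle_informative.
have uc y : u (c, y) = e y.
  rewrite /u; case: excluded_middle_informative => [/below_irr|_] //.
  by case: excluded_middle_informative.
have uo d y : ~ below d c -> d <> c -> u (d, y) = fn p (d, y).
  by move=> h1 h2; rewrite /u /=; do 2 case: excluded_middle_informative => //.
have pu : sub (fn p) u.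
  move=> [d y] s h; case: (classic (below d c)) => [b|nb]; first by rewrite ub //; exact: fn_mono h.
  case: (classic (d = c)) => [E|ne]; last by rewrite uo.
  by subst d; rewrite uc; apply: se.
have cu : countable u.
  apply: (countable_cover (a := fun n => match n with 0 => fn r' | 1 => fn p | _ =>
     fun k => match excluded_middle_informative (fst k = c) with left _ => e (snd k) | right _ => None end end)).
    move=> [|[|n]]; [by case: (r') => ? []|by case: (p) => ? []|].
    have [en he] := ce.
    exists (fun n => match en n with Some y => Some (c, y) | None => None end) => -[d y] /=.
    case: excluded_middle_informative => // -> /he [m em]; by exists m; rewrite em.
  move=> [d y]; case: (classic (below d c)) => [b|nb]; first by rewrite ub // => h; exists 0.
  case: (classic (d = c)) => [E|ne]; last by rewrite uo // => h; exists 1.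
  subst d; rewrite uc => h; exists 2 => /=; by case: excluded_middle_informative.
have kb f j n live' kids' data' : below (node live' kids' data') c -> below (kids' f j n) c.
  exact: below_down.
(* Certificates of coordinates below [c] stay below [c], hence inside [r']; at [c] the certificate
   [l] of [e] serves; everywhere else those of [p] persist because [u] extends [p]. *)
have vu : valid u.
  move=> d y s; case: (classic (below d c)) => [b|nb].
    rewrite ub // => /(proj2 (proj2_sig r')).
    case: d b => // live' kids' data' b [f [j [h1 [h2 [h3 h4]]]]].
    exists f, j; split; [|split=> //; split=> //].
      by move=> z t /h1; rewrite /at_ ub.
    by move=> n z t /h4; rewrite ub //; exact: kb b.
  case: (classic (d = c)) => [E|ne].
    subst d; rewrite uc => ey; exists e, i; split; first by move=> z t; rewrite /at_ uc.
    split=> //; case: l => l1 l2; split=> // n z t /l2; rewrite ub //; exact: below_kid.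
  rewrite uo // => /(proj2 (proj2_sig p)); case: d nb ne => // live' kids' data' nb ne.
  move=> [f [j [h1 [h2 h3]]]]; exists f, j; split; last by split=> //; exact: listed_mono h3.
  by move=> z t /h1 /pu.
exists (exist (fun p : pcond => countable p /\ valid p) u (conj cu vu) : Cond); split; first exact: pu.
by rewrite /fn /= uc.
Qed.
End Genericity.

Definition gen c x (r : real) : om Cond := oGen (fun p => fn p (c, x) = Some r).

Lemma genI c x v p : fn p (c, x) = Some v -> p ⊩ gen c x v.
Proof. by move=> h; apply: oGenI h (le_refl p). Qed.

Lemma gen_dense c x v p : p ⊩ gen c x v -> exists q, p ⊑ q /\ fn q (c, x) = Some v.
Proof.
move=> /(_ p (le_refl p)) [q [s [pq [sq e]]]]; exists q; split=> //; exact: fn_mono e.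
Qed.

Lemma gen_fun c x v w p : p ⊩ gen c x v -> fn p (c, x) = Some w -> v = w.
Proof.
by move=> /gen_dense [q [pq e]] /(fn_mono pq); rewrite e => -[].
Qed.

Lemma gen_unique c x v w p : p ⊩ gen c x v -> p ⊩ gen c x w -> v = w.
Proof.
move=> /gen_dense [q [pq e]] /(mono pq) h; by rewrite (gen_fun h e).
Qed.

Lemma leaf_extend l x v p : fn p (leaf l, x) = None -> exists q, p ⊑ q /\ fn q (leaf l, x) = Some v /\
  forall k, k <> (leaf l, x) -> fn q k = fn p k.
Proof.
move=> h.
pose u : pcond := fun k => match excluded_middle_informative (k = (leaf l, x)) with left _ => Some v | right _ => fn p k end.
have u1 : u (leaf l, x) = Some v by rewrite /u; case: excluded_middle_informative.
have u2 k : k <> (leaf l, x) -> u k = fn p k by rewrite /u; case: excluded_middle_informative.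
have pu : sub (fn p) u.
  move=> k s e; rewrite u2 // => E; by move: e; rewrite E h.
have cu : countable u.
  have [e he] : countable (fn p) by case: (p) => ? [].
  exists (fun n => match n with 0 => Some (leaf l, x) | S n => e n end) => k.
  case: (classic (k = (leaf l, x))) => [-> _|ne]; first by exists 0.
  by rewrite u2 // => /he [n en]; exists (S n).
have vu : valid u.
  move=> d y s; case: (classic ((d, y) = (leaf l, x))) => [[-> ->] //|ne].
  rewrite u2 // => e.
  move/(proj2 (proj2_sig p)): e; case: d {ne} => // live kids data [f [i [h1 [h2 h3]]]].
  exists f, i; split; last by split=> //; exact: listed_mono h3.
  by move=> z t /h1 /pu.
by exists (exist (fun p : pcond => countable p /\ valid p) u (conj cu vu) : Cond).
Qed.
End Conditions.
Arguments coord : clear implicits.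
Arguments piece : clear implicits.
Arguments Cond : clear implicits.

(** * The axiom of choice is forced *)

Section Choice.
Context {P : poset}.
Implicit Types p q r : P.
Implicit Types x y z a b c : name P.

(* The transversal picks from each set the first possible element in a well-ordering of the
   indices of the union. *)
Lemma forced_choice p : p ⊩ sChoice.
Proof.
move=> s; oi hne; oi hdis.
pose K := {i : ix s & ix (el i)}.
pose x (k : K) := el (projT2 k).
have [lt [wf [_ tot]]] := well_ordering K.
pose c := mk K x (fun k => ∃ a ∈ s, x k ∈ a ∧ ∀ k', ⌜lt k' k⌝ ⇒ ¬ x k' ∈ a).
apply: (oExI (x := c)); oa a ha; apply: oExD => q pq; lift pq.
have [k [hk min]] : exists k, (exists r, p ⊑ r /\ (r ⊩ x k ∈ a)) /\
    forall k', lt k' k -> ~ exists r, p ⊑ r /\ (r ⊩ x k' ∈ a).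
  apply: NNPP => n.
  have {}n k : ~ exists r, p ⊑ r /\ (r ⊩ x k ∈ a).
    elim: k / (wf k) => k _ IH h; apply: n; by exists k.
  have [r1 [l1 [y hy]]] := oEx_dense (oImpE (oAllE hne a) ha); lift l1.
  have [r2 [l2 [i /oAndP [hi e]]]] := oEx_dense (proj1 (memP _ _ _) ha); lift l2.
  have [r3 [l3 [j /oAndP [hj e']]]] := oEx_dense (proj1 (memP _ _ _) (mem_eqr e hy)); lift l3.
  apply: (n (existT _ i j)); exists r1; split=> //.
  exact: mem_eql e' hy.
case: hk => r [pr hk]; exists r; split=> //; exists (x k) => y.
have {}min k' : lt k' k -> r ⊩ ¬ x k' ∈ a.
  move=> h r' rr' n; apply: (min k' h); exists r'; split=> //; exact: le_trans rr'.
lift pr; apply: oIffI => q pq.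
split=> [/oAndP [hy hc]|e]; last first.
  lift pq; apply: oAndI; first exact: mem_eql (feq_sym e) hk.
  apply: mem_eql (feq_sym e) _; apply: (mem_el (el := x)).
  apply: (oExI (x := a)); apply: oAndI => //; apply: oAndI => // k'.
  by move=> q l h; exact: mono l (min k' h).
lift pq; oex hc as l [hl ey]%oAndP; oex hl as b [hb [hlb hml]%oAndP]%oAndP.
have eab : p ⊩ a ≐ b.
  have := oImpE (oAllE (oImpE (oAllE hdis a) ha) b) hb => h; apply: (oImpE h).
  by apply: (oExI (x := y)); apply: oAndI => //; apply: mem_eql (feq_sym ey) _.
case: (tot l k) => [h|[e|h]].
- by case: (min l h p (le_refl _)); apply: mem_eqr (feq_sym eab) _.
- by rewrite -e.
- have := oImpE (oAllE hml k) h => n; case: (n p (le_refl p)); exact: mem_eqr hk.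
Qed.

Lemma forced_ZFC A : ZFC A -> forall e p, p ⊩ sem A e.
Proof.
case=> {A} [||||||| n A _|n A _] e p.
- exact (@forced_extensionality P p).
- exact (@forced_foundation P p).
- exact (@forced_pairing P p).
- exact (@forced_union P p).
- exact (@forced_power P p).
- exact (@forced_infinity P p).
- exact (@forced_choice p).
- apply: sem_fAlls => e'; exact: forced_separation.
- apply: sem_fAlls => e'; exact: forced_replacement.
Qed.

Definition sMain : om P := sCH
     ∧ sTwoToAleph1GtAleph2
     ∧ (∀ X, ∀ t,
          sIsTopology X t
          ⇒ sHausdorff X t
          ⇒ sLocallyCountable X t
          ⇒ sCardLeAleph2 X
          ⇒ (∀ U', sONA U' X t ⇒
               ∃ U, sONA U X t ∧ sFiner U U' X
                 ∧ (∀ Y ∈ t, sCardLeAleph1 Y ⇒ sSubspaceStronglyD Y t U))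
          ⇒ sIsDSpace X t).
End Choice.

(** * Functions in the Boolean-valued model *)

Section Functions.
Context {P : poset}.
Implicit Types p q r : P.
Implicit Types x y z a b c f A B : name P.

Lemma Ext_const (F : om P) : Ext (fun _ => F). Proof. by []. Qed.
Lemma Ext_mem1 a : Ext (fun x => x ∈ a). Proof. move=> p x y; exact: mem_eql. Qed.
Lemma Ext_mem2 a : Ext (fun x => a ∈ x). Proof. move=> p x y; exact: mem_eqr. Qed.
Lemma Ext_eq1 a : Ext (fun x => x ≐ a).
Proof. move=> p x y e; apply: feq_trans; exact: feq_sym. Qed.
Lemma Ext_imp (F G : name P -> om P) : Ext F -> Ext G -> Ext (fun x => F x ⇒ G x).
Proof.
move=> eF eG p x y e h; oi k; apply: (eG _ _ _ e); apply: (oImpE h); exact: eF (feq_sym e) k.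
Qed.
Lemma Ext_all T (F : T -> name P -> om P) : (forall t, Ext (F t)) -> Ext (fun x => ∀ t, F t x).
Proof. move=> h p x y e k t; exact: h e (oAllE k t). Qed.
Lemma Ext_not (F : name P -> om P) : Ext F -> Ext (fun x => ¬ F x).
Proof. by move=> h; apply: Ext_imp. Qed.
Lemma Ext_and (F G : name P -> om P) : Ext F -> Ext G -> Ext (fun x => F x ∧ G x).
Proof. by move=> eF eG p x y e /oAndP [h k]; apply: oAndI; [exact: eF h|exact: eG k]. Qed.
Lemma Ext_ex T (F : T -> name P -> om P) : (forall t, Ext (F t)) -> Ext (fun x => ∃ t, F t x).
Proof. move=> h p x y e k; oex k as t k; apply: (oExI (x := t)); exact: h e k. Qed.
Lemma Ext_iff (F G : name P -> om P) : Ext F -> Ext G -> Ext (fun x => F x ⇔ G x).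
Proof. by move=> eF eG; apply: Ext_and; apply: Ext_imp. Qed.

Lemma upair_ext a b a' b' p : p ⊩ a ≐ a' -> p ⊩ b ≐ b' -> p ⊩ upair a b ≐ upair a' b'.
Proof.
move=> e1 e2; apply: ext_eq => q pq x /upairP h; apply/upairP; lift pq; oor h as h;
  [apply: oOrI1|apply: oOrI2|apply: oOrI1|apply: oOrI2]; apply: feq_trans h _ => //; exact: feq_sym.
Qed.

Lemma IsPairP z a b p : p ⊩ sIsPair z a b <-> p ⊩ z ≐ upair a b.
Proof.
split=> h; last first.
  by move=> x; apply: oIffI => q pq; lift pq; split=> [/(mem_eqr h) /upairP|/upairP /(mem_eqr (feq_sym h))].
apply: ext_eq => q pq x; lift pq; have k := oIffE (oAllE h x).
  by move=> /k /upairP.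
by move=> /upairP /k.
Qed.

Definition opair a b := upair (upair a a) (upair a b).

Lemma opair_ext a b a' b' p : p ⊩ a ≐ a' -> p ⊩ b ≐ b' -> p ⊩ opair a b ≐ opair a' b'.
Proof. by move=> e1 e2; do 2 apply: upair_ext => //. Qed.

Lemma IsOPairP z a b p : p ⊩ sIsOPair z a b <-> p ⊩ z ≐ opair a b.
Proof.
split=> h.
  oex h as u h; oex h as v [h1%IsPairP [h2%IsPairP h3%IsPairP]%oAndP]%oAndP.
  apply: feq_trans h3 _; exact: upair_ext.
apply: (oExI (x := upair a a)); apply: (oExI (x := upair a b)).
by apply: oAndI; [|apply: oAndI]; apply/IsPairP => //; apply: feq_refl.
Qed.

Lemma upair_l a b p : p ⊩ a ∈ upair a b.
Proof. apply/upairP; apply: oOrI1; exact: feq_refl. Qed.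
Lemma upair_r a b p : p ⊩ b ∈ upair a b.
Proof. apply/upairP; apply: oOrI2; exact: feq_refl. Qed.

Lemma opair_inj a b c d p : p ⊩ opair a b ≐ opair c d -> (p ⊩ a ≐ c) /\ (p ⊩ b ≐ d).
Proof.
move=> e.
have sing x y q : q ⊩ x ∈ upair y y -> q ⊩ x ≐ y by move=> /upairP h; oor h as h.
have e1 : p ⊩ a ≐ c.
  have /upairP h := mem_eqr e (@upair_l (upair a a) (upair a b) _); oor h as h.
    by apply: sing; apply: (mem_eqr h); apply: upair_l.
  by apply: feq_sym; apply: sing; apply: mem_eqr (feq_sym h) _; apply: upair_l.
split=> //.
have /upairP h := mem_eqr (feq_sym e) (@upair_r (upair c c) (upair c d) _).
have /upairP h' := mem_eqr e (@upair_r (upair a a) (upair a b) _).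
oor h as h.
  have e2 := sing _ _ _ (mem_eqr h (@upair_r c d _)).
  oor h' as h'.
    have e3 := sing _ _ _ (mem_eqr h' (@upair_r a b _)).
    apply: feq_trans e3 _; apply: feq_trans (feq_sym e1) _; exact: feq_sym.
  have /upairP e3 := mem_eqr h' (@upair_r a b _); oor e3 as e3 => //.
  apply: feq_trans e3 _; apply: feq_trans (feq_sym e1) _; exact: feq_sym.
have /upairP e2 := mem_eqr h (@upair_r c d _); oor e2 as e2; last exact: feq_sym.
oor h' as h'.
  have e3 := sing _ _ _ (mem_eqr h' (@upair_r a b _)).
  apply: feq_trans e3 _; apply: feq_trans (feq_sym e1) _; exact: feq_sym.
have /upairP e3 := mem_eqr h' (@upair_r a b _); oor e3 as e3 => //.
apply: feq_trans e3 _; apply: feq_trans (feq_sym e1) _; exact: feq_sym.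
Qed.

Lemma mapsP f a b p : p ⊩ sMaps f a b <-> p ⊩ opair a b ∈ f.
Proof.
split=> h.
  oex h as z [h1 h2%IsOPairP]%oAndP; exact: mem_eql h2 h1.
apply: (oExI (x := opair a b)); apply: oAndI => //; apply/IsOPairP; exact: feq_refl.
Qed.

Lemma maps_ext f a b a' b' p : p ⊩ a ≐ a' -> p ⊩ b ≐ b' -> p ⊩ sMaps f a b -> p ⊩ sMaps f a' b'.
Proof. move=> e1 e2 /mapsP h; apply/mapsP; apply: mem_eql h; exact: opair_ext. Qed.

Lemma Ext_maps1 f b : Ext (fun x => sMaps f x b).
Proof. move=> p x y e; apply: maps_ext => //; exact: feq_refl. Qed.
Lemma Ext_maps2 f a : Ext (fun x => sMaps f a x).
Proof. move=> p x y e; apply: maps_ext => //; exact: feq_refl. Qed.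

Definition mkfun A B (F : name P -> name P -> om P) :=
  mk (ix A * ix B) (fun k => opair (el (fst k)) (el (snd k)))
    (fun k => ixv (fst k) ∧ ixv (snd k) ∧ F (el (fst k)) (el (snd k))).

Lemma elP A (i : ix A) p : p ⊩ ixv i -> p ⊩ el i ∈ A.
Proof. move=> h; apply/memP; apply: (oExI (x := i)); apply: oAndI => //; exact: feq_refl. Qed.

Lemma mkfun_mem A B F z p : p ⊩ z ∈ mkfun A B F -> p ⊩ (∃ a ∈ A, ∃ b ∈ B, z ≐ opair a b ∧ F a b).
Proof.
move=> h; oex h as [i j] [[hi [hj hF]%oAndP]%oAndP e]%oAndP.
apply: (oExI (x := el i)); apply: oAndI; first exact: elP.
apply: (oExI (x := el j)); apply: oAndI; first exact: elP.
exact: oAndI.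
Qed.

Lemma mkfunP A B F a b p : (forall y, Ext (fun x => F x y)) -> (forall x, Ext (F x)) ->
  p ⊩ sMaps (mkfun A B F) a b <-> (p ⊩ a ∈ A) /\ (p ⊩ b ∈ B) /\ (p ⊩ F a b).
Proof.
move=> e1 e2; split=> [/mapsP /mkfun_mem h|[ha [hb hF]]].
  suff /oAndP [h1 /oAndP] : p ⊩ (a ∈ A ∧ (b ∈ B ∧ F a b)) by [].
  oex h as a' [ha h]%oAndP; oex h as b' [hb [[ea eb]%opair_inj hF]%oAndP]%oAndP.
  apply: oAndI; first exact: mem_eql (feq_sym ea) ha.
  apply: oAndI; first exact: mem_eql (feq_sym eb) hb.
  by apply: e1 (feq_sym ea) _; apply: e2 (feq_sym eb) _.
apply/mapsP; move/memP: ha => ha; oex ha as i [hi ea]%oAndP.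
move/memP: hb => hb; oex hb as j [hj eb]%oAndP.
apply: (oExI (x := (i, j))); apply: oAndI => /=; last exact: opair_ext.
apply: oAndI => //; apply: oAndI => //; apply: e1 ea _; exact: e2 eb hF.
Qed.
End Functions.

Ltac ext := repeat (intros; cbv beta; lazymatch goal with
  | |- Ext (fun _ => ?F) => apply Ext_const
  | |- Ext (fun x => oMem x ?a) => apply Ext_mem1
  | |- Ext (fun x => oMem ?a x) => apply Ext_mem2
  | |- Ext (oMem ?a) => apply Ext_mem2
  | |- Ext (sMaps ?f ?a) => apply Ext_maps2
  | |- Ext (fun x => oEq x ?a) => apply Ext_eq1
  | |- Ext (fun x => sMaps ?f x ?a) => apply Ext_maps1
  | |- Ext (fun x => sMaps ?f ?a x) => apply Ext_maps2
  | |- Ext (fun x => oAnd _ _) => apply Ext_and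
  | |- Ext (fun x => oNot _) => apply Ext_not
  | |- Ext (fun x => oImp _ _) => apply Ext_imp
  | |- Ext (fun x => oIff _ _) => apply Ext_iff
  | |- Ext (fun x => oEx _) => apply Ext_ex
  | |- Ext (fun x => oAll _) => apply Ext_all
  end).

Section FunctionProperties.
Context {P : poset}.
Implicit Types p q r : P.
Implicit Types x y z a b c f A B : name P.

Lemma func_dom f A B a b p : p ⊩ sIsFunc f A B -> p ⊩ sMaps f a b -> (p ⊩ a ∈ A) /\ (p ⊩ b ∈ B).
Proof.
move=> /oAndP [h _] /mapsP k; apply/oAndP.
have := oImpE (oAllE h (opair a b)) k => {}h.
oex h as a' [ha h]%oAndP; oex h as b' [hb [ea eb]%IsOPairP%opair_inj]%oAndP.
by apply: oAndI; [apply: mem_eql (feq_sym ea) _|apply: mem_eql (feq_sym eb) _].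
Qed.

Lemma func_total f A B a p : p ⊩ sIsFunc f A B -> p ⊩ a ∈ A -> p ⊩ (∃ b, sMaps f a b).
Proof. by move=> /oAndP [_ /oAndP [h _]]; apply: oImpE (oAllE h a). Qed.

Lemma func_fun f A B a b c p : p ⊩ sIsFunc f A B -> p ⊩ sMaps f a b -> p ⊩ sMaps f a c -> p ⊩ b ≐ c.
Proof.
move=> /oAndP [_ /oAndP [_ h]] k; apply: oImpE; exact: oImpE (oAllE (oAllE (oAllE h a) b) c) k.
Qed.

Lemma inj_func f A B p : p ⊩ sIsInj f A B -> p ⊩ sIsFunc f A B.
Proof. by case/oAndP. Qed.

Lemma inj_inj f A B a b c p : p ⊩ sIsInj f A B -> p ⊩ sMaps f a c -> p ⊩ sMaps f b c -> p ⊩ a ≐ b.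
Proof.
move=> /oAndP [_ h] k; apply: oImpE; exact: oImpE (oAllE (oAllE (oAllE h a) b) c) k.
Qed.

Lemma bij_inj f A B p : p ⊩ sIsBij f A B -> p ⊩ sIsInj f A B.
Proof. by case/oAndP. Qed.

Lemma bij_onto f A B b p : p ⊩ sIsBij f A B -> p ⊩ b ∈ B -> p ⊩ (∃ a, sMaps f a b).
Proof. by move=> /oAndP [_ h]; exact: oImpE (oAllE h b). Qed.

Section Make.
Context (A B : name P) (F : name P -> name P -> om P) (p : P).
Context (e1 : forall y, Ext (fun x => F x y)) (e2 : forall x, Ext (F x)).
Context (tot : forall q, p ⊑ q -> forall a, q ⊩ a ∈ A -> q ⊩ (∃ b ∈ B, F a b)).
Context (uni : forall q, p ⊑ q -> forall a b c, q ⊩ a ∈ A -> q ⊩ F a b -> q ⊩ F a c -> q ⊩ b ≐ c).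
Local Notation f := (mkfun A B F).

Lemma mkfun_func : p ⊩ sIsFunc f A B.
Proof.
apply: oAndI; [|apply: oAndI].
- move=> z q pq /mkfun_mem h; oex h as a [ha h]%oAndP; oex h as b [hb [e _]%oAndP]%oAndP.
  apply: (oExI (x := a)); apply: oAndI => //; apply: (oExI (x := b)); apply: oAndI => //.
  exact/IsOPairP.
- move=> a q pq ha; have h := tot pq ha; oex h as b [hb h]%oAndP.
  by apply: (oExI (x := b)); apply/mkfunP.
- move=> a b c q pq /(mkfunP _ _ _ _ _ e1 e2) [ha [hb h]] r qr /(mkfunP _ _ _ _ _ e1 e2) [_ [_ h']].
  exact: (uni (le_trans pq qr) (mono qr ha) (mono qr h) h').
Qed.

Context (inj : forall q, p ⊑ q -> forall a a' b, q ⊩ a ∈ A -> q ⊩ a' ∈ A -> q ⊩ F a b -> q ⊩ F a' b -> q ⊩ a ≐ a').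

Lemma mkfun_inj : p ⊩ sIsInj f A B.
Proof.
apply: oAndI; first exact: mkfun_func.
move=> a b c q pq /(mkfunP _ _ _ _ _ e1 e2) [ha [hb h]] r qr /(mkfunP _ _ _ _ _ e1 e2) [ha' [_ h']].
exact: (inj (le_trans pq qr) (mono qr ha) ha' (mono qr h) h').
Qed.

Context (onto : forall q, p ⊑ q -> forall b, q ⊩ b ∈ B -> q ⊩ (∃ a ∈ A, F a b)).

Lemma mkfun_bij : p ⊩ sIsBij f A B.
Proof.
apply: oAndI; first exact: mkfun_inj.
move=> b q pq hb; have h := onto pq hb; oex h as a [ha h]%oAndP.
by apply: (oExI (x := a)); apply/mkfunP.
Qed.
End Make.
End FunctionProperties.

(** * Ordinals in the Boolean-valued model *)

Section Check.
Context {P : poset} {L : ordinals}.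
Implicit Types p q r : P.
Implicit Types s t u : L.
Implicit Types x y z a b c : name P.

(** The canonical (check) name of a ground ordinal. *)
Definition chk : L -> name P := Fix (@lt_wf L) (fun _ => name P)
  (fun t rec => mk {s | lt s t} (fun k => rec (proj1_sig k) (proj2_sig k)) (fun _ => ⌜True⌝)).

Lemma chkE t : chk t = mk {s | lt s t} (fun k => chk (proj1_sig k)) (fun _ => ⌜True⌝).
Proof.
rewrite /chk Fix_eq // => u f g h; congr mk; apply: functional_extensionality => s; exact: h.
Qed.

Lemma chkP z t p : p ⊩ z ∈ chk t <-> p ⊩ (∃ s, ⌜lt s t⌝ ∧ z ≐ chk s).
Proof.
rewrite chkE; split=> h.
  by oex h as [s hs] [_ e]%oAndP; apply: (oExI (x := s)); apply: oAndI.
oex h as s [hs e]%oAndP; apply: (oExI (x := exist _ s hs)); exact: oAndI.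
Qed.

Lemma chk_lt s t p : lt s t -> p ⊩ chk s ∈ chk t.
Proof. move=> h; apply/chkP; apply: (oExI (x := s)); apply: oAndI => //; exact: feq_refl. Qed.

Lemma chk_neq s t p : lt s t -> ~ (p ⊩ chk s ≐ chk t).
Proof.
elim: s / (lt_wf s) t p => s _ IH t p st e.
have /chkP /oEx_dense [q [pq [u /oAndP [us eu]]]] := mem_eqr (feq_sym e) (chk_lt p st).
exact: (IH u us s q us (feq_sym eu)).
Qed.

Lemma chk_inj s t p : p ⊩ chk s ≐ chk t -> s = t.
Proof.
move=> e; case: (lt_total s t) => [/chk_neq|[//|/chk_neq]] n; first by case: (n _ e).
by case: (n _ (feq_sym e)).
Qed.

Lemma chk_mem s t p : p ⊩ chk s ∈ chk t -> lt s t.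
Proof. by move=> /chkP /oEx_dense [q [pq [u /oAndP [us /chk_inj ->]]]]. Qed.

Lemma chk_transitive t p : p ⊩ sTransitive (chk t).
Proof.
move=> x; oi h; move=> y; oi k.
move/chkP: h => h; oex h as s [hs e]%oAndP.
move: k => /(mem_eqr e)/chkP k; oex k as u [hu e']%oAndP.
apply: mem_eql (feq_sym e') _; apply: chk_lt; exact: lt_trans hs.
Qed.

Lemma Ext_transitive : Ext (@sTransitive P).
Proof. rewrite /sTransitive /sSubset; ext. Qed.

Lemma chk_ordinal t p : p ⊩ sOrdinal (chk t).
Proof.
apply: oAndI; first exact: chk_transitive.
move=> x; oi h; move/chkP: h => h; oex h as s [hs e]%oAndP.
apply: Ext_transitive (feq_sym e) _; exact: chk_transitive.
Qed.

Lemma ordinal_trans x y z p : p ⊩ sOrdinal x -> p ⊩ y ∈ x -> p ⊩ z ∈ y -> p ⊩ z ∈ x.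
Proof. move=> /oAndP [h _] k; apply: oImpE; exact: oAllE (oImpE (oAllE h y) k) z. Qed.

Lemma ordinal_mem x y p : p ⊩ sOrdinal x -> p ⊩ y ∈ x -> p ⊩ sOrdinal y.
Proof.
move=> o h; apply: oAndI; first by case/oAndP: o => _ k; exact: oImpE (oAllE k y) h.
move=> z; oi k; case/oAndP: (o) => _ o'; apply: oImpE (oAllE o' z) _; exact: ordinal_trans h k.
Qed.

(** An induction on [t] with an inner induction on the name [x]. If [x] contains every smaller
    ground ordinal, then either [x] is included in [chk t] and they agree, or some element of [x]
    lies outside [chk t] and the inner hypothesis applies to it. *)
Lemma trichotomy t x p : p ⊩ sOrdinal x -> p ⊩ x ∈ chk t ∨ (x ≐ chk t ∨ chk t ∈ x).
Proof.
elim: t / (lt_wf t) x p => t _ IH.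
have above x p : p ⊩ sOrdinal x -> (forall s, lt s t -> p ⊩ chk s ∈ x) -> p ⊩ x ≐ chk t ∨ chk t ∈ x.
  elim: x p => I f IHx S p o sub.
  oem (∃ i, S i ∧ ¬ f i ∈ chk t) as h.
    oex h as i [hi n]%oAndP; apply: oOrI2.
    have hm : p ⊩ f i ∈ mk I f S by apply: mem_el.
    have oy := ordinal_mem o hm.
    have k : p ⊩ f i ≐ chk t ∨ chk t ∈ f i.
      apply: IHx => // s st; have k := IH s st _ _ oy; oor k as k.
        case: (n p (le_refl p)); apply: ordinal_trans (@chk_ordinal t p) (chk_lt p st) k.
      oor k as k => //.
      case: (n p (le_refl p)); apply: mem_eql (feq_sym k) _; exact: chk_lt.
    oor k as k; first exact: mem_eql k hm.
    exact: ordinal_trans o hm k.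
  apply: oOrI1; apply: ext_eq => q pq z hz; lift pq.
    oex hz as i [hi e]%oAndP; apply: mem_eql (feq_sym e) _.
    oem (f i ∈ chk t) as k => //.
    by case: (h p (le_refl p)); apply: (oExI (x := i)); exact: oAndI.
  move/chkP: hz => hz; oex hz as s [st e]%oAndP.
  apply: mem_eql (feq_sym e) _; exact: sub.
move=> x p o.
oem (∃ s, ⌜lt s t⌝ ∧ (x ∈ chk s ∨ x ≐ chk s)) as h.
  apply: oOrI1; oex h as s [st h]%oAndP; oor h as h; last exact: mem_eql (feq_sym h) (chk_lt p st).
  exact: ordinal_trans (@chk_ordinal t p) (chk_lt p st) h.
apply: oOrI2; apply: above => // s st; have k := IH s st _ _ o.
have no : p ⊩ (x ∈ chk s ∨ x ≐ chk s) ⇒ chk s ∈ x.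
  oi k'; case: (h p (le_refl p)); apply: (oExI (x := s)); exact: oAndI (oLiftI _ st) k'.
oor k as k; first by apply: (oImpE no); apply: oOrI1.
by oor k as k => //; apply: (oImpE no); apply: oOrI2.
Qed.
End Check.

(** * Consequences of sigma-closure and of the chain condition *)

Section Density.
Context {L : Type}.
Local Notation P := (Cond L).
Implicit Types p q r : P.

(** Sigma-closure: infinitely many choices of ground witnesses are made one after another, and an
    upper bound of the chain collects them. No new sequence of ground objects is added. *)
Lemma decide_seq T (F : nat -> T -> om P) p : (forall n, p ⊩ (∃ t, F n t)) ->
  exists q, p ⊑ q /\ exists f, forall n, q ⊩ F n (f n).
Proof.
move=> h.
have [next hn] : exists next : nat * P -> P * T, forall z, p ⊑ snd z -> snd z ⊑ fst (next z) /\
    (fst (next z) ⊩ F (fst z) (snd (next z))).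
  apply: (choice_fun (R := fun z w => p ⊑ snd z -> snd z ⊑ fst w /\ (fst w ⊩ F (fst z) (snd w)))) => -[n q].
  have [r0 [_ [t0 _]]] := oEx_dense (h 0).
  case: (classic (p ⊑ q)) => pq; last by exists (q, t0).
  have [r [qr [t ht]]] := oEx_dense (mono pq (h n)); by exists (r, t).
pose s := fix s n := match n with 0 => p | S k => fst (next (k, s k)) end.
have ps n : p ⊑ s n.
  by elim: n => [|n IH]; [exact: le_refl|apply: le_trans IH (proj1 (hn (n, s n) IH))].
have [q hq] := @cond_chain L s (fun n => proj1 (hn (n, s n) (ps n))).
exists q; split; first exact: (hq 0).
exists (fun n => snd (next (n, s n))) => n; apply: mono (hq (S n)) _; exact: (proj2 (hn (n, s n) (ps n))).
Qed.

Lemma decide_set (A : nat -> om P) p : exists q, p ⊑ q /\ exists Z : nat -> Prop, forall n,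
  (Z n -> q ⊩ A n) /\ (~ Z n -> q ⊩ ¬ A n).
Proof.
have [n|q [pq [f hf]]] := @decide_seq bool (fun n b => if b then A n else ¬ A n) p.
  apply: oExD => q pq; have [r [qr [h|h]]] := oDec (A n) q; exists r; split=> //; by [exists true|exists false].
exists q; split=> //; exists (fun n => f n = true) => n.
by have := hf n; case: (f n).
Qed.

(** The chain condition: a value that can be decided densely often has only [real] many
    candidates. *)
Lemma cover T (Q : P -> T -> Prop) p : (forall q r t, q ⊑ r -> Q q t -> Q r t) ->
  (forall q, p ⊑ q -> exists r, q ⊑ r /\ exists t, Q r t) ->
  exists g : real -> T, forall q, p ⊑ q -> exists r, q ⊑ r /\ exists i, Q r (g i).
Proof.
move=> mon den.
have [r0 [pr0 Dr0]] := den p (le_refl p).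
have [g [gD gp]] := @cond_predense L (fun r => exists t, Q r t) r0 Dr0.
have [t ht] := choice_fun gD.
exists t => q pq; have [r [qr Dr]] := den q pq; have [i [b [rb gb]]] := gp r Dr.
by exists b; split; [exact: le_trans rb|exists i; apply: mon (ht i)].
Qed.
End Density.

(** * Injections into ground ordinals *)

Section Cardinals.
Context {L : scale}.
Local Notation P := (Cond L).
Implicit Types p q r : P.
Implicit Types s t u : L.
Implicit Types x y z a b c X : name P.

(** A forced injection of [X] into the ordinal [t], kept as a relation whose values are actual
    ground ordinals, so that equality of values is equality in the ground. *)
Definition rel_inj p X t (G : name P -> L -> om P) :=
  (forall u, Ext (fun x => G x u)) /\
  (forall q, p ⊑ q -> forall x, q ⊩ x ∈ X -> q ⊩ (∃ u, ⌜lt u t⌝ ∧ G x u)) /\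
  (forall q, p ⊑ q -> forall x u u', q ⊩ x ∈ X -> q ⊩ G x u -> q ⊩ G x u' -> u = u') /\
  (forall q, p ⊑ q -> forall x x' u, q ⊩ x ∈ X -> q ⊩ x' ∈ X -> q ⊩ G x u -> q ⊩ G x' u -> q ⊩ x ≐ x').

Definition fun_of (G : name P -> L -> om P) x y := ∃ u, y ≐ chk u ∧ G x u.

Lemma fun_of1 G y : (forall u, Ext (fun x => G x u)) -> Ext (fun x => fun_of G x y).
Proof. by move=> h; apply: Ext_ex => u; apply: Ext_and; [apply: Ext_const|]. Qed.

Lemma fun_of2 G x : Ext (fun_of G x).
Proof. by apply: Ext_ex => u; apply: Ext_and; [apply: Ext_eq1|apply: Ext_const]. Qed.

Section Rel.
Context (p : P) (X : name P) (t : L) (G : name P -> L -> om P) (h : rel_inj p X t G).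

Lemma fun_of_total q : p ⊑ q -> forall x, q ⊩ x ∈ X -> q ⊩ (∃ y ∈ chk t, fun_of G x y).
Proof.
move=> pq x hx; have k := proj1 (proj2 h) q pq x hx; oex k as u [hu k]%oAndP.
apply: (oExI (x := chk u)); apply: oAndI; first exact: chk_lt.
apply: (oExI (x := u)); apply: oAndI => //; exact: feq_refl.
Qed.

Lemma fun_of_fun q : p ⊑ q -> forall x y z, q ⊩ x ∈ X -> q ⊩ fun_of G x y -> q ⊩ fun_of G x z -> q ⊩ y ≐ z.
Proof.
move=> pq x y z hx k k'; oex k as u [ey k]%oAndP; oex k' as u' [ez k']%oAndP.
have E : u = u' by case: h => _ [_ [h3 _]]; exact: (h3 q pq x u u' hx k k').
subst u'; exact: feq_trans ey (feq_sym ez).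
Qed.

Lemma fun_of_inj q : p ⊑ q -> forall x x' y, q ⊩ x ∈ X -> q ⊩ x' ∈ X ->
  q ⊩ fun_of G x y -> q ⊩ fun_of G x' y -> q ⊩ x ≐ x'.
Proof.
move=> pq x x' y hx hx' k k'; oex k as u [ey k]%oAndP; oex k' as u' [ez k']%oAndP.
have E : u = u' by apply: chk_inj (feq_trans (feq_sym ey) ez).
subst u'; case: h => _ [_ [_ h4]]; exact: (h4 q pq x x' u).
Qed.

Lemma rel_inj_card : p ⊩ sCardLe X (chk t).
Proof.
apply: (oExI (x := mkfun X (chk t) (fun_of G))); apply: mkfun_inj.
- move=> y; apply: fun_of1; by case: h.
- exact: fun_of2.
- exact: fun_of_total.
- exact: fun_of_fun.
- exact: fun_of_inj.
Qed.

Lemma rel_bij_card : (forall q, p ⊑ q -> forall u, lt u t -> q ⊩ (∃ x ∈ X, G x u)) -> p ⊩ sCardEq X (chk t).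
Proof.
move=> ho; apply: (oExI (x := mkfun X (chk t) (fun_of G))); apply: mkfun_bij.
- move=> y; apply: fun_of1; by case: h.
- exact: fun_of2.
- exact: fun_of_total.
- exact: fun_of_fun.
- exact: fun_of_inj.
move=> q pq y /chkP k; oex k as u [hu e]%oAndP; have k := ho q pq u hu.
oex k as x [hx k]%oAndP; apply: (oExI (x := x)); apply: oAndI => //.
apply: (oExI (x := u)); exact: oAndI.
Qed.
End Rel.

Lemma inj_rel p X t f : p ⊩ sIsInj f X (chk t) -> rel_inj p X t (fun x u => sMaps f x (chk u)).
Proof.
move=> i; split; [by move=> u; apply: Ext_maps1|split; [|split]] => q pq; move: (mono pq i) => {}i.
- move=> x hx; have k := func_total (inj_func i) hx; oex k as y k.
  have [_ /chkP hy] := func_dom (inj_func i) k; oex hy as u [hu e]%oAndP.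
  apply: (oExI (x := u)); apply: (oAndI hu); exact: maps_ext (@feq_refl _ x _) e k.
- move=> x u u' hx k k'; exact: chk_inj (func_fun (inj_func i) k k').
- move=> x x' u _ _; exact: inj_inj i.
Qed.

Lemma card_rel p X t : p ⊩ sCardLe X (chk t) -> forall C,
  (forall q G, p ⊑ q -> rel_inj q X t G -> q ⊩ C) -> p ⊩ C.
Proof.
move=> h C k; refine (oExE h _) => q pq f i; apply: k pq _; exact: inj_rel i.
Qed.

Lemma card_le_map p X t t' (h : L -> L) : (forall u, lt u t -> lt (h u) t') ->
  (forall u u', lt u t -> lt u' t -> h u = h u' -> u = u') ->
  p ⊩ sCardLe X (chk t) -> p ⊩ sCardLe X (chk t').
Proof.
move=> ht hi c; apply: (card_rel c) => q G pq [g1 [g2 [g3 g4]]].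
apply: (rel_inj_card (G := fun x v => ∃ u, ⌜lt u t /\ v = h u⌝ ∧ G x u)).
split; first by move=> u; ext; apply: g1.
split; [|split] => r qr.
- move=> x hx; have k := g2 r qr x hx; oex k as u [hu k]%oAndP.
  apply: (oExI (x := h u)); apply: oAndI; first exact: ht.
  by apply: (oExI (x := u)); apply: oAndI.
- move=> x u u' hx k k'.
  have [r1 [l1 [v /oAndP [[hv ->] kv]]]] := oEx_dense k; move: (mono l1 k') => {}k'.
  have [r2 [l2 [v' /oAndP [[hv' ->] kv']]]] := oEx_dense k'.
  have l := le_trans l1 l2.
  by rewrite (g3 r2 (le_trans qr l) x v v' (mono l hx) (mono l2 kv) kv').
- move=> x x' u hx hx' k k'; oex k as v [[hv e]%oLiftE k]%oAndP.
  oex k' as v' [[hv' e']%oLiftE k']%oAndP.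
  have E : v = v' by apply: hi => //; rewrite -e -e'.
  by subst v'; apply: (g4 r qr x x' v).
Qed.
End Cardinals.

(** * Collapsing the range of an injection to an initial segment *)

Section Collapse.
Context {L : scale}.
Local Notation P := (Cond L).
Implicit Types p q r : P.
Implicit Types s t u v : L.
Implicit Types x y z X : name P.

Lemma decide_below (A : L -> om P) t p : covered nat t -> exists q, p ⊑ q /\ exists Z : L -> Prop,
  forall s, lt s t -> (Z s -> q ⊩ A s) /\ (~ Z s -> q ⊩ ¬ A s).
Proof.
move=> [f hf]; have [q [pq [Z hZ]]] := decide_set (fun n => A (f n)) p.
exists q; split=> //; exists (fun s => exists n, f n = s /\ Z n) => s /hf [n <-].
split=> [[m [<- Zm]]|h]; first exact: (proj1 (hZ m) Zm).
by apply: (proj2 (hZ n)) => Zn; apply: h; exists n.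
Qed.

Section Col.
Context (p : P) (X : name P) (t : L) (G : name P -> L -> om P).
Context (h : rel_inj p X t G) (ht : forall u, lt u t -> covered nat u).

Let A s : om P := ∃ x ∈ X, G x s.
Definition decides (A : L -> om P) (Z : L -> Prop) u q := forall s, lt s u -> (Z s -> q ⊩ A s) /\ (~ Z s -> q ⊩ ¬ A s).

Lemma decides_mono A' Z u q r : q ⊑ r -> decides A' Z u q -> decides A' Z u r.
Proof. by move=> qr d s /d [h1 h2]; split=> [/h1|/h2]; apply: mono. Qed.

Lemma decides_unique A' Z Z' u q : decides A' Z u q -> decides A' Z' u q -> otype Z u = otype Z' u.
Proof.
move=> d d'; apply: otype_ext => s su; have [h1 h2] := d s su; have [h1' h2'] := d' s su.
split=> k; apply: NNPP => n; first by case: (h2' n q (le_refl q) (h1 k)).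
by case: (h2 n q (le_refl q) (h1' k)).
Qed.

(** At [q] the value [u] of [x] is known, as is the range of the injection below [u], whose order
    type is [v]. [C] below is the collapsed injection. *)
Let S x v q := exists u Z, (q ⊩ G x u) /\ lt u t /\ decides A Z u q /\ otype Z u = v.
Let C x v : om P := oGen (S x v).

Lemma S_mono x v q r : q ⊑ r -> S x v q -> S x v r.
Proof.
move=> qr [u [Z [h1 [h2 [h3 h4]]]]]; exists u, Z; split; first exact: mono h1.
by split=> //; split=> //; apply: decides_mono h3.
Qed.

Lemma C_elim x v q : q ⊩ C x v -> exists r, q ⊑ r /\ S x v r.
Proof.
move=> /(_ q (le_refl q)) [r [s [qr [sr k]]]]; exists r; split=> //; exact: S_mono k.
Qed.

Lemma C_ext v : Ext (fun x => C x v).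
Proof.
move=> q x y e k r qr; have [r' [rr' [u [Z [h1 hZ]]]]] := C_elim (mono qr k).
exists r', r'; split=> //; split; first exact: le_refl.
exists u, Z; split=> //; case: h => eG _; apply: eG h1; exact: mono (le_trans qr rr') e.
Qed.

Lemma C_total q x : p ⊑ q -> q ⊩ x ∈ X -> exists r, q ⊑ r /\ exists v, S x v r.
Proof.
move=> pq hx; have [r [qr [u /oAndP [hu k]]]] := oEx_dense (proj1 (proj2 h) q pq x hx).
have [r' [rr' [Z hZ]]] := decide_below A r (ht hu).
exists r'; split; first exact: le_trans rr'.
exists (otype Z u), u, Z; split; [exact: mono k|by []].
Qed.

Lemma C_fun q : p ⊑ q -> forall x v v', q ⊩ x ∈ X -> q ⊩ C x v -> q ⊩ C x v' -> v = v'.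
Proof.
move=> pq x v v' hx k k'; have [r [qr [u [Z [h1 [h2 [h3 <-]]]]]]] := C_elim k.
have [r' [rr' [u' [Z' [h1' [h2' [h3' <-]]]]]]] := C_elim (mono qr k').
have l := le_trans qr rr'.
have E : u = u' by exact: (proj1 (proj2 (proj2 h)) r' (le_trans pq l) x _ _ (mono l hx) (mono rr' h1) h1').
subst u'; exact: decides_unique (decides_mono rr' h3) h3'.
Qed.

(** The value [u] is itself in the range, so it would be counted below [u'] and make the order type
    at [u'] strictly larger. *)
Lemma C_lt q x u u' Z Z' : p ⊑ q -> q ⊩ x ∈ X -> q ⊩ G x u -> decides A Z u q ->
  decides A Z' u' q -> otype Z u = otype Z' u' -> ~ lt u u'.
Proof.
move=> pq hx k d d' e l.
have Zu : Z' u.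
  apply: NNPP => n; have [_ k'] := d' u l; apply: (k' n q (le_refl q)).
  by apply: (oExI (x := x)); apply: oAndI.
have := proj1 (otypeP Z' u') u l Zu; rewrite -e.
have -> : otype Z' u = otype Z u.
  by apply: decides_unique d => s su; apply: d'; apply: lt_trans l.
exact: lt_irr.
Qed.

Lemma C_inj q : p ⊑ q -> forall x x' v, q ⊩ x ∈ X -> q ⊩ x' ∈ X -> q ⊩ C x v -> q ⊩ C x' v -> q ⊩ x ≐ x'.
Proof.
move=> pq x x' v hx hx' k k'; apply: reg => r qr; lift qr.
have [r' [l [u [Z [h1 [h2 [h3 h4]]]]]]] := C_elim k.
have [r'' [l' [u' [Z' [h1' [h2' [h3' h4']]]]]]] := C_elim (mono l k').
have l2 := le_trans l l'; exists r''; split=> //.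
have E : u = u'.
  have n1 := C_lt (le_trans pq l2) (mono l2 hx) (mono l' h1) (decides_mono l' h3) h3'.
  have n2 := C_lt (le_trans pq l2) (mono l2 hx') h1' h3' (decides_mono l' h3).
  case: (lt_total u u') => [/n1|[//|/n2]]; rewrite h4 h4'; by case.
subst u'; exact: (proj2 (proj2 (proj2 h)) r'' (le_trans pq l2) x x' u (mono l2 hx) (mono l2 hx') (mono l' h1) h1').
Qed.

Lemma C_rel q t' : p ⊑ q -> (forall r x v, q ⊑ r -> r ⊩ x ∈ X -> S x v r -> lt v t') -> rel_inj q X t' C.
Proof.
move=> pq bd; split; first exact: C_ext.
split; [|split] => r qr.
- move=> x hx; apply: oExD => r' rr'; have [r1 [l [v k]]] := C_total (le_trans pq (le_trans qr rr')) (mono rr' hx).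
  exists r1; split=> //; exists v; apply: oAndI; last exact: oGenI k (le_refl _).
  exact: bd (le_trans (le_trans qr rr') l) (mono (le_trans rr' l) hx) k.
- exact: C_fun (le_trans pq qr).
- exact: C_inj (le_trans pq qr).
Qed.

(** Composing an injection with the order type of its range below each value gives an injection onto
    an initial segment of [t]. Each [u] below [t] is countable, so a stronger condition decides the
    whole range below [u], and the order type is computed in the ground. *)
Lemma collapse : p ⊩ (∃ v, ⌜lt v t⌝ ∧ sCardLe X (chk v)) ∨ sCardEq X (chk t).
Proof.
(* Collapsed values are downward closed: a smaller order type is attained at an element [z] of the
   range, and the preimage of [z] collapses to it. *)
have down r x v v' : p ⊑ r -> r ⊩ x ∈ X -> S x v r -> lt v' v -> r ⊩ (∃ y ∈ X, C y v').
  move=> pr hx [u [Z [h1 [h2 [h3 <-]]]]] /otype_onto [z [zu [Zz <-]]].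
  have k := proj1 (h3 z zu) Zz.
  refine (oExE k _) => r' rr' y /oAndP [hy k']; apply: (oExI (x := y)); apply: (oAndI hy).
  apply: oGenI (le_refl r'); exists z, Z; split=> //; split; first exact: lt_trans h2.
  split=> // s sz; have [k1 k2] := h3 s (lt_trans sz zu).
  by split=> [/k1|/k2]; apply: mono.
(* If some [v] below [t] is missed, downward closure puts all collapsed values below [v]; otherwise
   the collapse is onto. *)
refine (oEm (A := ∃ v, ⌜lt v t⌝ ∧ ¬ (∃ x ∈ X, C x v)) _ _) => q pq no.
  apply: oOrI1; refine (oExE no _) => r qr v /oAndP [hv n].
  apply: (oExI (x := v)); apply: (oAndI hv); apply: (rel_inj_card (G := C)).
  apply: C_rel; first exact: le_trans qr.
  move=> r' x v' rr' hx k; case: (lt_total v' v) => [//|h'].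
  case: (n r' rr'); case: h' => [e|h']; last by apply: down h'; eauto; apply: le_trans pq (le_trans qr rr').
  subst v'; apply: (oExI (x := x)); apply: (oAndI hx); exact: oGenI k (le_refl _).
apply: oOrI2; apply: (rel_bij_card (G := C)).
  apply: C_rel => // r x v qr hx [u [Z [_ [ut [_ <-]]]]].
  have [_ [_ n]] := otypeP Z u; case: (lt_total (otype Z u) u) => [k|[->|k]] //; exact: lt_trans ut.
move=> r qr v hv; refine (oEm (A := ∃ x ∈ X, C x v) _ _) => // r' rr' n.
case: (no r' (le_trans qr rr')); apply: (oExI (x := v)); exact: oAndI (oLiftI _ hv) n.
Qed.
End Col.
End Collapse.

(** * Ground traces of forced surjections *)

Section Surjections.
Context {L : Type}.
Local Notation P := (Cond L).
Implicit Types p q r : P.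

(** [None] records that there is no value at all, so that some option is always decided densely. *)
Definition value I T (H : I -> T -> om P) i (o : option T) : om P :=
  match o with Some y => H i y | None => ¬ (∃ y, H i y) end.

Lemma value_dense I T (H : I -> T -> om P) i q : exists r, q ⊑ r /\ exists o, r ⊩ value H i o.
Proof.
have [r [qr [h|h]]] := oDec (∃ y, H i y) q; last by exists r; split=> //; exists None.
have [r' [rr' [y hy]]] := oEx_dense h.
by exists r'; split; [exact: le_trans rr'|exists (Some y)].
Qed.

(** Sigma-closure decides the entire partial function on [nat], which is what preserves [om1]. *)
Lemma surj_count T (H : nat -> T -> om P) (D : nat -> Prop) (B : T -> Prop) p :
  (forall q, p ⊑ q -> forall n y y', q ⊩ H n y -> q ⊩ H n y' -> y = y') ->
  (forall y, B y -> p ⊩ (∃ n, ⌜D n⌝ ∧ H n y)) ->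
  exists h : nat -> option T, forall y, B y -> exists n, D n /\ h n = Some y.
Proof.
move=> fn onto; have [n|q [pq [h hh]]] := @decide_seq L _ (value H) p.
  apply: oExD => q _; exact: value_dense.
exists h => y /onto k; have [r [qr [n /oAndP [Dn hy]]]] := oEx_dense (mono pq k).
exists n; split; first exact: Dn.
have := mono qr (hh n); case: (h n) => [y'|] /= k'.
  by rewrite (fn r (le_trans pq qr) n y' y k' hy).
by case: (k' r (le_refl r)); apply: oExI hy.
Qed.

(** The chain condition leaves [real] many candidates at each index, which is what preserves [om2]
    and bounds the number of leaf sets an ordinal can enumerate. *)
Lemma surj_real I T (H : I -> T -> om P) (B : T -> Prop) p :
  (forall q, p ⊑ q -> forall n y y', q ⊩ H n y -> q ⊩ H n y' -> y = y') ->
  (forall y, B y -> p ⊩ (∃ n, H n y)) ->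
  exists h : I -> real -> option T, forall y, B y -> exists n i, h n i = Some y.
Proof.
move=> fn onto.
have [h hh] : exists h : I -> real -> option T, forall n q, p ⊑ q -> exists r, q ⊑ r /\ exists i, r ⊩ value H n (h n i).
  apply: (choice_fun (R := fun n g => forall q, p ⊑ q -> exists r, q ⊑ r /\ exists i, r ⊩ value H n (g i))) => n.
  apply: (cover (Q := fun r o => r ⊩ value H n o)) => [q r o qr|q _]; [exact: mono|exact: value_dense].
exists h => y /onto k; have [r [pr [n hy]]] := oEx_dense k.
have [r' [rr' [i hi]]] := hh n r pr; exists n, i; move: hi; case: (h n i) => [y'|] /= k'.
  by rewrite (fn r' (le_trans pr rr') n y' y k' (mono rr' hy)).
by case: (k' r' (le_refl r')); apply: oExI (mono rr' hy).
Qed.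
End Surjections.

(** * The first three alephs of the extension *)

Section Alephs.
Context {L : scale}.
Local Notation P := (Cond L).
Implicit Types p q r : P.
Implicit Types s t u : L.
Implicit Types x w X : name P.

Lemma fin_inj i j : @fin L i = fin j -> i = j.
Proof.
move=> e; have [h|[//|h]] : i < j \/ i = j \/ j < i by lia.
  by case: (@lt_irr L (fin j)); rewrite -{1}e; apply/lt_fin.
by case: (@lt_irr L (fin j)); rewrite -{2}e; apply/lt_fin.
Qed.

Lemma covered_code A t (a0 : A) : covered A t ->
  exists c : L -> A, forall s s', lt s t -> lt s' t -> c s = c s' -> s = s'.
Proof.
move=> [f hf]; have [c hc] : exists c : L -> A, forall s, lt s t -> f (c s) = s.
  apply: (choice_fun (R := fun s a => lt s t -> f a = s)) => s.
  by case: (classic (lt s t)) => [/hf [a e]|n]; [exists a|exists a0].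
by exists c => s s' /hc {2}<- /hc {2}<- ->.
Qed.

Lemma card_rel_dense p X t : p ⊩ sCardLe X (chk t) -> exists q G, p ⊑ q /\ rel_inj q X t G.
Proof.
move=> /oEx_dense [q [pq [f i]]]; exists q, (fun x u => sMaps f x (chk u)); split=> //; exact: inj_rel.
Qed.

(** Read backwards, a forced injection of [chk s] into [t] is a partial function from the ordinals
    below [t] onto those below [s]; in this form [surj_count] and [surj_real] apply. *)
Lemma rel_functional I (f : I -> L) q s t G : rel_inj q (chk s) t G ->
  forall r, q ⊑ r -> forall n y y', r ⊩ ⌜lt y s⌝ ∧ G (chk y) (f n) -> r ⊩ ⌜lt y' s⌝ ∧ G (chk y') (f n) -> y = y'.
Proof.
move=> [_ [_ [_ h]]] r qr n y y' /oAndP [ys k] /oAndP [ys' k'].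
apply: (@chk_inj P L y y' r); apply: (h r qr _ _ (f n)) => //; exact: chk_lt.
Qed.

Lemma rel_onto q s t G y : rel_inj q (chk s) t G -> lt y s -> q ⊩ (∃ u, ⌜lt u t⌝ ∧ (⌜lt y s⌝ ∧ G (chk y) u)).
Proof.
move=> [_ [h _]] ys; have k := h q (le_refl q) _ (chk_lt q ys); oex k as u [hu k]%oAndP.
apply: (oExI (x := u)); apply: (oAndI hu); exact: oAndI (oLiftI _ ys) k.
Qed.

Lemma card_le_count p s t : p ⊩ sCardLe (chk s) (chk t) -> covered nat t -> covered nat s.
Proof.
move=> /card_rel_dense [q [G [_ h]]] [f hf].
have [||g hg] := @surj_count L L (fun n y => ⌜lt y s⌝ ∧ G (chk y) (f n)) (fun _ => True) (fun y => lt y s) q.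
- exact: rel_functional h.
- move=> y /(rel_onto h) k; oex k as u [hu k]%oAndP; have [n E] := hf u hu; subst u; apply: (oExI (x := n)); exact: oAndI (oLiftI _ I) k.
exists (fun n => match g n with Some y => y | None => s end) => y /hg [n [_ e]].
by exists n; rewrite e.
Qed.

Lemma card_le_real p s t : p ⊩ sCardLe (chk s) (chk t) -> covered real t -> covered real s.
Proof.
move=> /card_rel_dense [q [G [_ h]]] [f hf].
have [||g hg] := @surj_real L real L (fun n y => ⌜lt y s⌝ ∧ G (chk y) (f n)) (fun y => lt y s) q.
- exact: rel_functional h.
- move=> y /(rel_onto h) k; oex k as u [hu k]%oAndP; have [n E] := hf u hu; subst u; exact: (oExI (x := n)).
apply: covered_onto onto_real_prod _.
exists (fun z => match g (fst z) (snd z) with Some y => y | None => s end) => y /hg [n [i e]].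
by exists (n, i); rewrite e.
Qed.

Lemma card_le_fin p s n : p ⊩ sCardLe (chk s) (chk (@fin L n)) -> lt s om0.
Proof.
move=> /card_rel_dense [q [G [_ h]]]; apply: NNPP => ns.
have om k : lt (fin k) s.
  have k0 : lt (fin k) (@om0 L) by apply/lt_om0; exists k.
  by case: (lt_total s om0) => [//|[->//|/(lt_trans k0)]].
have [||g hg] := @surj_count L L (fun m y => ⌜lt y s⌝ ∧ G (chk y) (fin m)) (fun m => m < n)
  (fun y => exists k, y = fin k) q.
- exact: rel_functional h.
- move=> y [k ->]; have l := rel_onto h (om k); oex l as u [hu l]%oAndP.
  have [m e] : exists m, u = fin m.
    by apply/lt_om0; apply: lt_trans (hu : lt u (@fin L n)) _; apply/lt_om0; exists n.
  subst u; apply: (oExI (x := m)); apply: (oAndI _ l); apply: oLiftI; apply/lt_fin; exact: hu.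
(* Pigeonhole in the ground: [n + 1] distinct finite ordinals would occur among [n] values. *)
have := @NoDup_incl_length _ (map (fun k => Some (@fin L k)) (seq 0 (S n))) (map g (seq 0 n)).
rewrite !length_map !length_seq => le; suff /le : incl (map (fun k => Some (@fin L k)) (seq 0 (S n))) (map g (seq 0 n)).
  move=> le'; suff : S n <= n by lia.
  apply: le'.
  apply: FinFun.Injective_map_NoDup; last exact: seq_NoDup.
  by move=> i j [/fin_inj].
move=> o /in_map_iff [k [<- _]]; have [|m [mn e]] := hg (fin k); first by exists k.
by apply/in_map_iff; exists m; split=> //; apply/in_seq; lia.
Qed.

Lemma chk_id p t : rel_inj p (chk t) t (fun x u => x ≐ chk u).
Proof.
split; [by move=> u; apply: Ext_eq1|split; [|split]] => q pq.
- by move=> x /chkP.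
- move=> x u u' _ e e'; apply: chk_inj (feq_trans (feq_sym e) e').
- move=> x x' u _ _ e e'; exact: feq_trans e (feq_sym e').
Qed.

Lemma chk_card_map p t t' (h : L -> L) : (forall u, lt u t -> lt (h u) t') ->
  (forall u u', lt u t -> lt u' t -> h u = h u' -> u = u') -> p ⊩ sCardLe (chk t) (chk t').
Proof. move=> h1 h2; apply: (card_le_map h1 h2); exact: rel_inj_card (chk_id p t). Qed.

Lemma covered_map t : covered nat t -> exists h : L -> L, (forall u, lt u t -> lt (h u) om0) /\
  (forall u u', lt u t -> lt u' t -> h u = h u' -> u = u').
Proof.
move=> /(covered_code 0) [c hc]; exists (fun u => fin (c u)); split.
  by move=> u _; apply/lt_om0; exists (c u).
by move=> u u' h h' /fin_inj; apply: hc.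
Qed.

Lemma cardEq_sym a b p : p ⊩ sCardEq a b -> p ⊩ sCardEq b a.
Proof.
move=> h; oex h as f h; apply: (oExI (x := mkfun b a (fun y x => sMaps f x y))).
apply: mkfun_bij.
- move=> y; exact: Ext_maps2.
- move=> x; exact: Ext_maps1.
- move=> q pq y hy; have {}h := mono pq h; have k := bij_onto h hy; oex k as x k.
  apply: (oExI (x := x)); apply: (oAndI _ k); exact: (proj1 (func_dom (inj_func (bij_inj h)) k)).
- move=> q pq y x x' _; have {}h := mono pq h; exact: inj_inj (bij_inj h).
- move=> q pq y y' x _ _; have {}h := mono pq h; exact: func_fun (inj_func (bij_inj h)).
- move=> q pq x hx; have {}h := mono pq h; have k := func_total (inj_func (bij_inj h)) hx; oex k as y k.
  apply: (oExI (x := y)); apply: (oAndI _ k); exact: (proj2 (func_dom (inj_func (bij_inj h)) k)).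
Qed.

Lemma cardEq_le a b p : p ⊩ sCardEq a b -> p ⊩ sCardLe a b.
Proof. move=> h; oex h as f h; apply: (oExI (x := f)); exact: bij_inj h. Qed.

Let e0 : nat -> name P := fun _ => numeral 0.

(** The notion is by conversion the meaning of its formula, so the congruence is an instance of
    [Ext_sem]; the index functions point at the first two entries of the environment. *)
Lemma Ext_cardEq1 b : Ext (fun x => sCardEq x b).
Proof. exact (@Ext_sem P (CardEq (fun e => e - 2) (fun e => e - 1) 2) (econs b e0)). Qed.
Lemma Ext_cardEq2 b : Ext (fun x => sCardEq b x).
Proof. exact (@Ext_sem P (CardEq (fun e => e - 1) (fun e => e - 2) 2) (econs b e0)). Qed.
Lemma Ext_cardLe2 b : Ext (fun x => sCardLe b x).
Proof. exact (@Ext_sem P (CardLe (fun e => e - 1) (fun e => e - 2) 2) (econs b e0)). Qed.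
Lemma Ext_cardinal : Ext (@sCardinal P).
Proof. exact (@Ext_sem P (Cardinal (fun e => e - 1) 1) e0). Qed.
Lemma Ext_limit : Ext (@sLimit P).
Proof. exact (@Ext_sem P (Limit (fun e => e - 1) 1) e0). Qed.

Lemma chk_cardinal p t : (forall q s, lt s t -> ~ (q ⊩ sCardLe (chk t) (chk s))) -> p ⊩ sCardinal (chk t).
Proof.
move=> h; apply: oAndI; first exact: chk_ordinal.
move=> a q pq /chkP k; oex k as s [hs e]%oAndP; oi k.
have {}k := Ext_cardEq1 e k; apply: (h q s hs); exact: cardEq_le (cardEq_sym k).
Qed.

Lemma om1_cardinal p : p ⊩ sCardinal (chk (@om1 L)).
Proof.
apply: chk_cardinal => q s /lt_om1 c /card_le_count /(_ c) /lt_om1; exact: lt_irr.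
Qed.

Lemma om2_cardinal p : p ⊩ sCardinal (chk (@om2 L)).
Proof.
apply: chk_cardinal => q s /lt_om2 c /card_le_real /(_ c) /lt_om2; exact: lt_irr.
Qed.

Lemma fresh p c c' : exists u, lt u om1 /\ fn p (c, u) = None /\ fn p (c', u) = None.
Proof.
apply: NNPP => n; apply: (@lt_irr L om1); apply/lt_om1.
have [e he] : countable (fn p) by case: (p) => ? [].
exists (fun n => match e n with Some k => snd k | None => om1 end) => u hu.
case E : (fn p (c, u)) => [v|].
  by have [|m em] := he (c, u); [rewrite E|exists m; rewrite em].
case E' : (fn p (c', u)) => [v|].
  by have [|m em] := he (c', u); [rewrite E'|exists m; rewrite em].
by case: n; exists u.
Qed.

Definition c0 : coord L := leaf (fun _ => false).

(* The first place where the generic function at the leaf [c0] takes the value [v]; this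
   injects the reals into [om1]. *)
Definition place (v : real) u : om P := ⌜lt u om1⌝ ∧ (gen c0 u v ∧ (∀ u', ⌜lt u' u⌝ ⇒ ¬ gen c0 u' v)).

Lemma place_total p v : p ⊩ (∃ u, place v u).
Proof.
apply: oExD => q _.
have [u [hu [qu _]]] := fresh q c0 c0; have [r [qr [e _]]] := leaf_extend v qu.
(* The minimum is taken over all extensions of [q], so that no extension of [r'] can put [v] at an
   earlier place. *)
have [w [[r' [qr' [hw k]]] min]] := least (Q := fun u => exists r', q ⊑ r' /\ lt u om1 /\ (r' ⊩ gen c0 u v))
  (ex_intro _ r (conj qr (conj hu (genI e)))).
exists r'; split=> //; exists w; apply: oAndI => //; apply: oAndI => // w' s rs ww t st k'.
apply: (min w' ww); exists t; split; first exact: le_trans qr' (le_trans rs st).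
by split=> //; apply: lt_trans hw.
Qed.

Lemma place_inj p v v' u : p ⊩ place v u -> p ⊩ place v' u -> v = v'.
Proof. move=> /oAndP [_ /oAndP [h _]] /oAndP [_ /oAndP [h' _]]; exact: gen_unique h h'. Qed.

Lemma place_fun p v u u' : p ⊩ place v u -> p ⊩ place v u' -> u = u'.
Proof.
move=> /oAndP [_ /oAndP [h n]] /oAndP [_ /oAndP [h' n']].
case: (lt_total u u') => [l|[//|l]].
  by case: (oNotE (oImpE (oAllE n' u) (oLiftI p l)) h).
by case: (oNotE (oImpE (oAllE n u') (oLiftI p l)) h').
Qed.

(** Composition with [place]: whatever injects into the ground reals has size at most aleph_1 in the
    extension. *)
Lemma card_le_place p X (R : name P -> real -> om P) : (forall v, Ext (fun x => R x v)) ->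
  (forall q, p ⊑ q -> forall x, q ⊩ x ∈ X -> q ⊩ (∃ v, R x v)) ->
  (forall q, p ⊑ q -> forall x v v', q ⊩ x ∈ X -> q ⊩ R x v -> q ⊩ R x v' -> v = v') ->
  (forall q, p ⊑ q -> forall x x' v, q ⊩ x ∈ X -> q ⊩ x' ∈ X -> q ⊩ R x v -> q ⊩ R x' v -> q ⊩ x ≐ x') ->
  p ⊩ sCardLe X (chk (@om1 L)).
Proof.
move=> e tot fn inj; apply: (rel_inj_card (G := fun x u => ∃ v, R x v ∧ place v u)).
split; first by move=> u; apply: Ext_ex => v; apply: Ext_and; [exact: e|apply: Ext_const].
split; [|split] => q pq.
- move=> x hx; have k := tot q pq x hx; oex k as v k; have l := @place_total q v; oex l as u l.
  apply: (oExI (x := u)); apply: oAndI; first by case/oAndP: l.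
  by apply: (oExI (x := v)); apply: oAndI.
- move=> x u u' hx k k'; have [r [qr [v /oAndP [h1 h2]]]] := oEx_dense k.
  have [r' [rr' [v' /oAndP [h1' h2']]]] := oEx_dense (mono qr k').
  have l := le_trans qr rr'.
  have E := fn r' (le_trans pq l) x v v' (mono l hx) (mono rr' h1) h1'; subst v'.
  exact: place_fun (mono rr' h2) h2'.
- move=> x x' u hx hx' k k'; oex k as v [h1 h2]%oAndP; oex k' as v' [h1' h2']%oAndP.
  have E := place_inj h2 h2'; subst v'; exact: (inj q pq x x' v).
Qed.

Lemma chk_card_place p s : covered real s -> p ⊩ sCardLe (chk s) (chk (@om1 L)).
Proof.
move=> /(covered_code (fun _ => true)) [c hc].
apply: (card_le_place (R := fun x v => ∃ u, ⌜lt u s /\ v = c u⌝ ∧ x ≐ chk u)).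
- by move=> v; ext.
- move=> q _ x /chkP h; oex h as u [hu e]%oAndP; apply: (oExI (x := c u)); apply: (oExI (x := u)).
  exact: oAndI (oLiftI _ (conj hu eq_refl)) e.
- move=> q _ x v v' _ k k'; have [r [qr [u /oAndP [[hu ->] h1]]]] := oEx_dense k.
  have [r' [rr' [u' /oAndP [[hu' ->] h1']]]] := oEx_dense (mono qr k').
  by rewrite (chk_inj (feq_trans (feq_sym (mono rr' h1)) h1')).
- move=> q _ x x' v _ _ k k'; oex k as u [[hu e]%oLiftE h1]%oAndP; oex k' as u' [[hu' e']%oLiftE h1']%oAndP.
  have E : u = u' by apply: hc => //; rewrite -e -e'.
  subst u'; exact: feq_trans h1 (feq_sym h1').
Qed.

Lemma not_cardinal p s t : lt t s -> p ⊩ sCardEq (chk s) (chk t) -> ~ (p ⊩ sCardinal (chk s)).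
Proof.
move=> h e /oAndP [_ k].
exact: oNotE (oImpE (oAllE k (chk t)) (chk_lt p h)) (cardEq_sym e).
Qed.

(** [collapse] takes the role of Schröder-Bernstein: an injection of [s] into [om0] becomes a
    bijection with [om0] or an injection into a finite ordinal, and the latter is impossible. *)
Lemma not_cardinal1 p s : lt om0 s -> lt s om1 -> ~ (p ⊩ sCardinal (chk s)).
Proof.
move=> h0 h1 c; have [h [hh1 hh2]] := covered_map (proj1 (lt_om1 s) h1).
have [q [G [pq g]]] := card_rel_dense (@chk_card_map p _ _ _ hh1 hh2).
suff: q ⊩ ⊥ by move=> k; exact: k.
have k := collapse g (fun u hu => proj1 (lt_om1 u) (lt_trans hu (om0_om1 L))).
lift pq; oor k as k; last exact: not_cardinal h0 k c.
oex k as v [hv k]%oAndP; have [n E] := proj1 (lt_om0 v) hv; subst v.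
by apply: (@lt_irr L s); apply: lt_trans h0; exact: card_le_fin k.
Qed.

(** An image of the ground reals injects into [om1] through [place], and [collapse] turns this into
    a bijection, as [om1] is still uncountable. *)
Lemma not_cardinal2 p s : lt om1 s -> lt s om2 -> ~ (p ⊩ sCardinal (chk s)).
Proof.
move=> h1 h2 c; have [q [G [pq g]]] := card_rel_dense (@chk_card_place p _ (proj1 (lt_om2 s) h2)).
suff: q ⊩ ⊥ by move=> k; exact: k.
have k := collapse g (fun u hu => proj1 (lt_om1 u) hu).
lift pq; oor k as k; last exact: not_cardinal h1 k c.
oex k as v [hv k]%oAndP.
have c1 := card_le_count k (proj1 (lt_om1 v) hv).
by apply: (@lt_irr L s); apply: lt_trans h1; apply/lt_om1.
Qed.

Lemma om0_limit p : p ⊩ sLimit (chk (@om0 L)).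
Proof.
apply: oAndI; first exact: chk_ordinal.
have f n : p ⊩ chk (@fin L n) ∈ chk (@om0 L) by apply: chk_lt; apply/lt_om0; exists n.
apply: oAndI; first by apply: (oExI (x := chk (@fin L 0))); exact: f.
move=> x; oi h; move/chkP: h => h; oex h as s [hs e]%oAndP.
have [n E] := proj1 (lt_om0 s) hs; subst s.
apply: (oExI (x := chk (fin (S n)))); apply: oAndI; first exact: f.
move=> y; apply: oIffI => q pq; lift pq; split.
  move/chkP => h; oex h as s [hs' e']%oAndP.
  have [m E] : exists m, s = fin m.
    by apply/lt_om0; apply: lt_trans (hs' : lt s (@fin L (S n))) _; apply/lt_om0; exists (S n).
  subst s; case: (Nat.eq_dec m n) => [E|ne].
    by subst m; apply: oOrI2; exact: feq_trans e' (feq_sym e).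
  apply: oOrI1; apply: mem_eqr (feq_sym e) _; apply: mem_eql (feq_sym e') _; apply: chk_lt; apply/lt_fin.
  have /lt_fin : lt (@fin L m) (fin (S n)) by exact: hs'.
  lia.
have ls : lt (@fin L n) (fin (S n)) by apply/lt_fin; lia.
move=> h; oor h as h; last first.
  by apply: mem_eql (feq_sym (feq_trans h e)) _; apply: chk_lt.
apply: ordinal_trans (@chk_ordinal _ _ _ p) (chk_lt p ls) _; exact: mem_eqr e h.
Qed.

Lemma fin_not_limit p n : ~ (p ⊩ sLimit (chk (@fin L n))).
Proof.
move=> /oAndP [_ /oAndP [h1 h2]].
have fin_lt q s m : q ⊩ ⌜lt s (@fin L m)⌝ -> exists k, s = fin k /\ k < m.
  move=> h; have [k E] : exists k, s = fin k.
    by apply/lt_om0; apply: lt_trans (h : lt s (@fin L m)) _; apply/lt_om0; exists m.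
  exists k; split=> //; have : lt (@fin L k) (@fin L m) by rewrite -E; exact: h.
  by move/lt_fin.
suff: p ⊩ ⊥ by move=> k; exact: k.
case: n h1 h2 => [|n] h1 h2.
  oex h1 as x h; move/chkP: h => h; oex h as s [hs _]%oAndP.
  by have [k [_ l]] := fin_lt _ _ _ hs; lia.
have l : lt (@fin L n) (fin (S n)) by apply/lt_fin; lia.
have h := oImpE (oAllE h2 (chk (fin n))) (chk_lt p l).
oex h as z [hz hs]%oAndP.
have m : p ⊩ chk (@fin L n) ∈ z by apply/(oIffE (oAllE hs _)); apply: oOrI2; exact: feq_refl.
move/chkP: hz => hz; oex hz as s [hs' e]%oAndP; have [k [E kn]] := fin_lt _ _ _ hs'; subst s.
have /lt_fin := chk_mem (mem_eqr e m); lia.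
Qed.

Lemma om0_aleph0 p : p ⊩ sIsAleph0 (chk (@om0 L)).
Proof.
apply: oAndI; first exact: om0_limit.
move=> x; oi h; oi k; move/chkP: h => h; oex h as s [hs e]%oAndP.
have [n E] := proj1 (lt_om0 s) hs; subst s; exact: fin_not_limit (Ext_limit e k).
Qed.

Lemma aleph0_unique w p : p ⊩ sIsAleph0 w -> p ⊩ w ≐ chk (@om0 L).
Proof.
move=> /oAndP [lim n]; have o : p ⊩ sOrdinal w by case/oAndP: lim.
have h := @trichotomy P L om0 _ _ o; oor h as h.
  move/chkP: h => h; oex h as s [hs e]%oAndP.
  have [m E] := proj1 (lt_om0 s) hs; subst s.
  by case: (fin_not_limit (Ext_limit e lim)).
oor h as h; first exact: h.
by case: (oNotE (oImpE (oAllE n _) h) (@om0_limit p)).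
Qed.

Lemma om1_cardSucc p : p ⊩ sIsCardSucc (chk (@om1 L)) (chk (@om0 L)).
Proof.
apply: oAndI; first exact: om1_cardinal.
apply: oAndI; first exact: chk_lt (om0_om1 L).
move=> m; oi c; oi h; move=> x; oi hx.
have o : p ⊩ sOrdinal m by case/oAndP: c.
have k := @trichotomy P L om1 _ _ o; oor k as k.
  move/chkP: k => k; oex k as s [hs e]%oAndP.
  case: (@not_cardinal1 p s (chk_mem (mem_eqr e h)) hs (Ext_cardinal e c)).
oor k as k; first exact: mem_eqr (feq_sym k) hx.
exact: ordinal_trans o k hx.
Qed.

Lemma om1_aleph1 p : p ⊩ sIsAleph1 (chk (@om1 L)).
Proof.
apply: (oExI (x := chk (@om0 L))); apply: oAndI; [exact: om0_aleph0|exact: om1_cardSucc].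
Qed.

Lemma aleph1_unique k p : p ⊩ sIsAleph1 k -> p ⊩ k ≐ chk (@om1 L).
Proof.
move=> h; oex h as w [hw [c [wk min]%oAndP]%oAndP]%oAndP; have {}hw := aleph0_unique hw.
have o : p ⊩ sOrdinal k by case/oAndP: c.
have h := @trichotomy P L om1 _ _ o; oor h as h.
  move/chkP: h => h; oex h as s [hs e]%oAndP.
  case: (@not_cardinal1 p s (chk_mem (mem_eqr e (mem_eql hw wk))) hs (Ext_cardinal e c)).
oor h as h => //.
have m : p ⊩ w ∈ chk (@om1 L) by apply: mem_eql (feq_sym hw) (chk_lt p (om0_om1 L)).
have l := oImpE (oImpE (oAllE min _) (@om1_cardinal p)) m.
by case: (lt_irr (chk_mem (oImpE (oAllE l _) h))).
Qed.

Lemma om2_cardSucc p : p ⊩ sIsCardSucc (chk (@om2 L)) (chk (@om1 L)).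
Proof.
apply: oAndI; first exact: om2_cardinal.
apply: oAndI; first exact: chk_lt (om1_om2 L).
move=> m; oi c; oi h; move=> x; oi hx.
have o : p ⊩ sOrdinal m by case/oAndP: c.
have k := @trichotomy P L om2 _ _ o; oor k as k.
  move/chkP: k => k; oex k as s [hs e]%oAndP.
  case: (@not_cardinal2 p s (chk_mem (mem_eqr e h)) hs (Ext_cardinal e c)).
oor k as k; first exact: mem_eqr (feq_sym k) hx.
exact: ordinal_trans o k hx.
Qed.

Lemma om2_aleph2 p : p ⊩ sIsAleph2 (chk (@om2 L)).
Proof.
apply: (oExI (x := chk (@om1 L))); apply: oAndI; [exact: om1_aleph1|exact: om2_cardSucc].
Qed.

Lemma aleph2_sub k p : p ⊩ sIsAleph2 k -> p ⊩ sSubset k (chk (@om2 L)).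
Proof.
move=> h; oex h as w [hw [c [wk min]%oAndP]%oAndP]%oAndP; have {}hw := aleph1_unique hw.
have m : p ⊩ w ∈ chk (@om2 L) by apply: mem_eql (feq_sym hw) (chk_lt p (om1_om2 L)).
exact: oImpE (oImpE (oAllE min _) (@om2_cardinal p)) m.
Qed.

Lemma countable_chk p X s : covered nat s -> p ⊩ sCardLe X (chk s) -> p ⊩ sCountable X.
Proof.
move=> /covered_map [h [h1 h2]] c; apply: (oExI (x := chk (@om0 L))); apply: oAndI; first exact: om0_aleph0.
exact: card_le_map h1 h2 c.
Qed.

Lemma countable_card p X : p ⊩ sCountable X -> p ⊩ sCardLe X (chk (@om0 L)).
Proof. move=> h; oex h as w [hw h]%oAndP; exact: Ext_cardLe2 (aleph0_unique hw) h. Qed.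

Lemma card_le_om1 p X : p ⊩ sCardLe X (chk (@om1 L)) -> p ⊩ sCountable X ∨ sCardEq X (chk (@om1 L)).
Proof.
move=> h; apply: (card_rel h) => q G pq g.
have k := collapse g (fun u hu => proj1 (lt_om1 u) hu); oor k as k; last exact: oOrI2.
apply: oOrI1; oex k as v [hv k]%oAndP; exact: countable_chk (proj1 (lt_om1 v) hv) k.
Qed.

Lemma ltAleph1_countable p X : p ⊩ sCardLtAleph1 X -> p ⊩ sCountable X.
Proof.
move=> h; oex h as k [hk [h n]%oAndP]%oAndP; have {}hk := aleph1_unique hk.
have c := card_le_om1 (Ext_cardLe2 hk h); oor c as c => //.
by case: (oNotE n (Ext_cardEq2 (feq_sym hk) c)).
Qed.
End Alephs.

(** * CH and the size of the power set of aleph_1 *)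

Section Continuum.
Context {L : scale}.
Local Notation P := (Cond L).
Implicit Types p q r : P.
Implicit Types s t u : L.
Implicit Types x y X : name P.

Definition decide (A : Prop) : bool := match excluded_middle_informative A with left _ => true | right _ => false end.

Lemma decideP (A : Prop) : decide A = true <-> A.
Proof. by rewrite /decide; case: excluded_middle_informative. Qed.

Lemma pow_isPower a p : p ⊩ @sIsPower P (pow a) a.
Proof. move=> x; apply: oIffI => q _; exact: powP. Qed.

Definition real_of x (v : real) : om P := ∀ n, (⌜v n = true⌝ ⇒ chk (@fin L n) ∈ x) ∧ (⌜v n = false⌝ ⇒ ¬ chk (@fin L n) ∈ x).

Lemma real_of_t x v n p : p ⊩ real_of x v -> v n = true -> p ⊩ chk (@fin L n) ∈ x.
Proof. move=> /oAllE /(_ n) /oAndP [h _] e; exact: oImpE h (oLiftI _ e). Qed.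
Lemma real_of_f x v n p : p ⊩ real_of x v -> v n = false -> ~ (p ⊩ chk (@fin L n) ∈ x).
Proof. move=> /oAllE /(_ n) /oAndP [_ h] e k; exact: oNotE (oImpE h (oLiftI _ e)) k. Qed.

(** No reals are added: a stronger condition decides membership of all finite ordinals at once. *)
Lemma real_of_total x p : p ⊩ (∃ v, real_of x v).
Proof.
apply: oExD => q _; have [r [qr [Z hZ]]] := decide_set (fun n => chk (@fin L n) ∈ x) q.
exists r; split=> //; exists (fun n => decide (Z n)) => n; have [h1 h2] := hZ n.
apply: oAndI => r' rr'; rewrite /decide; case: excluded_middle_informative => k // e.
  exact: mono (h1 k).
exact: mono (h2 k).
Qed.

Lemma real_of_unique x v v' p : p ⊩ real_of x v -> p ⊩ real_of x v' -> v = v'.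
Proof.
move=> h h'; apply: functional_extensionality => n.
case e : (v n); case e' : (v' n) => //.
  by case: (real_of_f h' e' (real_of_t h e)).
by case: (real_of_f h e (real_of_t h' e')).
Qed.

Lemma real_of_sub x x' v p : p ⊩ x ∈ pow (chk (@om0 L)) -> p ⊩ real_of x v -> p ⊩ real_of x' v ->
  forall q, p ⊑ q -> forall y, q ⊩ y ∈ x -> q ⊩ y ∈ x'.
Proof.
move=> /powP hx h h' q pq y hy; have /chkP k := oImpE (oAllE (mono pq hx) y) hy.
lift pq; oex k as s [hs e]%oAndP; have [n E] := proj1 (lt_om0 s) hs; subst s.
apply: mem_eql (feq_sym e) _; apply: (real_of_t h').
case e' : (v n) => //; case: (real_of_f h e' (mem_eql e hy)).
Qed.

Definition set_of (v : real) : name P := mk nat (fun n => chk (@fin L n)) (fun n => ⌜v n = true⌝).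

Lemma set_of_mem v n p : p ⊩ chk (@fin L n) ∈ set_of v -> v n = true.
Proof.
by move=> /oEx_dense [q [_ [m /oAndP [hm /chk_inj /fin_inj ->]]]]; exact: hm.
Qed.

Lemma set_of_real v p : p ⊩ real_of (set_of v) v.
Proof.
move=> n; apply: oAndI => q _ h; first exact: (mem_el (el := fun n => chk (@fin L n))).
by move=> r _ /set_of_mem e; move: (oLiftE h); rewrite e.
Qed.

Lemma set_of_pow v p : p ⊩ set_of v ∈ pow (chk (@om0 L)).
Proof.
apply/powP; move=> y; oi h; oex h as n [_ e]%oAndP; apply: mem_eql (feq_sym e) _; apply: chk_lt.
by apply/lt_om0; exists n.
Qed.

(** A forced injection into [om0] would, restricted to names of ground reals, leave a ground
    surjection of [nat] onto [real]. *)
Lemma pow_uncountable p : ~ (p ⊩ sCountable (pow (chk (@om0 L)))).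
Proof.
move=> /countable_card /card_rel_dense [q [G [_ [g1 [g2 [g3 g4]]]]]].
have [||h hh] := @surj_count L real (fun n v => G (set_of v) (fin n)) (fun _ => True) (fun _ => True) q.
- move=> r qr n v v' k k'.
  have e := g4 r qr _ _ _ (@set_of_pow v r) (@set_of_pow v' r) k k'.
  apply: real_of_unique (@set_of_real v r) _ => m; have := @set_of_real v' r m.
  move=> /oAndP [h1 h2]; apply: oAndI; oi h.
    by apply: mem_eqr (feq_sym e) _; apply: (oImpE h1).
  by oi h'; apply: (oNotE (oImpE h2 h)); exact: mem_eqr e h'.
- move=> v _; have k := g2 q (le_refl q) _ (@set_of_pow v q); oex k as u [hu k]%oAndP.
  have [n E] := proj1 (lt_om0 u) hu; subst u; apply: (oExI (x := n)); exact: oAndI (oLiftI _ I) k.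
apply: (@cantor nat); exists (fun n => match h n with Some v => v | None => fun _ => true end) => v.
by have [n [_ e]] := hh v I; exists n; rewrite e.
Qed.

Theorem forced_CH p : p ⊩ @sCH P.
Proof.
apply: (oExI (x := chk (@om0 L))); apply: (oExI (x := chk (@om1 L))); apply: (oExI (x := pow (chk (@om0 L)))).
apply: oAndI; first exact: om0_aleph0. apply: oAndI; first exact: om1_aleph1.
apply: oAndI; first exact: pow_isPower.
have k : p ⊩ sCardLe (pow (chk (@om0 L))) (chk (@om1 L)).
  apply: (card_le_place (R := real_of)).
  - by move=> v; rewrite /real_of; ext.
  - move=> q _ x _; exact: real_of_total.
  - move=> q _ x v v' _; exact: real_of_unique.
  - move=> q _ x x' v hx hx' h h'; apply: ext_eq; exact: real_of_sub.
have {}k := card_le_om1 k; oor k as k => //.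
by case: (pow_uncountable k).
Qed.

(** A forced map on ordinals has at most [real] many possible values at each of them, so [L * real]
    bounds what it can enumerate. Labels are the subsets of this product, and Cantor makes them too
    many. *)
Definition label := (L * real -> bool)%type.
Definition one : real := fun _ => true.
Definition zero : real := fun _ => false.

Definition leaf_set (l : label) : name P :=
  mk {u : L | lt u om1} (fun k => chk (proj1_sig k)) (fun k => gen (leaf l) (proj1_sig k) one).

Lemma leaf_set_pow l p : p ⊩ leaf_set l ∈ pow (chk (@om1 L)).
Proof.
apply/powP; move=> y; oi h; oex h as [u hu] [_ e]%oAndP; apply: mem_eql (feq_sym e) _; exact: chk_lt.
Qed.

(** Conditions are countable, so some [u] below [om1] is free at both leaves, and opposite values
    can be set there. *)
Lemma leaf_set_inj l l' p : p ⊩ leaf_set l ≐ leaf_set l' -> l = l'.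
Proof.
move=> e; apply: NNPP => ne; have [u [hu [n n']]] := fresh p (leaf l) (leaf l').
have [q [pq [q1 q2]]] := leaf_extend one n.
have m' : fn q (leaf l', u) = None by rewrite q2 // => -[E]; case: ne.
have [r [qr [r1 _]]] := leaf_extend zero m'.
have h : r ⊩ chk u ∈ leaf_set l.
  apply: (oExI (x := exist _ u hu)); apply: oAndI; last exact: feq_refl.
  exact: genI (fn_mono qr q1).
have {}h := mem_eqr (mono (le_trans pq qr) e) h.
have [r' [rr' [[u' hu'] /oAndP [/= k /chk_inj E]]]] := oEx_dense h.
subst u'; have := gen_fun k (fn_mono rr' r1); rewrite /one /zero => E.
by have := f_equal (fun g => g 0) E.
Qed.

Definition tag s : label := fun z => decide (fst z = s).

Lemma tag_inj s t : tag s = tag t -> s = t.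
Proof.
move=> /(f_equal (fun g => g (s, one))) e; have : tag s (s, one) = true by apply/decideP.
by rewrite e => /decideP.
Qed.

Theorem forced_2_aleph1 p : p ⊩ @sTwoToAleph1GtAleph2 P.
Proof.
apply: (oExI (x := chk (@om1 L))); apply: (oExI (x := chk (@om2 L))); apply: (oExI (x := pow (chk (@om1 L)))).
apply: oAndI; first exact: om1_aleph1. apply: oAndI; first exact: om2_aleph2.
apply: oAndI; first exact: pow_isPower. apply: oAndI.
  pose F x y : om P := ∃ s, x ≐ chk s ∧ y ≐ leaf_set (tag s).
  apply: (oExI (x := mkfun (chk (@om2 L)) (pow (chk (@om1 L))) F)); apply: mkfun_inj.
  - by move=> y; rewrite /F; ext.
  - by move=> x; rewrite /F; ext.
  - move=> q _ x /chkP h; oex h as s [_ e]%oAndP; apply: (oExI (x := leaf_set (tag s))).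
    apply: oAndI; first exact: leaf_set_pow.
    apply: (oExI (x := s)); apply: (oAndI e); exact: feq_refl.
  - move=> q _ x y z _ h h'; oex h as s [e1 e2]%oAndP; oex h' as t [e1' e2']%oAndP.
    have E := chk_inj (feq_trans (feq_sym e1) e1'); subst t; exact: feq_trans e2 (feq_sym e2').
  - move=> q _ x x' y _ _ h h'; oex h as s [e1 e2]%oAndP; oex h' as t [e1' e2']%oAndP.
    have E := tag_inj (leaf_set_inj (feq_trans (feq_sym e2) e2')); subst t.
    exact: feq_trans e1 (feq_sym e1').
oi h; oex h as f h.
(* The possible preimages of leaf sets under a bijection with [om2] would give a ground surjection
   of [L * real] onto the labels. *)
have [||g hg] := @surj_real L L label (fun s l => sMaps f (chk s) (leaf_set l)) (fun _ => True) p.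
- move=> q pq s l l' k k'; exact: leaf_set_inj (func_fun (inj_func (bij_inj (mono pq h))) k k').
- move=> l _; have k := bij_onto h (@leaf_set_pow l p); oex k as a k.
  have [/chkP ha _] := func_dom (inj_func (bij_inj h)) k; oex ha as s [_ e]%oAndP.
  apply: (oExI (x := s)); exact: Ext_maps1 e k.
case: (@cantor (L * real)); exists (fun z => match g (fst z) (snd z) with Some l => l | None => fun _ => true end) => l.
by have [s [i e]] := hg l I; exists (s, i); rewrite /= e.
Qed.
End Continuum.

(** * Topology in the Boolean-valued model *)

Section Topology.
Context {P : poset}.
Implicit Types p q r : P.
Implicit Types x y z u v w A D X t : name P.

Lemma subsetE A D x p : p ⊩ sSubset A D -> p ⊩ x ∈ A -> p ⊩ x ∈ D.
Proof. move=> h; exact: oImpE (oAllE h x). Qed.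

Lemma open_sub X t u x p : p ⊩ sIsTopology X t -> p ⊩ u ∈ t -> p ⊩ x ∈ u -> p ⊩ x ∈ X.
Proof. move=> /oAndP [h _] hu; exact: subsetE (oImpE (oAllE h u) hu). Qed.

Lemma open_inter X t u v p : p ⊩ sIsTopology X t -> p ⊩ u ∈ t -> p ⊩ v ∈ t -> p ⊩ (∃ w ∈ t, sIsInter w u v).
Proof.
move=> /oAndP [_ /oAndP [_ /oAndP [_ /oAndP [h _]]]] hu; exact: oImpE (oAllE (oImpE (oAllE h u) hu) v).
Qed.

Lemma open_local X t A p : p ⊩ sIsTopology X t -> p ⊩ (∀ x ∈ A, ∃ u ∈ t, x ∈ u ∧ sSubset u A) -> p ⊩ A ∈ t.
Proof.
move=> /oAndP [_ /oAndP [_ /oAndP [_ /oAndP [_ h]]]] loc.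
have ex : Ext (fun u => sSubset u A) by rewrite /sSubset; ext.
have k : p ⊩ sSubset (sep t (fun u => sSubset u A)) t.
  by move=> u; oi k; case/(sepP _ _ _ ex): k.
have {}h := oImpE (oAllE h _) k; oex h as u [hu h]%oAndP.
apply: mem_eql hu; apply: ext_eq => q pq x hx; lift pq.
  have := proj1 (oIffE (oAllE h x)) hx => {}hx; oex hx as v [hv hx]%oAndP.
  have [_ hs] := proj1 (sepP _ _ _ ex) hv; exact: subsetE hs hx.
apply/(oIffE (oAllE h x)); have l := oImpE (oAllE loc x) hx; oex l as v [hv [xv vA]%oAndP]%oAndP.
apply: (oExI (x := v)); apply: (oAndI _ xv); apply/(sepP _ _ _ ex); by split.
Qed.

Lemma closedDiscrete_local D X t x p : p ⊩ sClosedDiscrete D X t -> p ⊩ x ∈ X ->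
  p ⊩ (∃ u ∈ t, x ∈ u ∧ (∀ y, y ∈ u ⇒ y ∈ D ⇒ y ≐ x)).
Proof.
move=> /oAndP [_ /oAndP [cl dis]] hx; oem (x ∈ D) as h.
  have k := oImpE (oAllE dis x) h; oex k as u [hu k]%oAndP.
  apply: (oExI (x := u)); apply: (oAndI hu); apply: oAndI.
    have := proj2 (oIffE (oAllE k x)) (feq_refl _ _); by case/oAndP.
  move=> y; oi hy; oi hy'; apply/(oIffE (oAllE k y)); exact: oAndI.
oex cl as c [hc k]%oAndP; apply: (oExI (x := c)); apply: (oAndI hc); apply: oAndI.
  apply/(oIffE (oAllE k x)); exact: oAndI.
move=> y; oi hy; oi hy'; have := proj1 (oIffE (oAllE k y)) hy; case/oAndP => _ n; case: (oNotE n hy').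
Qed.

(** A closed discrete set is one that every point of the space has an open neighbourhood meeting in
    at most that point; both halves of the definition follow from this local form. *)
Lemma closedDiscreteI D X t p : p ⊩ sIsTopology X t -> p ⊩ sSubset D X ->
  p ⊩ (∀ x ∈ X, ∃ u ∈ t, x ∈ u ∧ (∀ y, y ∈ u ⇒ y ∈ D ⇒ y ≐ x)) -> p ⊩ sClosedDiscrete D X t.
Proof.
move=> top sub loc; apply: (oAndI sub); apply: oAndI.
  have ex : Ext (fun x => ¬ x ∈ D) by ext.
  apply: (oExI (x := sep X (fun x => ¬ x ∈ D))); apply: oAndI; last first.
    move=> x; apply: oIffI => q pq; split=> [/(sepP _ _ _ ex) [h1 h2]|/oAndP h]; first exact: oAndI.
    by apply/(sepP _ _ _ ex).
  apply: (open_local top); move=> x; oi h; have [hx n] := proj1 (sepP _ _ _ ex) h.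
  have k := oImpE (oAllE loc x) hx; oex k as u [hu [xu k]%oAndP]%oAndP.
  apply: (oExI (x := u)); apply: (oAndI hu); apply: (oAndI xu).
  move=> y; oi hy; apply/(sepP _ _ _ ex); split; first exact: open_sub top hu hy.
  oi hy'; apply: (oNotE n); apply: (mem_eql _ hy'); exact: oImpE (oImpE (oAllE k y) hy) hy'.
move=> x; oi hx; have k := oImpE (oAllE loc x) (subsetE sub hx); oex k as u [hu [xu k]%oAndP]%oAndP.
apply: (oExI (x := u)); apply: (oAndI hu); move=> y; apply: oIffI => q pq; lift pq.
split=> [/oAndP [h1 h2]|e]; first exact: oImpE (oImpE (oAllE k y) h1) h2.
apply: oAndI; [exact: mem_eql (feq_sym e) xu|exact: mem_eql (feq_sym e) hx].
Qed.
End Topology.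

(** * Sticky sets *)

Section Sticky.
Context {P : poset}.
Implicit Types p q r : P.
Implicit Types x y z u v w D X t U : name P.

Definition nbr U x y : om P := ∃ u, sMaps U x u ∧ y ∈ u.

Lemma Ext_nbr1 U y : Ext (fun x => nbr U x y).
Proof. rewrite /nbr; ext. Qed.
Lemma ona_func U X t p : p ⊩ sONA U X t -> p ⊩ sIsFunc U X t.
Proof. by case/oAndP. Qed.

Lemma ona_self U X t x u p : p ⊩ sONA U X t -> p ⊩ sMaps U x u -> p ⊩ x ∈ u.
Proof.
move=> /oAndP [h k] m; exact: oImpE (oAllE (oImpE (oAllE k x) (proj1 (func_dom h m))) u) m.
Qed.

Lemma nbr_self U X t x p : p ⊩ sONA U X t -> p ⊩ x ∈ X -> p ⊩ nbr U x x.
Proof.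
move=> o hx; have k := func_total (ona_func o) hx; oex k as u k.
apply: (oExI (x := u)); apply: (oAndI k); exact: ona_self o k.
Qed.

Lemma nbr_dom U X t x y p : p ⊩ sONA U X t -> p ⊩ nbr U x y -> p ⊩ x ∈ X.
Proof. move=> o k; oex k as u [k _]%oAndP; exact: (proj1 (func_dom (ona_func o) k)). Qed.

Lemma nbr_cod U X t x y p : p ⊩ sIsTopology X t -> p ⊩ sONA U X t -> p ⊩ nbr U x y -> p ⊩ y ∈ X.
Proof.
move=> top o k; oex k as u [k h]%oAndP.
exact: open_sub top (proj2 (func_dom (ona_func o) k)) h.
Qed.

Lemma unionI U D x y p : p ⊩ x ∈ D -> p ⊩ nbr U x y -> p ⊩ sInUnionImage y U D.
Proof. move=> h k; apply: (oExI (x := x)); exact: oAndI h k. Qed.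

Lemma unionE U D y p C : p ⊩ sInUnionImage y U D ->
  (forall q x, p ⊑ q -> q ⊩ x ∈ D -> q ⊩ nbr U x y -> q ⊩ C) -> p ⊩ C.
Proof. move=> h k; refine (oExE h _) => q pq x /oAndP [h1 h2]; exact: k pq h1 h2. Qed.

Lemma union_mono U D D' y p : p ⊩ sSubset D D' -> p ⊩ sInUnionImage y U D -> p ⊩ sInUnionImage y U D'.
Proof. move=> s h; apply: (unionE h) => q x pq h1 h2; exact: unionI (subsetE (mono pq s) h1) h2. Qed.

Lemma sticky_cd U D X t p : p ⊩ sSticky U D X t -> p ⊩ sClosedDiscrete D X t.
Proof. by case/oAndP. Qed.

Lemma sticky_sub U D X t p : p ⊩ sSticky U D X t -> p ⊩ sSubset D X.
Proof. by move=> /sticky_cd /oAndP []. Qed.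

Lemma stickyE U D X t x y p : p ⊩ sONA U X t -> p ⊩ sSticky U D X t -> p ⊩ nbr U x y -> p ⊩ y ∈ D ->
  p ⊩ sInUnionImage x U D.
Proof.
move=> o /oAndP [_ h] k hy; have hx := nbr_dom o k; apply: (oImpE (oImpE (oAllE h x) hx)).
oex k as u [k k']%oAndP; apply: (oExI (x := u)); apply: (oAndI k); apply: (oExI (x := y)); exact: oAndI.
Qed.

Lemma stickyI U D X t p : p ⊩ sClosedDiscrete D X t ->
  (forall q x y, p ⊑ q -> q ⊩ x ∈ X -> q ⊩ nbr U x y -> q ⊩ y ∈ D -> q ⊩ sInUnionImage x U D) -> p ⊩ sSticky U D X t.
Proof.
move=> cd h; apply: (oAndI cd); move=> x q pq hx r qr k.
refine (oExE k _) => r1 l1 u /oAndP [k1 k2]; refine (oExE k2 _) => r2 l2 y /oAndP [k3 k4].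
have l := le_trans qr (le_trans l1 l2); apply: (h _ x y (le_trans pq l) (mono l hx) _ k4).
apply: (oExI (x := u)); exact: oAndI (mono l2 k1) k3.
Qed.
End Sticky.

(** * Coding countable sticky sets by pieces *)

Section Main.
Context {L : scale}.
Local Notation P := (Cond L).
Implicit Types p q r : P.
Implicit Types s : L.
Implicit Types x y z u v w D : name P.
Implicit Types e f : piece L.
Context (X t U j : name P).

(** [U] is an assignment already refined to have countable values. [j] attaches ground ordinals to
    the points, so that pieces, which are ground objects, can refer to them. *)
Definition setup : om P := sIsTopology X t ∧ sONA U X t ∧ (∀ x, ∀ u, sMaps U x u ⇒ sCountable u) ∧
  sIsInj j X (chk (@om2 L)) ∧ (∀ Y ∈ t, sCardLeAleph1 Y ⇒ sSubspaceStronglyD Y t U).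

Lemma setup_top p : p ⊩ setup -> p ⊩ sIsTopology X t.
Proof. by case/oAndP. Qed.
Lemma setup_ona p : p ⊩ setup -> p ⊩ sONA U X t.
Proof. by move=> /oAndP [_ /oAndP []]. Qed.
Lemma setup_countable p x u : p ⊩ setup -> p ⊩ sMaps U x u -> p ⊩ sCountable u.
Proof. move=> /oAndP [_ /oAndP [_ /oAndP [h _]]]; exact: oImpE (oAllE (oAllE h x) u). Qed.
Lemma setup_inj p : p ⊩ setup -> p ⊩ sIsInj j X (chk (@om2 L)).
Proof. by move=> /oAndP [_ /oAndP [_ /oAndP [_ /oAndP []]]]. Qed.
Lemma setup_strong p Y : p ⊩ setup -> p ⊩ Y ∈ t -> p ⊩ sCardLeAleph1 Y -> p ⊩ sSubspaceStronglyD Y t U.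
Proof.
move=> /oAndP [_ /oAndP [_ /oAndP [_ /oAndP [_ h]]]] h1 h2; exact: oImpE (oImpE (oAllE h Y) h1) h2.
Qed.

Definition J x s : om P := sMaps j x (chk s).

Lemma J_total p x : p ⊩ setup -> p ⊩ x ∈ X -> p ⊩ (∃ s, ⌜lt s om2⌝ ∧ J x s).
Proof. move=> /setup_inj /inj_rel h hx; exact: (proj1 (proj2 h) p (le_refl p) x hx). Qed.
Lemma J_dom p x s : p ⊩ setup -> p ⊩ J x s -> p ⊩ x ∈ X.
Proof. move=> /setup_inj h k; exact: (proj1 (func_dom (inj_func h) k)). Qed.
Lemma J_fun p x s s' : p ⊩ setup -> p ⊩ J x s -> p ⊩ J x s' -> s = s'.
Proof. move=> /setup_inj h k k'; exact: chk_inj (func_fun (inj_func h) k k'). Qed.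
Lemma J_inj p x y s : p ⊩ setup -> p ⊩ J x s -> p ⊩ J y s -> p ⊩ x ≐ y.
Proof. move=> /setup_inj h; exact: inj_inj h. Qed.
Lemma J_ext s : Ext (fun x => J x s).
Proof. exact: Ext_maps1. Qed.

Definition ones e : name P := sep X (fun x => ∃ s, ⌜e s = Some one⌝ ∧ J x s).

Lemma ones_ext e : Ext (fun x => ∃ s, ⌜e s = Some one⌝ ∧ J x s).
Proof. rewrite /J; ext. Qed.

Lemma onesP p e x : p ⊩ x ∈ ones e <-> (p ⊩ x ∈ X) /\ (p ⊩ (∃ s, ⌜e s = Some one⌝ ∧ J x s)).
Proof. exact: (sepP X p x (@ones_ext e)). Qed.

Lemma ones_J p e x s : p ⊩ setup -> p ⊩ J x s -> (p ⊩ x ∈ ones e <-> e s = Some one).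
Proof.
move=> h k; split=> [/onesP [_ /oEx_dense [q [pq [s' /oAndP [e' k']]]]]|e'].
  by rewrite (J_fun (mono pq h) (mono pq k) k'); exact: e'.
apply/onesP; split; first exact: J_dom h k.
apply: (oExI (x := s)); exact: oAndI (oLiftI _ e') k.
Qed.

(* A piece [e] codes a countable sticky set, namely [ones e], together with the countable set
   [U``(ones e)], which is the part of [X] that [j] maps into the domain of [e]. The order
   [D <= D'] on sticky sets then becomes extension of pieces. *)
Definition good e : om P := ⌜countable e⌝ ∧ sSticky U (ones e) X t ∧
  (∀ x, ∀ s, J x s ⇒ (⌜e s <> None⌝ ⇔ sInUnionImage x U (ones e))).

Lemma good_countable p e : p ⊩ good e -> countable e.
Proof. by case/oAndP. Qed.
Lemma good_sticky p e : p ⊩ good e -> p ⊩ sSticky U (ones e) X t.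
Proof. by case/oAndP => _ /oAndP []. Qed.
Lemma good_dom p e x s : p ⊩ good e -> p ⊩ J x s -> (e s <> None <-> (p ⊩ sInUnionImage x U (ones e))).
Proof. case/oAndP => _ /oAndP [_ h] k; exact: oIffE (oImpE (oAllE (oAllE h x) s) k). Qed.

Lemma ones_sub p e f : sub f e -> p ⊩ sSubset (ones f) (ones e).
Proof.
move=> fe x; oi h; case/onesP: h => hx h; apply/onesP; split; first exact: hx.
oex h as s [hs h]%oAndP; apply: (oExI (x := s)); apply: (oAndI _ h); exact: fe hs.
Qed.

(* On the open set [U``(ones f)] the set [D] coincides with the closed discrete set [ones f]. *)
Lemma good_local p f x s D : p ⊩ setup -> p ⊩ good f -> p ⊩ J x s -> f s <> None ->
  (forall q y s', p ⊑ q -> q ⊩ y ∈ D -> q ⊩ J y s' -> f s' <> None -> f s' = Some one) ->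
  p ⊩ (∃ u ∈ t, x ∈ u ∧ (∀ y, y ∈ u ⇒ y ∈ D ⇒ y ≐ x)).
Proof.
move=> h g k fs hD; have hx := J_dom h k.
have l := closedDiscrete_local (sticky_cd (good_sticky g)) hx.
have m := proj1 (good_dom g k) fs.
refine (unionE m _) => q z pq hz hn.
refine (oExE (mono pq l) _) => q1 l1 u2 /oAndP [hu2 /oAndP [xu2 k2]].
refine (oExE (mono l1 hn) _) => q2 l2 u1 /oAndP [hu1 xu1].
have l12 := le_trans l1 l2; have pl := le_trans pq l12.
move: (mono pl h) (mono pl g) (mono l2 hu2) (mono l2 xu2) (mono l2 k2) (mono l12 hz) => {}h {}g {}hu2 {}xu2 {}k2 {}hz.
have u1t := proj2 (func_dom (ona_func (setup_ona h)) hu1).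
refine (oExE (open_inter (setup_top h) u1t hu2) _) => r l3 v /oAndP [hv iv].
apply: (oExI (x := v)); apply: (oAndI hv); apply: oAndI.
  apply/(oIffE (oAllE iv x)); exact: oAndI (mono l3 xu1) (mono l3 xu2).
move=> y r1 l4 hy r2 l5 hyD.
have l45 := le_trans l4 l5; have l6 := le_trans l3 l45.
have /oAndP [y1 y2] := proj1 (oIffE (mono l45 (oAllE iv y))) (mono l5 hy).
have hu : r2 ⊩ sInUnionImage y U (ones f).
  apply: (unionI (mono l6 hz)); apply: (oExI (x := u1)); exact: oAndI (mono l6 hu1) y1.
have yX := open_sub (setup_top (mono l6 h)) (mono l6 u1t) y1.
refine (oExE (J_total (mono l6 h) yX) _) => r3 l7 s' /oAndP [_ ks'].
have fs' := proj2 (good_dom (mono (le_trans l6 l7) g) ks') (mono l7 hu).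
have e1 := hD r3 y s' (le_trans pl (le_trans l6 l7)) (mono l7 hyD) ks' fs'.
have hf := proj2 (ones_J f (mono (le_trans l6 l7) h) ks') e1.
exact: oImpE (oImpE (mono (le_trans l6 l7) (oAllE k2 y)) (mono l7 y2)) hf.
Qed.

(** Stickiness is what makes the union closed discrete. A point covered by the union is covered by
    one of the coded sets, and [good_local] isolates it there. If [U(x)] meets the union, it meets
    one of the coded sets, which then covers [x]; so for an uncovered point [U(x)] misses the union
    altogether. *)
Lemma good_closed p e : p ⊩ setup -> countable e ->
  (forall s (v : real), e s = Some v -> exists f, sub f e /\ f s = Some v /\ (p ⊩ good f)) -> p ⊩ good e.
Proof.
move=> h ce pc; apply: (oAndI (oLiftI _ ce)).
have near q y s : p ⊑ q -> q ⊩ y ∈ ones e -> q ⊩ J y s -> exists f, sub f e /\ (q ⊩ y ∈ ones f) /\ (q ⊩ good f).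
  move=> pq hy k; have e1 := proj1 (ones_J e (mono pq h) k) hy.
  have [f [fe [fs g]]] := pc s one e1; exists f; split=> //.
  split; [exact/(ones_J f (mono pq h) k)|exact: mono g].
have stick q x y s s' : p ⊑ q -> q ⊩ nbr U x y -> q ⊩ y ∈ ones e -> q ⊩ J x s -> q ⊩ J y s' ->
    (q ⊩ sInUnionImage x U (ones e)) /\ e s <> None.
  move=> pq n hy k k'; have [f [fe [hf g]]] := near q y s' pq hy k'.
  have hu := stickyE (setup_ona (mono pq h)) (good_sticky g) n hf.
  split; first exact: union_mono (@ones_sub q _ _ fe) hu.
  by have := proj2 (good_dom g k) hu; case e1 : (f s) => [v|] // _; rewrite (fe _ _ e1).
have cover q x s : p ⊑ q -> q ⊩ J x s -> (e s <> None <-> (q ⊩ sInUnionImage x U (ones e))).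
  move=> pq k; split=> [|hu].
    case e1 : (e s) => [v|] // _; have [f [fe [fs g]]] := pc s v e1.
    apply: union_mono (@ones_sub q _ _ fe) _; apply/(good_dom (mono pq g) k); by rewrite fs.
  have [r [qr [y /oAndP [hy hn]]]] := oEx_dense hu.
  have [r' [rr' [s' /oAndP [_ k']]]] := oEx_dense (J_total (mono (le_trans pq qr) h) (proj1 (proj1 (onesP _ _ _) hy))).
  have [f [fe [hf g]]] := near r' y s' (le_trans pq (le_trans qr rr')) (mono rr' hy) k'.
  have := proj2 (good_dom g (mono (le_trans qr rr') k)) (unionI hf (mono rr' hn)).
  by case e1 : (f s) => [v|] // _; rewrite (fe _ _ e1).
apply: oAndI; last first.
  by move=> x s q pq k; apply: oIffI => r qr; exact: cover (le_trans pq qr) (mono qr k).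
apply: stickyI; last first.
  move=> q x y pq hx n hy; refine (oExE (J_total (mono pq h) hx) _) => r qr s /oAndP [_ k].
  refine (oExE (J_total (mono (le_trans pq qr) h) (mono qr (proj1 (proj1 (onesP _ _ _) hy)))) _) => r' rr' s' /oAndP [_ k'].
  have l := le_trans qr rr'.
  exact: (proj1 (stick r' x y s s' (le_trans pq l) (mono l n) (mono l hy) (mono rr' k) k')).
apply: (closedDiscreteI (setup_top h)).
  by move=> x; oi k; case/onesP: k.
move=> x q pq hx; refine (oExE (J_total (mono pq h) hx) _) => r qr s /oAndP [_ k].
have pr := le_trans pq qr; case e1 : (e s) => [v|].
  have [f [fe [fs g]]] := pc s v e1; apply: (good_local (mono pr h) (mono pr g) k); first by rewrite fs.
  move=> r' y s' rr' hy k' fs'; have e2 := proj1 (ones_J e (mono (le_trans pr rr') h) k') hy.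
  by case e3 : (f s') fs' => [w|] // _; move: (fe _ _ e3); rewrite e2.
refine (oExE (func_total (ona_func (setup_ona (mono pr h))) (mono qr hx)) _) => r1 l1 u hu.
have pr1 := le_trans pr l1.
apply: (oExI (x := u)); apply: (oAndI (proj2 (func_dom (ona_func (setup_ona (mono pr1 h))) hu))).
apply: (oAndI (ona_self (setup_ona (mono pr1 h)) hu)).
move=> y r2 l2 hy r3 l3 hy'; have l4 := le_trans l2 l3; have pr3 := le_trans pr1 l4.
have n : r3 ⊩ nbr U x y by apply: (oExI (x := u)); exact: oAndI (mono l4 hu) (mono l3 hy).
refine (oExE (J_total (mono pr3 h) (proj1 (proj1 (onesP _ _ _) hy'))) _) => r4 l5 s' /oAndP [_ k'].
have := stick r4 x y s s' (le_trans pr3 l5) (mono l5 n) (mono l5 hy') (mono (le_trans l1 (le_trans l4 l5)) k) k'.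
by rewrite e1 => -[_ []].
Qed.
End Main.

(** * Closing off a set of continuum many ordinals *)

Section Closing.
Context {L : scale}.
Local Notation P := (Cond L).
Implicit Types p q r : P.
Implicit Types s : L.
Implicit Types x y z u w D : name P.
Implicit Types e : piece L.
Context (X t U j : name P).
Local Notation Setup := (setup X t U j).
Local Notation Jm := (J j).

(** Sigma-closure puts the sequence of ordinals of a countable set of points into the ground. *)
Lemma enum p D : p ⊩ Setup -> p ⊩ sCountable D -> p ⊩ sSubset D X ->
  exists q, p ⊑ q /\ exists h : nat -> option L, (forall n s, h n = Some s -> q ⊩ (∃ y ∈ D, Jm y s)) /\
    (forall r y s, q ⊑ r -> r ⊩ y ∈ D -> r ⊩ Jm y s -> exists n, h n = Some s).
Proof.
move=> hs /countable_card /card_rel_dense [q [G [pq [_ [g2 [_ g4]]]]]] sub.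
pose H (n : nat) s : om P := ∃ y ∈ D, G y (fin n) ∧ Jm y s.
have [n|r [qr [h hh]]] := @decide_seq L _ (value H) q; first by apply: oExD => r _; exact: value_dense.
exists r; split; first exact: le_trans qr.
exists h; split=> [n s E|r' y s rr' hy k].
  have := hh n; rewrite E /= => k; refine (oExE k _) => r' _ y /oAndP [hy /oAndP [_ hk]].
  apply: (oExI (x := y)); exact: oAndI hy hk.
have qr' := le_trans qr rr'.
have [r1 [l1 [u /oAndP [hu gy]]]] := oEx_dense (g2 r' qr' y hy).
have [n E] := proj1 (lt_om0 u) hu; subst u; exists n.
have := mono (le_trans rr' l1) (hh n); case: (h n) => [s'|] /= v; last first.
  case: (oNotE v); apply: (oExI (x := s)); apply: (oExI (x := y)).
  exact: oAndI (mono l1 hy) (oAndI gy (mono l1 k)).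
have [r2 [l2 [y' /oAndP [hy' /oAndP [gy' k']]]]] := oEx_dense v.
have l12 := le_trans l1 l2.
have ey := g4 r2 (le_trans qr' l12) y y' (fin n) (mono l12 hy) hy' (mono l2 gy) gy'.
by rewrite (J_fun (mono (le_trans pq (le_trans qr' l12)) hs) (J_ext ey (mono l12 k)) k').
Qed.

(** [hh] lists the ordinals of the points in the neighbourhood of the point at [s]; the statement is
    vacuous when no point sits at [s]. *)
Definition NB s (hh : nat -> option L) : om P :=
  ∀ y, ∀ z, ∀ s', Jm y s ⇒ Jm z s' ⇒ (nbr U y z ⇔ ⌜exists n, hh n = Some s'⌝).

Lemma NBP p s hh y z s' : p ⊩ NB s hh -> p ⊩ Jm y s -> p ⊩ Jm z s' ->
  (p ⊩ nbr U y z) <-> exists n, hh n = Some s'.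
Proof.
move=> h k k'; have := oIffE (oImpE (oImpE (oAllE (oAllE (oAllE h y) z) s') k) k').
by move=> E; split=> [/(proj1 E)|/(proj2 E)].
Qed.

Lemma NB_dense p s : p ⊩ Setup -> exists q, p ⊑ q /\ exists hh, q ⊩ NB s hh.
Proof.
move=> hs; have [q [pq [h|h]]] := oDec (∃ y, Jm y s) p; last first.
  exists q; split=> //; exists (fun _ => None) => y z s' r qr k.
  case: (oNotE (mono qr h)); apply: (oExI (x := y)); exact: k.
have [q1 [l1 [y k]]] := oEx_dense h; have pq1 := le_trans pq l1.
have o := setup_ona (mono pq1 hs).
have [q2 [l2 [u hu]]] := oEx_dense (func_total (ona_func o) (J_dom (mono pq1 hs) k)).
have pq2 := le_trans pq1 l2; move: (mono l2 o) (mono l2 k) (mono pq2 hs) => {}o {}k {}hs.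
have sub : q2 ⊩ sSubset u X.
  move=> z r l hz; exact: open_sub (setup_top (mono l hs)) (mono l (proj2 (func_dom (ona_func o) hu))) hz.
have [q3 [l3 [hh [h1 h2]]]] := enum hs (setup_countable hs hu) sub.
exists q3; split; first exact: le_trans pq2 l3.
exists hh => y' z s' r1 m1 k1 r2 m2 k2.
have m3 := le_trans m1 m2; have m4 := le_trans l3 m3.
have ey := J_inj (mono m4 hs) (mono m4 k) (mono m2 k1).
apply: oIffI => r3 m5; have m6 := le_trans m4 m5; split=> n.
  have [r4 [m7 [u' /oAndP [hu' hz]]]] := oEx_dense (Ext_nbr1 (feq_sym (mono m5 ey)) n).
  have m8 := le_trans m6 m7.
  have hz' := mem_eqr (func_fun (ona_func (mono m8 o)) hu' (mono m8 hu)) hz.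
  apply: oLiftI; exact: (h2 r4 z s' (le_trans m3 (le_trans m5 m7)) hz' (mono (le_trans m5 m7) k2)).
have [n' E] := oLiftE n; have kk := mono (le_trans m3 m5) (h1 _ _ E).
refine (oExE kk _) => r4 m7 z' /oAndP [hz' k'].
have m8 := le_trans m6 m7.
have ez := J_inj (mono m8 hs) k' (mono (le_trans m5 m7) k2).
apply: Ext_nbr1 (mono (le_trans m5 m7) ey) _; apply: (oExI (x := u)).
exact: oAndI (mono m8 hu) (mem_eql ez hz').
Qed.

(* Some point at [s] whose neighbourhood meets the set [D] listed by [f] is not covered by [U``D]. *)
Definition bad (f : nat -> L) s : om P := ∃ z, ∃ y, ∃ n, Jm z s ∧ nbr U z y ∧ Jm y (f n) ∧
  ¬ (∃ m, ∃ d, Jm d (f m) ∧ nbr U d z).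

(** Neighbourhoods and bad points are only forced, so all of their [real] many candidates enter [A].
    Since countable subsets of [A] in the extension are listed by ground sequences, closure under
    ground sequences reaches all of them. *)
Lemma closing_set p e s0 : p ⊩ Setup -> countable e -> exists (A : L -> Prop) (g : real -> L),
  A s0 /\ (forall s, e s <> None -> A s) /\ (forall s, A s -> exists i, g i = s) /\
  (forall q y z s s', p ⊑ q -> A s -> q ⊩ Jm y s -> q ⊩ nbr U y z -> q ⊩ Jm z s' -> A s') /\
  (forall q f s, p ⊑ q -> (forall n, A (f n)) -> q ⊩ bad f s -> exists r s', q ⊑ r /\ A s' /\ (r ⊩ bad f s')).
Proof.
move=> hs [en hen].
have [N hN] : exists N : L -> real -> nat -> option L, forall s q, p ⊑ q -> exists r, q ⊑ r /\ exists i, r ⊩ NB s (N s i).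
  apply: (choice_fun (R := fun s N => forall q, p ⊑ q -> exists r, q ⊑ r /\ exists i, r ⊩ NB s (N i))) => s.
  apply: (cover (Q := fun r hh => r ⊩ NB s hh)) => [q r hh qr|q pq]; first exact: mono.
  exact: NB_dense (mono pq hs).
have [W hW] : exists W : (nat -> L) -> real -> option L, forall f q, p ⊑ q ->
    exists r, q ⊑ r /\ exists i, r ⊩ value bad f (W f i).
  apply: (choice_fun (R := fun f W => forall q, p ⊑ q -> exists r, q ⊑ r /\ exists i, r ⊩ value bad f (W i))) => f.
  apply: (cover (Q := fun r o => r ⊩ value bad f o)) => [q r o qr|q pq]; [exact: mono|exact: value_dense].
have [nn hnn] := onto_real_nat.
pose st (i : real) := match nn i with 0 => s0 | S n => match en n with Some s => s | None => s0 end end.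
(* The boolean selects the task: the [n]-th point of the [i]-th candidate neighbourhood of [f 0], or
   the [i]-th candidate for a bad point of [f]. The default [f 0] adds nothing new. *)
pose op (k : bool * (real * nat)) (f : nat -> L) : L := match k with
  | (true, (i, n)) => match N (f 0) i n with Some s => s | None => f 0 end
  | (false, (i, _)) => match W f i with Some s => s | None => f 0 end end.
have [A [A1 [A2 [_ [g hg]]]]] := @closure L _ st op (onto_real_pair onto_real_bool (onto_real_pair (onto_refl real) onto_real_nat)).
exists A, g; split; [|split; [|split; [|split]]].
- by have [i E] := hnn 0; move: (A1 i); rewrite /st E.
- by move=> s /hen [n E]; have [i Ei] := hnn (S n); move: (A1 i); rewrite /st Ei E.
- by move=> s /hg.
- move=> q y z s s' pq As k n k'; have [r [qr [i hi]]] := hN s q pq.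
  have [m E] := proj1 (NBP hi (mono qr k) (mono qr k')) (mono qr n).
  by have := A2 (true, (i, m)) (fun _ => s) (fun _ => As); rewrite /op E.
- move=> q f s pq Af hb; have [r [qr [i hi]]] := hW f q pq.
  have := A2 (false, (i, 0)) f Af; rewrite /op; move: hi; case: (W f i) => [s'|] /= v As.
    by exists r, s'.
  case: (oNotE v); apply: (oExI (x := s)); exact: mono qr hb.
Qed.
End Closing.

(** * Subspaces and trace assignments *)

Section Subspace.
Context {P : poset}.
Implicit Types p q r : P.
Implicit Types x y z u v D X Y t U V T : name P.

Definition cap u Y := sep u (fun x => x ∈ Y).

Lemma capP u Y x p : p ⊩ x ∈ cap u Y <-> (p ⊩ x ∈ u) /\ (p ⊩ x ∈ Y).
Proof. apply: sepP; exact: Ext_mem1. Qed.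

Lemma cap_inter u Y p : p ⊩ sIsInter (cap u Y) u Y.
Proof.
move=> x; apply: oIffI => q _; split=> [/capP [h1 h2]|/oAndP h]; first exact: oAndI.
exact/capP.
Qed.

Lemma cap_open T Y t u p : p ⊩ sIsSubspaceTopology T Y t -> p ⊩ u ∈ t -> p ⊩ cap u Y ∈ T.
Proof.
move=> h hu; apply/(oIffE (oAllE h _)); apply: (oExI (x := u)); exact: oAndI hu (@cap_inter u Y p).
Qed.

Lemma trace_nbr U V Y y z p : p ⊩ sIsTraceONA V U Y ->
  (p ⊩ nbr V y z) <-> (p ⊩ y ∈ Y) /\ (p ⊩ z ∈ Y) /\ (p ⊩ nbr U y z).
Proof.
move=> tr; split=> [h|[hy [hz h]]].
  suff /oAndP [h1 /oAndP] : p ⊩ (y ∈ Y ∧ (z ∈ Y ∧ nbr U y z)) by [].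
  oex h as v [m hz]%oAndP; move/mapsP: m => m.
  have k := proj1 (oIffE (oAllE tr _)) m.
  oex k as y' [hy k]%oAndP; oex k as u k; oex k as v' [mu [iv e]%oAndP]%oAndP.
  have [e1 e2] := opair_inj (proj1 (IsOPairP _ _ _ _) e).
  have /oAndP [z1 z2] := proj1 (oIffE (oAllE iv z)) (mem_eqr e2 hz).
  apply: oAndI; first exact: mem_eql (feq_sym e1) hy.
  apply: (oAndI z2); apply: (Ext_nbr1 (feq_sym e1)); apply: (oExI (x := u)); exact: oAndI mu z1.
oex h as u [mu hzu]%oAndP; apply: (oExI (x := cap u Y)); apply: oAndI; last by apply/capP.
apply/mapsP; apply/(oIffE (oAllE tr _)); apply: (oExI (x := y)); apply: (oAndI hy).
apply: (oExI (x := u)); apply: (oExI (x := cap u Y)); apply: (oAndI mu); apply: (oAndI (@cap_inter u Y p)).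
apply/IsOPairP; exact: feq_refl.
Qed.

Lemma subspace_cd X t T Y D p : p ⊩ sIsSubspaceTopology T Y t -> p ⊩ sClosedDiscrete D X t ->
  p ⊩ sSubset D Y -> p ⊩ sSubset Y X -> p ⊩ sClosedDiscrete D Y T.
Proof.
move=> sp /oAndP [_ /oAndP [cl dis]] DY YX; apply: (oAndI DY); apply: oAndI.
  oex cl as c [hc k]%oAndP; apply: (oExI (x := cap c Y)); apply: (oAndI (cap_open sp hc)).
  move=> x; apply: oIffI => q pq; lift pq; split=> [/capP [h1 h2]|/oAndP [h1 h2]].
    apply: (oAndI h2); by case/oAndP: (proj1 (oIffE (oAllE k x)) h1).
  apply/capP; split=> //; apply/(oIffE (oAllE k x)); exact: oAndI (subsetE YX h1) h2.
move=> x; oi hx; have k := oImpE (oAllE dis x) hx; oex k as u [hu k]%oAndP.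
apply: (oExI (x := cap u Y)); apply: (oAndI (cap_open sp hu)); move=> y; apply: oIffI => q pq; lift pq.
split=> [/oAndP [/capP [h1 h2] h3]|h]; first by apply/(oIffE (oAllE k y)); exact: oAndI.
have /oAndP [h1 h2] := proj2 (oIffE (oAllE k y)) h.
apply: (oAndI _ h2); apply/capP; split=> //; exact: subsetE DY h2.
Qed.

Lemma subspace_local T Y t D z p : p ⊩ sIsSubspaceTopology T Y t -> p ⊩ sClosedDiscrete D Y T ->
  p ⊩ z ∈ Y -> p ⊩ (∃ u ∈ t, z ∈ u ∧ (∀ y, y ∈ u ⇒ y ∈ D ⇒ y ≐ z)).
Proof.
move=> sp cd hz; have k := closedDiscrete_local cd hz; oex k as v [hv [zv k]%oAndP]%oAndP.
have l := proj1 (oIffE (oAllE sp v)) hv; oex l as u [hu iv]%oAndP.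
apply: (oExI (x := u)); apply: (oAndI hu); apply: oAndI.
  by case/oAndP: (proj1 (oIffE (oAllE iv z)) zv).
move=> y; oi hy; oi hy'; apply: (oImpE (oImpE (oAllE k y) _) hy'); apply/(oIffE (oAllE iv y)).
apply: (oAndI hy); case/oAndP: cd => s _; exact: subsetE s hy'.
Qed.
End Subspace.

(** * From larger sticky sets back to pieces *)

Section Extension.
Context {L : scale}.
Local Notation P := (Cond L).
Implicit Types p q r : P.
Implicit Types s : L.
Implicit Types x y z u w D : name P.
Implicit Types e : piece L.
Context (X t U j : name P).
Local Notation Setup := (setup X t U j).
Local Notation Jm := (J j).
Local Notation ones' := (ones X j).
Local Notation good' := (good X t U j).

Let e0 : nat -> name P := fun _ => numeral 0.
Lemma Ext_sticky V Z T : Ext (fun D => @sSticky P V D Z T).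
Proof.
exact (@Ext_sem P (Sticky (fun i => i - 3) (fun i => i - 4) (fun i => i - 2) (fun i => i - 1) 4)
  (econs V (econs Z (econs T e0)))).
Qed.

Lemma Ext_union2 V y : Ext (fun D => @sInUnionImage P y V D).
Proof. rewrite /sInUnionImage; ext. Qed.

Lemma countable_decide (a : nat -> option L) : countable (fun s => if decide (exists n, a n = Some s) then Some one else None).
Proof.
exists a => s; case E : (decide _) => // _; exact/decideP.
Qed.

(** Sigma-closure brings [D] and the neighbourhoods of its points into the ground, where [e'] can be
    defined. The end-extension hypothesis says that [D] adds no point already covered by [ones e],
    which is exactly what lets [e'] keep the values of [e]. *)
Lemma extend_piece p e D : p ⊩ Setup -> p ⊩ good' e -> p ⊩ sSticky U D X t -> p ⊩ sCountable D ->
  p ⊩ sSubset (ones' e) D ->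
  (forall q y, p ⊑ q -> q ⊩ y ∈ D -> q ⊩ sInUnionImage y U (ones' e) -> q ⊩ y ∈ ones' e) ->
  exists q e', p ⊑ q /\ sub e e' /\ countable e' /\ (q ⊩ good' e') /\
    forall r y s, q ⊑ r -> r ⊩ Jm y s -> r ⊩ sInUnionImage y U D -> e' s <> None.
Proof.
move=> hs ge st cD sD end_ext.
have [q1 [l1 [h [h1 h2]]]] := enum hs cD (sticky_sub st).
have [|q2 [l2 [k hk]]] := @decide_seq L (nat -> option L)
    (fun n hh => match h n with Some s => NB U j s hh | None => ⌜True⌝ end) q1.
  move=> n; apply: oExD => q qq; case: (h n) => [s|].
    exact: NB_dense (mono (le_trans l1 qq) hs).
  by exists q; split; [exact: le_refl|exists (fun _ => None)].
have l := le_trans l1 l2.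
pose d s := exists n, h n = Some s.
pose nb s := exists n m, h n <> None /\ k n m = Some s.
have dP r y s : q2 ⊑ r -> r ⊩ Jm y s -> (r ⊩ y ∈ D) <-> d s.
  move=> qr ky; split=> [hy|[n E]]; first exact: h2 (le_trans l2 qr) hy ky.
  refine (oExE (mono (le_trans l2 qr) (h1 n s E)) _) => r' rr' y' /oAndP [hy' ky'].
  exact: mem_eql (J_inj (mono (le_trans (le_trans l qr) rr') hs) ky' (mono rr' ky)) hy'.
have nbP r z s : q2 ⊑ r -> r ⊩ Jm z s -> (r ⊩ sInUnionImage z U D) <-> nb s.
  move=> qr kz; split=> [hz|[n [m [hn E]]]].
    have [r1 [m1 [y /oAndP [hy n]]]] := oEx_dense hz.
    have pr := le_trans l (le_trans qr m1).
    have [r2 [m2 [s' /oAndP [_ ky]]]] := oEx_dense (J_total (mono pr hs) (subsetE (sticky_sub (mono pr st)) hy)).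
    have qr2 := le_trans qr (le_trans m1 m2).
    have [i E] := h2 r2 y s' (le_trans l2 qr2) (mono m2 hy) ky.
    have := mono qr2 (hk i); rewrite E => hN.
    have [m E'] := proj1 (NBP hN ky (mono (le_trans m1 m2) kz)) (mono m2 n).
    by exists i, m; rewrite E.
  case E' : (h n) hn => [s'|] // _; have := mono qr (hk n); rewrite E' => hN.
  refine (oExE (mono (le_trans l2 qr) (h1 n s' E')) _) => r' rr' y /oAndP [hy ky].
  apply: (unionI hy); apply/(NBP (mono rr' hN) ky (mono rr' kz)); by exists m.
(* Off the coded set [e] may take any value except [one]; new covered points outside [D] get
   [zero]. *)
pose e' : piece L := fun s => match e s with Some v => Some v
  | None => if decide (d s) then Some one else if decide (nb s) then Some zero else None end.
have ee' : sub e e' by move=> s v E; rewrite /e' E.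
have ce' : countable e'.
  apply: (countable_cover (a := fun n => match n with 0 => fun s => match e s with Some _ => Some one | None => None end
    | 1 => fun s => if decide (exists n, h n = Some s) then Some one else None
    | S (S n) => fun s => if decide (exists m, k n m = Some s) then Some one else None end)).
    move=> [|[|n]]; [|exact: countable_decide|exact: countable_decide].
    have [en he] := good_countable ge; exists en => s; case E : (e s) => [v|] // _; apply: he; by rewrite E.
  move=> s; rewrite /e'; case E : (e s) => [v|]; first by exists 0; rewrite E.
  case E1 : (decide (d s)); first by exists 1; rewrite E1.
  case E2 : (decide (nb s)) => // _; move/decideP: E2 => [n [m [_ E2]]]; exists (S (S n)).
  by have /decideP -> : exists m, k n m = Some s by exists m.
have onesE r y s : q2 ⊑ r -> r ⊩ Jm y s -> e' s = Some one <-> d s.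
  move=> qr ky; have pr := le_trans l qr; rewrite /e'; case E : (e s) => [v|]; last first.
    split=> [|/decideP -> //]; case E1 : (decide (d s)) => [|]; first by move/decideP: E1.
    by case: (decide (nb s)) => // -[] /(f_equal (fun g => g 0)).
  have O := ones_J e (mono pr hs) ky.
  split=> [[E1]|hd].
    apply/(dP r y s qr ky); apply: (subsetE (mono pr sD)); apply/O; by rewrite E E1.
  have /O <- // : r ⊩ y ∈ ones' e.
  apply: (end_ext r y pr); first exact/(dP r y s qr ky).
  by apply/(good_dom (mono pr ge) ky); rewrite E.
have eqD : q2 ⊩ D ≐ ones' e'.
  apply: ext_eq => r qr y hy.
    have yX := subsetE (sticky_sub (mono (le_trans l qr) st)) hy.
    refine (oExE (J_total (mono (le_trans l qr) hs) yX) _) => r' rr' s /oAndP [_ ky].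
    have qr' := le_trans qr rr'.
    apply/(ones_J e' (mono (le_trans l qr') hs) ky); apply/(onesE r' y s qr' ky); apply/(dP r' y s qr' ky).
    exact: mono hy.
  have [yX _] := proj1 (onesP _ _ _ _ _) hy.
  refine (oExE (J_total (mono (le_trans l qr) hs) yX) _) => r' rr' s /oAndP [_ ky].
  have qr' := le_trans qr rr'; apply/(dP r' y s qr' ky); apply/(onesE r' y s qr' ky).
  apply/(ones_J e' (mono (le_trans l qr') hs) ky); exact: mono hy.
have dom r y s : q2 ⊑ r -> r ⊩ Jm y s -> e' s <> None <-> (r ⊩ sInUnionImage y U D).
  move=> qr ky; have pr := le_trans l qr; split; last first.
    move=> /(nbP r y s qr ky) hn; rewrite /e'; case: (e s) => // .
    by case: (decide (d s)) => //; move/decideP: hn => ->.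
  rewrite /e'; case E : (e s) => [v|].
    move=> _; apply: union_mono (mono pr sD) _; apply/(good_dom (mono pr ge) ky); by rewrite E.
  case E1 : (decide (d s)).
    move=> _; have hy : r ⊩ y ∈ D by apply/(dP r y s qr ky); apply/decideP.
    apply: (unionI hy); apply: nbr_self (setup_ona (mono pr hs)) (J_dom (mono pr hs) ky).
  case E2 : (decide (nb s)) => // _; apply/(nbP r y s qr ky); exact/decideP.
exists q2, e'; split=> //; split=> //; split=> //; split; last first.
  by move=> r y s qr ky hu; apply/(dom r y s qr ky).
apply: (oAndI (oLiftI _ ce')); apply: oAndI; first exact: Ext_sticky eqD (mono l st).
move=> y s r qr ky; apply: oIffI => r' rr'; have qr' := le_trans qr rr'; split=> h'.
  apply: (Ext_union2 (mono qr' eqD)); apply/(dom r' y s qr' (mono rr' ky)); exact: h'.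
apply: oLiftI; apply/(dom r' y s qr' (mono rr' ky)); exact: Ext_union2 (feq_sym (mono qr' eqD)) h'.
Qed.
End Extension.

(** * The open part of size at most aleph_1 *)

Section Density.
Context {L : scale}.
Local Notation P := (Cond L).
Implicit Types p q r : P.
Implicit Types s : L.
Implicit Types x y z w D : name P.
Implicit Types e : piece L.
Context (X t U j : name P).
Local Notation Setup := (setup X t U j).
Local Notation Jm := (J j).
Local Notation ones' := (ones X j).
Local Notation good' := (good X t U j).

Lemma ones_countable p e : p ⊩ Setup -> countable e -> p ⊩ sCountable (ones' e).
Proof.
move=> hs [en hen].
have [c hc] : exists c : L -> nat, forall s, e s <> None -> en (c s) = Some s.
  apply: (choice_fun (R := fun s n => e s <> None -> en n = Some s)) => s.
  case: (classic (e s = None)) => [E|/hen [n E]]; [by exists 0|by exists n].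
apply: (countable_chk (s := om0)); first by apply/lt_om1; exact: om0_om1.
apply: (rel_inj_card (G := fun x u => ∃ s, ⌜e s = Some one /\ u = fin (c s)⌝ ∧ Jm x s)).
split; first by move=> u; rewrite /J; ext.
split; [|split] => q pq.
- move=> x /onesP [_ k]; oex k as s [hs' k]%oAndP; apply: (oExI (x := fin (c s))).
  apply: oAndI; first by apply: oLiftI; apply/lt_om0; exists (c s).
  apply: (oExI (x := s)); exact: oAndI (oLiftI _ (conj hs' eq_refl)) k.
- move=> x u u' _ k k'; have [r [qr [s /oAndP [[_ ->] h]]]] := oEx_dense k.
  have [r' [rr' [s' /oAndP [[_ ->] h']]]] := oEx_dense (mono qr k').
  by rewrite (J_fun (mono (le_trans pq (le_trans qr rr')) hs) (mono rr' h) h').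
- move=> x x' u _ _ k k'; refine (oExE k _) => r qr s /oAndP [[hs1 E1] h].
  refine (oExE (mono qr k') _) => r' rr' s' /oAndP [[hs1' E1'] h'].
  have E : s = s'.
    have /fin_inj E : @fin L (c s) = fin (c s') by rewrite -E1 -E1'.
    have : Some s = Some s' by rewrite -(hc s) ?hs1 // -(hc s') ?hs1' // E.
    by case.
  subst s'; exact: J_inj (mono (le_trans pq (le_trans qr rr')) hs) (mono rr' h) h'.
Qed.

Section Closed.
Context (p : P) (A : L -> Prop) (g : real -> L) (hs : p ⊩ Setup).
Context (gA : forall s, A s -> exists i, g i = s).
Context (Acl : forall q y z s s', p ⊑ q -> A s -> q ⊩ Jm y s -> q ⊩ nbr U y z -> q ⊩ Jm z s' -> A s').

Definition part : name P := sep X (fun x => ∃ s, ⌜A s⌝ ∧ Jm x s).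

Lemma part_ext : Ext (fun x => ∃ s, ⌜A s⌝ ∧ Jm x s).
Proof. rewrite /J; ext. Qed.

Lemma partP q x : q ⊩ x ∈ part <-> (q ⊩ x ∈ X) /\ (q ⊩ (∃ s, ⌜A s⌝ ∧ Jm x s)).
Proof. exact: (sepP X q x part_ext). Qed.

Lemma part_J q x s : p ⊑ q -> q ⊩ Jm x s -> (q ⊩ x ∈ part) <-> A s.
Proof.
move=> pq k; split=> [/partP [_ /oEx_dense [r [qr [s' /oAndP [As k']]]]]|As].
  by rewrite (J_fun (mono (le_trans pq qr) hs) (mono qr k) k'); exact: As.
apply/partP; split; first exact: J_dom (mono pq hs) k.
apply: (oExI (x := s)); exact: oAndI (oLiftI _ As) k.
Qed.

Lemma part_sub q : q ⊩ sSubset part X.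
Proof. move=> x r _ /partP [h _]; exact: h. Qed.

Lemma part_nbr q y z : p ⊑ q -> q ⊩ y ∈ part -> q ⊩ nbr U y z -> q ⊩ z ∈ part.
Proof.
move=> pq hy n; have [_ k] := proj1 (partP _ _) hy.
refine (oExE k _) => r qr s /oAndP [As ky]; have pr := le_trans pq qr.
have zX := nbr_cod (setup_top (mono pr hs)) (setup_ona (mono pr hs)) (mono qr n).
refine (oExE (J_total (mono pr hs) zX) _) => r' rr' s' /oAndP [_ kz].
apply/(part_J (le_trans pr rr') kz); apply: (Acl (le_trans pr rr') As (mono rr' ky) _ kz).
exact: mono (le_trans qr rr') n.
Qed.

Lemma part_open : p ⊩ part ∈ t.
Proof.
apply: (open_local (setup_top hs)) => y q pq hy; have o := setup_ona (mono pq hs).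
refine (oExE (func_total (ona_func o) (subsetE (@part_sub q) hy)) _) => r qr u hu.
have pr := le_trans pq qr; have o' := mono qr o.
apply: (oExI (x := u)); apply: (oAndI (proj2 (func_dom (ona_func o') hu))); apply: (oAndI (ona_self o' hu)).
move=> z r' rr' hz; apply: (part_nbr (le_trans pr rr') (mono (le_trans qr rr') hy)).
apply: (oExI (x := u)); exact: oAndI (mono rr' hu) hz.
Qed.

(** The part has continuum many ordinals in the ground, and [place] brings this down to aleph_1. *)
Lemma part_card : p ⊩ sCardLeAleph1 part.
Proof.
have [c hc] : exists c : L -> real, forall s, A s -> g (c s) = s.
  apply: (choice_fun (R := fun s i => A s -> g i = s)) => s.
  case: (classic (A s)) => [/gA [i E]|n]; [by exists i|by exists one].
apply: (oExI (x := chk (@om1 L))); apply: oAndI; first exact: om1_aleph1.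
apply: (card_le_place (R := fun x v => ∃ s, ⌜A s /\ v = c s⌝ ∧ Jm x s)).
- by move=> v; rewrite /J; ext.
- move=> q _ x /partP [_ k]; oex k as s [As k]%oAndP; apply: (oExI (x := c s)); apply: (oExI (x := s)).
  exact: oAndI (oLiftI _ (conj As eq_refl)) k.
- move=> q pq x u u' _ k k'; have [r [qr [s /oAndP [[_ ->] h]]]] := oEx_dense k.
  have [r' [rr' [s' /oAndP [[_ ->] h']]]] := oEx_dense (mono qr k').
  by rewrite (J_fun (mono (le_trans pq (le_trans qr rr')) hs) (mono rr' h) h').
- move=> q pq x x' u _ _ k k'; refine (oExE k _) => r qr s /oAndP [[hs1 E1] h].
  refine (oExE (mono qr k') _) => r' rr' s' /oAndP [[hs1' E1'] h'].
  have E : s = s' by rewrite -(hc s hs1) -(hc s' hs1') -E1 -E1'.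
  subst s'; exact: J_inj (mono (le_trans pq (le_trans qr rr')) hs) (mono rr' h) h'.
Qed.

Context (Abad : forall q (f : nat -> L) s, p ⊑ q -> (forall n, A (f n)) -> q ⊩ bad U j f s ->
  exists r s', q ⊑ r /\ A s' /\ (r ⊩ bad U j f s')).

(** If some uncovered [z] has a neighbourhood meeting [D], then [z] is bad for the list of [D], and
    the closure of [A] supplies a bad point inside the part; there it contradicts stickiness of [D]
    in the subspace. Once [D] is known to meet only neighbourhoods of covered points, closed
    discreteness follows: covered points lie in the part, and the neighbourhoods of the others miss
    [D]. *)
Lemma part_sticky q T V D : p ⊑ q -> q ⊩ sIsSubspaceTopology T part t -> q ⊩ sIsTraceONA V U part ->
  q ⊩ sCountable D -> q ⊩ sSticky V D part T -> q ⊩ (∃ y, y ∈ D) -> q ⊩ sSticky U D X t.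
Proof.
move=> pq0 sp tr cD st ne; apply: reg => q0 qq0; lift qq0.
have Dp := sticky_sub st.
have DX : q ⊩ sSubset D X by move=> y r l hy; apply: subsetE (@part_sub r) (subsetE (mono l Dp) hy).
have [q1 [l1 [h [h1 h2]]]] := enum (mono pq0 hs) cD DX.
(* A member of the nonempty [D] fills the gaps of its list, giving a total sequence [f] in [A]. *)
have [s0 [n0 E0]] : exists s n, h n = Some s.
  have [r [l [y hy]]] := oEx_dense (mono l1 ne).
  have [r' [l' [s /oAndP [_ k]]]] := oEx_dense (J_total (mono (le_trans pq0 (le_trans l1 l)) hs) (subsetE (mono (le_trans l1 l) DX) hy)).
  by have [n E] := h2 r' y s (le_trans l l') (mono l' hy) k; exists s, n.
pose f n := match h n with Some s => s | None => s0 end.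
have pq1 := le_trans pq0 l1.
have hA n s : h n = Some s -> A s.
  move=> E; have [r [l [y /oAndP [hy k]]]] := oEx_dense (h1 n s E).
  apply/(part_J (le_trans pq1 l) k); exact: subsetE (mono (le_trans l1 l) Dp) hy.
have fA n : A (f n) by rewrite /f; case E : (h n) => [s|]; [exact: hA E|exact: hA E0].
have fD r n y : q1 ⊑ r -> r ⊩ Jm y (f n) -> r ⊩ y ∈ D.
  move=> l k; have [m E] : exists m, h m = Some (f n).
    by rewrite /f; case E : (h n) => [s|]; [exists n|exists n0].
  refine (oExE (mono l (h1 m _ E)) _) => r' l' y' /oAndP [hy' k'].
  exact: mem_eql (J_inj (mono (le_trans pq1 (le_trans l l')) hs) k' (mono l' k)) hy'.
have Df r y s : q1 ⊑ r -> r ⊩ y ∈ D -> r ⊩ Jm y s -> exists n, f n = s.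
  by move=> l hy k; have [n E] := h2 r y s l hy k; exists n; rewrite /f E.
exists q1; split=> //.
have stick r z y : q1 ⊑ r -> r ⊩ nbr U z y -> r ⊩ y ∈ D -> r ⊩ sInUnionImage z U D.
  move=> l n hy; refine (oEm (A := sInUnionImage z U D) _ _) => // r1 m1 no; exfalso.
  have pr1 := le_trans pq1 (le_trans l m1).
  have zX := nbr_dom (setup_ona (mono pr1 hs)) (mono m1 n).
  have [r2 [m2 [s /oAndP [_ kz]]]] := oEx_dense (J_total (mono pr1 hs) zX).
  have pr2 := le_trans pr1 m2.
  have yX := nbr_cod (setup_top (mono pr2 hs)) (setup_ona (mono pr2 hs)) (mono (le_trans m1 m2) n).
  have [r3 [m3 [s' /oAndP [_ ky]]]] := oEx_dense (J_total (mono pr2 hs) yX).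
  have m13 := le_trans m1 (le_trans m2 m3); have l3 := le_trans l m13.
  have [k Ek] := Df r3 y s' l3 (mono m13 hy) ky.
  have hb : r3 ⊩ bad U j f s.
    apply: (oExI (x := z)); apply: (oExI (x := y)); apply: (oExI (x := k)).
    apply: (oAndI (mono m3 kz)); apply: (oAndI (mono m13 n)); rewrite Ek; apply: (oAndI ky).
    move=> r4 m4 hm; apply: (oNotE (mono (le_trans m2 (le_trans m3 m4)) no)).
    refine (oExE hm _) => r5 m5 m hm'; refine (oExE hm' _) => r6 m6 d /oAndP [kd nd].
    apply: (unionI (fD r6 m d (le_trans l3 (le_trans m4 (le_trans m5 m6))) kd) nd).
  (* The bad point [z] is exchanged for one whose ordinal lies in [A]. *)
  have [r4 [s4 [m4 [A4 hb4]]]] := Abad (le_trans pq1 l3) fA hb.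
  have l4 := le_trans l3 m4.
  have [r5 [m5 [z5 hb5]]] := oEx_dense hb4; have [r6 [m6 [y6 hb6]]] := oEx_dense hb5.
  have [r7 [m7 [n7 /oAndP [kz7 /oAndP [nz7 /oAndP [ky7 no7]]]]]] := oEx_dense hb6.
  have l7 := le_trans l4 (le_trans m5 (le_trans m6 m7)); have p7 := le_trans pq1 l7.
  have q7 := le_trans l1 l7.
  have hy7 := fD r7 n7 y6 l7 ky7.
  have hz7 := proj2 (part_J p7 kz7) A4.
  have nV : r7 ⊩ nbr V z5 y6.
    apply/(trace_nbr _ _ (mono q7 tr)); split=> //; split=> //; exact: subsetE (mono q7 Dp) hy7.
  have /oAndP [_ st7] := mono q7 st.
  have hu : r7 ⊩ sInUnionImage z5 V D.
    apply: (oImpE (oImpE (oAllE st7 z5) hz7)); refine (oExE nV _) => r8 m8 v /oAndP [k8 k8'].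
    apply: (oExI (x := v)); apply: (oAndI k8); apply: (oExI (x := y6)); exact: oAndI k8' (mono m8 hy7).
  have [r8 [m8 [d /oAndP [hd nd]]]] := oEx_dense hu.
  have [_ [_ nd']] := proj1 (trace_nbr _ _ (mono (le_trans q7 m8) tr)) nd.
  have dX := subsetE (mono (le_trans q7 m8) DX) hd.
  have [r9 [m9 [s9 /oAndP [_ kd]]]] := oEx_dense (J_total (mono (le_trans p7 m8) hs) dX).
  have [i Ei] := Df r9 d s9 (le_trans l7 (le_trans m8 m9)) (mono m9 hd) kd.
  apply: (oNotE (mono (le_trans m8 m9) no7)); apply: (oExI (x := i)); apply: (oExI (x := d)).
  rewrite Ei; exact: oAndI kd (mono m9 nd').
apply: stickyI; last by move=> r z y l hz n hy; exact: stick l n hy.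
apply: (closedDiscreteI (setup_top (mono pq1 hs)) (mono l1 DX)) => z r l hz.
have lr := le_trans l1 l; have pr := le_trans pq1 l.
refine (oEm (A := sInUnionImage z U D) _ _) => r1 m1 hu.
  have zp : r1 ⊩ z ∈ part.
    refine (unionE hu _) => r2 d m2 hd nd.
    exact: part_nbr (le_trans pr (le_trans m1 m2)) (subsetE (mono (le_trans lr (le_trans m1 m2)) Dp) hd) nd.
  exact: subspace_local (mono (le_trans lr m1) sp) (sticky_cd (mono (le_trans lr m1) st)) zp.
have o := setup_ona (mono (le_trans pr m1) hs).
refine (oExE (func_total (ona_func o) (mono m1 hz)) _) => r2 m2 u k.
apply: (oExI (x := u)); apply: (oAndI (proj2 (func_dom (ona_func (mono m2 o)) k))).
apply: (oAndI (ona_self (mono m2 o) k)); move=> y r3 m3 hy r4 m4 hy'; exfalso.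
apply: (oNotE (mono (le_trans m2 (le_trans m3 m4)) hu)).
apply: (stick r4 z y (le_trans l (le_trans m1 (le_trans m2 (le_trans m3 m4)))) _ hy').
apply: (oExI (x := u)); exact: oAndI (mono (le_trans m3 m4) k) (mono m4 hy).
Qed.
End Closed.
End Density.

(** * The generic closed discrete set *)

Section DSpace.
Context {L : scale}.
Local Notation P := (Cond L).
Implicit Types p q r : P.
Implicit Types s : L.
Implicit Types x y z w D : name P.
Implicit Types e f : piece L.
Context (X t U j : name P).
Local Notation Setup := (setup X t U j).
Local Notation Jm := (J j).
Local Notation ones' := (ones X j).
Local Notation good' := (good X t U j).

(** Strong D-ness is applied to the part generated by [x] and the domain of [e], where [ones e] is
    still sticky. The end-extension found there covers [x], is sticky in all of [X] by
    [part_sticky], and is coded by a piece extending [e]. *)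
Lemma good_extend_at p e x s0 : p ⊩ Setup -> p ⊩ good' e -> p ⊩ Jm x s0 ->
  exists r e', p ⊑ r /\ sub e e' /\ (r ⊩ good' e') /\ countable e' /\ e' s0 <> None.
Proof.
move=> hs ge kx; have [A [g [A0 [Ae [gA [Acl Abad]]]]]] := closing_set s0 hs (good_countable ge).
pose Y := part X j A.
have SS := setup_strong hs (part_open hs Acl) (part_card hs gA).
have [q1 [l1 [T h1]]] := oEx_dense SS; have [q2 [l2 [V /oAndP [sp /oAndP [tr str]]]]] := oEx_dense h1.
have l := le_trans l1 l2; move: (mono l hs) (mono l ge) (mono l kx) => hs2 ge2 kx2.
have onesY q : q2 ⊑ q -> q ⊩ sSubset (ones' e) Y.
  move=> qq y r qr hy; have [yX k] := proj1 (onesP _ _ _ _ _) hy; apply/partP; split; first exact: yX.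
  refine (oExE k _) => r1 m1 s /oAndP [hs1 ks]; apply: (oExI (x := s)); apply: (oAndI _ ks).
  by apply: oLiftI; apply: Ae; rewrite (hs1 : e s = Some one).
have inP : q2 ⊩ sInPoset (ones' e) V Y T.
  apply: (oAndI (ones_countable hs2 (good_countable ge2))); apply: stickyI.
    exact: subspace_cd sp (sticky_cd (good_sticky ge2)) (onesY q2 (le_refl q2)) (@part_sub _ _ _ _ q2).
  move=> q y z qq hy n hz; have [_ [_ n']] := proj1 (trace_nbr _ _ (mono qq tr)) n.
  have hu := stickyE (setup_ona (mono qq hs2)) (good_sticky (mono qq ge2)) n' hz.
  refine (unionE hu _) => r d qr hd nd; apply: (unionI hd); apply/(trace_nbr _ _ (mono (le_trans qq qr) tr)).
  split; first exact: subsetE (onesY r (le_trans qq qr)) hd.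
  by split=> //; exact: mono hy.
have xY := proj2 (part_J A hs l kx2) A0.
have [q3 [l3 [D /oAndP [/oAndP [cD sD] /oAndP [/oAndP [sub no] hx]]]]] :=
  oEx_dense (oImpE (oAllE (oImpE (oAllE str (ones' e)) inP) x) xY).
have l13 := le_trans l l3.
have tr3 := mono l3 tr; have DY := sticky_sub sD.
have st : q3 ⊩ sSticky U D X t.
  apply: (part_sticky hs Acl Abad l13 (mono l3 sp) tr3 cD sD).
  refine (unionE hx _) => r d _ hd _; apply: (oExI (x := d)); exact: hd.
have [|q4 [e' [l4 [ee [ce [ge' dom]]]]]] := extend_piece (mono l3 hs2) (mono l3 ge2) st cD sub.
  move=> q y qq hy hu; refine (oEm (A := y ∈ ones' e) _ _) => // r qr n; exfalso.
  have qr' := le_trans qq qr; apply: (oNotE (mono qr' no)).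
  apply: (oExI (x := y)); apply: (oAndI (mono qr hy)); apply: (oAndI n).
  refine (unionE (mono qr hu) _) => r1 d m1 hd nd; have q1' := le_trans qr' m1.
  apply: (unionI hd); apply/(trace_nbr _ _ (mono q1' tr3)).
  split; first exact: subsetE (onesY r1 (le_trans l3 q1')) hd.
  by split=> //; exact: subsetE (mono q1' DY) (mono (le_trans qr m1) hy).
exists q4, e'; split; first exact: le_trans l13 l4.
split=> //; split=> //; split=> //; apply: (dom q4 x s0 (le_refl _) (mono (le_trans l13 l4) kx)).
refine (unionE (mono l4 hx) _) => r d qr hd nd; apply: (unionI hd).
by case: (proj1 (trace_nbr _ _ (mono (le_trans l4 qr) tr3)) nd) => _ [].
Qed.

(** Ordinals that carry no point contribute nothing, so such a piece codes the empty set. *)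
Lemma good_off p e : p ⊩ Setup -> countable e ->
  (forall s, e s <> None -> p ⊩ ¬ (∃ x, Jm x s)) -> p ⊩ good' e.
Proof.
move=> hs ce off.
have no q x s : p ⊑ q -> q ⊩ Jm x s -> e s = None.
  move=> pq k; apply: NNPP => /off n; case: (oNotE (mono pq n)); apply: (oExI (x := x)); exact: k.
have emp q y : p ⊑ q -> ~ (q ⊩ y ∈ ones' e).
  move=> pq /onesP [_ /oEx_dense [r [qr [s /oAndP [E k]]]]].
  by have := oLiftE E; rewrite (no r y s (le_trans pq qr) k).
apply: (oAndI (oLiftI _ ce)); apply: oAndI.
  apply: stickyI; last by move=> q x y pq _ _ /(emp q y pq).
  apply: (closedDiscreteI (setup_top hs)).
    by move=> y q pq /(emp q y pq).
  move=> x q pq hx; have o := setup_ona (mono pq hs).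
  refine (oExE (func_total (ona_func o) hx) _) => r qr u k.
  apply: (oExI (x := u)); apply: (oAndI (proj2 (func_dom (ona_func (mono qr o)) k))).
  apply: (oAndI (ona_self (mono qr o) k)); move=> y r1 l1 _ r2 l2 hy; exfalso.
  exact: (emp r2 y (le_trans pq (le_trans qr (le_trans l1 l2))) hy).
move=> x s q pq k; apply: oIffI => r qr; split=> [E|hu]; first by case: (oLiftE E); exact: no k.
exfalso; have [r' [rr' [d /oAndP [hd _]]]] := oEx_dense hu.
exact: (emp r' d (le_trans pq (le_trans qr rr')) hd).
Qed.

(** If [s0] carries no point, the value [zero] may be added freely: the two pieces are compatible
    and good, and unions of good pieces are good. *)
Lemma good_dense p e s0 : p ⊩ Setup -> p ⊩ good' e ->
  exists r e', p ⊑ r /\ sub e e' /\ (r ⊩ good' e') /\ countable e' /\ e' s0 <> None.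
Proof.
move=> hs ge; case E0 : (e s0) => [v0|].
  exists p, e; split; first exact: le_refl. split; first exact: sub_refl.
  split; [exact: ge|split; [exact: good_countable ge|by rewrite E0]].
have [q [pq [h|h]]] := oDec (∃ x, Jm x s0) p.
  have [q1 [l1 [x k]]] := oEx_dense h; have l := le_trans pq l1.
  have [r [e' [l' H]]] := good_extend_at (mono l hs) (mono l ge) k.
  exists r, e'; split; [exact: le_trans l l'|exact: H].
pose f0 : piece L := fun s => if decide (s = s0) then Some zero else None.
have cf : countable f0.
  exists (fun _ => Some s0) => s; rewrite /f0; case E : (decide _) => // _; exists 0; congr Some.
  by move/decideP: E.
have gf : q ⊩ good' f0.
  apply: (good_off (mono pq hs) cf) => s; rewrite /f0; case E : (decide (s = s0)) => ne; last by case: ne.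
  move/decideP: E => E; rewrite E; exact: h.
have cm : compat e f0.
  move=> s u v Es; rewrite /f0; case E : (decide _) => //; move/decideP: E => E.
  by rewrite E E0 in Es.
exists q, (join e f0); split; first exact: pq. split; first exact: join_l.
have cj := countable_join (good_countable ge) cf.
split; last first.
  split; first exact: cj.
  by rewrite /join E0 /f0; have -> : decide (s0 = s0) = true by apply/decideP.
apply: (good_closed (mono pq hs) cj) => s v; rewrite /join; case Es : (e s) => [w|] Ev.
  exists e; split; first exact: join_l. split; [by rewrite Es|exact: mono pq ge].
exists f0; split; first exact: join_r. split; [exact: Ev|exact: gf].
Qed.

(** [D] consists of the points where the generic function at the node naming the good pieces takes
    the value [one]. Densely many conditions have any given point in the domain of their piece at
    this node. That piece is good, and on its domain it already determines [D]; so it shows both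
    that the point is covered and that [D] is locally closed discrete there. *)
Lemma dspace p : p ⊩ Setup -> p ⊩ (∃ D, sClosedDiscrete D X t ∧ (∀ x ∈ X, sInUnionImage x U D)).
Proof.
move=> hs; have [live [kids [data [c1 c2]]]] := code_exists good'.
pose c := node live kids data.
have piece_good q : p ⊑ q -> q ⊩ good' (at_ (fn q) c).
  move=> pq; apply: (generic_piece c1) => e ce; exact: good_closed (mono pq hs) ce.
have step q s : p ⊑ q -> exists r, q ⊑ r /\ fn r (c, s) <> None.
  move=> pq; apply: (generic_step c1 c2) => [e ce|e r qr].
    exact: good_closed (mono pq hs) ce.
  exact: good_dense (mono (le_trans pq qr) hs).
pose F x : om P := ∃ s, Jm x s ∧ gen c s one.
have eF : Ext F by rewrite /F /J; ext.
pose D := sep X F.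
have memD q x : q ⊩ x ∈ D <-> (q ⊩ x ∈ X) /\ (q ⊩ F x) by exact: (sepP X q x eF).
have inD q x s : p ⊑ q -> q ⊩ Jm x s -> at_ (fn q) c s <> None -> q ⊩ x ∈ D -> at_ (fn q) c s = Some one.
  move=> pq k; rewrite /at_; case E : (fn q (c, s)) => [v|] // _ /memD [_ h].
  have [r [qr [s' /oAndP [k' gg]]]] := oEx_dense h.
  have E' := J_fun (mono (le_trans pq qr) hs) (mono qr k) k'; subst s'.
  by rewrite (gen_fun gg (fn_mono qr E)).
apply: (oExI (x := D)); apply: oAndI.
  apply: (closedDiscreteI (setup_top hs)); first by move=> x q _ /memD [h _]; exact: h.
  move=> x q pq hx; apply: reg => q' qq'.
  have pq' := le_trans pq qq'.
  have [q1 [l1 [s /oAndP [_ k]]]] := oEx_dense (J_total (mono pq' hs) (mono qq' hx)).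
  have [r [l2 nr]] := step q1 s (le_trans pq' l1); have pr := le_trans pq' (le_trans l1 l2).
  exists r; split; first exact: le_trans l1 l2.
  apply: (good_local (mono pr hs) (piece_good r pr) (mono l2 k) nr) => r' y s' rr' hy k' ns'.
  move: ns'; rewrite /at_; case E : (fn r (c, s')) => [v|] // _.
  have E' := fn_mono rr' E; rewrite -E'; apply: (inD r' y s' (le_trans pr rr') k') => //.
  by rewrite /at_ E'.
move=> x q pq hx; apply: reg => q' qq'; have pq' := le_trans pq qq'.
have [q1 [l1 [s /oAndP [_ k]]]] := oEx_dense (J_total (mono pq' hs) (mono qq' hx)).
have [r [l2 nr]] := step q1 s (le_trans pq' l1); have pr := le_trans pq' (le_trans l1 l2).
exists r; split; first exact: le_trans l1 l2.
apply: union_mono (proj1 (good_dom (piece_good r pr) (mono l2 k)) nr).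
move=> y r1 m1 hy; have [yX h] := proj1 (onesP _ _ _ _ _) hy; apply/memD; split; first exact: yX.
refine (oExE h _) => r2 m2 s' /oAndP [E k']; apply: (oExI (x := s')); apply: (oAndI k').
apply: genI; exact: fn_mono (le_trans m1 m2) (oLiftE E).
Qed.
End DSpace.

(** * Reduction to countable neighbourhoods, and the conclusion *)

Section Final.
Context {L : scale}.
Local Notation P := (Cond L).
Implicit Types p q r : P.
Implicit Types x y z u v w D X t U V f A B : name P.

Lemma inj_widen f A B B' p : p ⊩ sIsInj f A B -> p ⊩ sSubset B B' -> p ⊩ sIsInj f A B'.
Proof.
move=> /oAndP [/oAndP [h1 h2] h3] sub; apply: oAndI h3; apply: oAndI h2.
move=> z; oi hz; have k := oImpE (oAllE h1 z) hz; oex k as a [ha k]%oAndP; oex k as b [hb k]%oAndP.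
apply: (oExI (x := a)); apply: (oAndI ha); apply: (oExI (x := b)); exact: oAndI (subsetE sub hb) k.
Qed.

Lemma countable_sub A B p : p ⊩ sSubset A B -> p ⊩ sCountable B -> p ⊩ sCountable A.
Proof.
move=> sub /countable_card c; apply: (countable_chk (s := om0)); first by apply/lt_om1; exact: om0_om1.
apply: (card_rel c) => q G pq [g1 [g2 [g3 g4]]]; apply: (rel_inj_card (G := G)).
have mem r x : q ⊑ r -> r ⊩ x ∈ A -> r ⊩ x ∈ B by move=> qr; exact: subsetE (mono (le_trans pq qr) sub).
split; first exact: g1. split; [|split] => r qr.
- move=> x hx; exact: g2 (mem r x qr hx).
- move=> x u u' hx; exact: g3 (mem r x qr hx).
- move=> x x' u hx hx'; exact: g4 (mem r x qr hx) (mem r x' qr hx').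
Qed.

Definition meet_fun U W (x v : name P) : om P := ∃ u, ∃ w, sMaps U x u ∧ sMaps W x w ∧ sIsInter v u w.

Lemma meet_fun_unique X t U W x v v' p : p ⊩ sONA U X t -> p ⊩ sONA W X t ->
  p ⊩ meet_fun U W x v -> p ⊩ meet_fun U W x v' -> p ⊩ v ≐ v'.
Proof.
move=> oU oW h h'; oex h as u h; oex h as w [k [l i]%oAndP]%oAndP.
oex h' as u' h'; oex h' as w' [k' [l' i']%oAndP]%oAndP.
have e1 := func_fun (ona_func oU) k k'; have e2 := func_fun (ona_func oW) l l'.
apply: ext_eq => q pq x0 hx; lift pq.
  have /oAndP [h1 h2] := proj1 (oIffE (oAllE i x0)) hx.
  apply/(oIffE (oAllE i' x0)); exact: oAndI (mem_eqr e1 h1) (mem_eqr e2 h2).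
have /oAndP [h1 h2] := proj1 (oIffE (oAllE i' x0)) hx.
apply/(oIffE (oAllE i x0)); exact: oAndI (mem_eqr (feq_sym e1) h1) (mem_eqr (feq_sym e2) h2).
Qed.

Lemma meet_fun1 U W v : Ext (fun x => meet_fun U W x v).
Proof. rewrite /meet_fun; ext. Qed.

Lemma meet_fun2 U W x : Ext (meet_fun U W x).
Proof. rewrite /meet_fun /sIsInter; ext. Qed.

Lemma meet_ona X t U W p : p ⊩ sIsTopology X t -> p ⊩ sONA U X t -> p ⊩ sONA W X t ->
  p ⊩ sONA (mkfun X t (meet_fun U W)) X t.
Proof.
move=> top oU oW; apply: oAndI.
  apply: mkfun_func; [exact: meet_fun1|exact: meet_fun2| |].
    move=> q pq x hx; move: (mono pq top) (mono pq oU) (mono pq oW) => top' oU' oW'.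
    have k := func_total (ona_func oU') hx; oex k as u k.
    have l := func_total (ona_func oW') hx; oex l as w l.
    have i := open_inter top' (proj2 (func_dom (ona_func oU') k)) (proj2 (func_dom (ona_func oW') l)).
    oex i as v [hv i]%oAndP; apply: (oExI (x := v)); apply: (oAndI hv).
    apply: (oExI (x := u)); apply: (oExI (x := w)); exact: oAndI k (oAndI l i).
  move=> q pq x v v' _; exact: meet_fun_unique (mono pq oU) (mono pq oW).
move=> x q pq hx v r qr h; have pr := le_trans pq qr.
have [_ [_ k]] := proj1 (mkfunP _ _ _ _ _ (@meet_fun1 U W) (@meet_fun2 U W)) h.
refine (oExE k _) => r1 l1 u k1; refine (oExE k1 _) => r2 l2 w /oAndP [mu /oAndP [mw i]].
have l := le_trans pr (le_trans l1 l2).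
apply/(oIffE (oAllE i x)); exact: oAndI (ona_self (mono l oU) mu) (ona_self (mono l oW) mw).
Qed.

Lemma forced_dspaces p : p ⊩ (∀ X, ∀ t,
          sIsTopology X t
          ⇒ sHausdorff X t
          ⇒ sLocallyCountable X t
          ⇒ sCardLeAleph2 X
          ⇒ (∀ U', sONA U' X t ⇒
               ∃ U, sONA U X t ∧ sFiner U U' X
                 ∧ (∀ Y ∈ t, sCardLeAleph1 Y ⇒ sSubspaceStronglyD Y t U))
          ⇒ sIsDSpace X t).
Proof.
move=> X t; oi top; oi hau; oi lc; oi card; oi strong; move=> U0; oi oU0.
oex lc as W [oW lc]%oAndP; oex card as k [hk card]%oAndP; oex card as j hj.
have {}hj := inj_widen hj (aleph2_sub hk).
(* Intersecting [U0] with the countable neighbourhoods [W] before invoking the hypothesis makes the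
   values of the finer assignment [U] countable. *)
pose U1 := mkfun X t (meet_fun U0 W).
have oU1 : p ⊩ sONA U1 X t by exact: meet_ona.
have U1P q x v : q ⊩ sMaps U1 x v -> q ⊩ meet_fun U0 W x v.
  by move=> h; case: (proj1 (mkfunP _ _ _ _ _ (@meet_fun1 U0 W) (@meet_fun2 U0 W)) h) => _ [].
have k1 := oImpE (oAllE strong U1) oU1; oex k1 as U [oU [fin_U str]%oAndP]%oAndP.
have refines q x u : p ⊑ q -> q ⊩ sMaps U x u -> q ⊩ (∃ u0, ∃ w, sMaps U0 x u0 ∧ sMaps W x w ∧ sSubset u u0 ∧ sSubset u w).
  move=> pq h; have hx := proj1 (func_dom (ona_func (mono pq oU)) h).
  refine (oExE (func_total (ona_func (mono pq oU1)) hx) _) => r qr v hv.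
  have sv := oImpE (oImpE (oAllE (oAllE (oImpE (oAllE (mono (le_trans pq qr) fin_U) x) (mono qr hx)) u) v) (mono qr h)) hv.
  refine (oExE (U1P r x v hv) _) => r1 l1 u0 k2; refine (oExE k2 _) => r2 l2 w /oAndP [mu /oAndP [mw i]].
  apply: (oExI (x := u0)); apply: (oExI (x := w)); apply: (oAndI mu); apply: (oAndI mw).
  have l := le_trans l1 l2; apply: oAndI => y r3 l3 hy;
    have /oAndP [h1 h2] := proj1 (oIffE (mono l3 (oAllE i y))) (subsetE (mono (le_trans l l3) sv) hy).
    exact: h1.
  exact: h2.
have hs : p ⊩ setup X t U j.
  apply: (oAndI top); apply: (oAndI oU); apply: oAndI; last exact: oAndI hj str.
  move=> x u q pq h; refine (oExE (refines q x u pq h) _) => r qr u0 k2.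
  refine (oExE k2 _) => r1 l1 w /oAndP [_ /oAndP [mw /oAndP [_ sw]]].
  have pr := le_trans pq (le_trans qr l1).
  apply: (countable_sub sw); apply: ltAleph1_countable.
  have hx := proj1 (func_dom (ona_func (mono pr oW)) mw).
  exact: oImpE (oAllE (oImpE (oAllE (mono pr lc) x) hx) w) mw.
(* A set that covers [X] through [U] also does so through the coarser [U0]. *)
refine (oExE (dspace hs) _) => p1 l0 D /oAndP [cd cov].
apply: (oExI (x := D)); apply: (oAndI cd); move=> y; apply: oIffI => q pq1; have pq := le_trans l0 pq1; split=> h.
  refine (unionE h _) => r x qr _ n; exact: nbr_cod (mono (le_trans pq qr) top) (mono (le_trans pq qr) oU0) n.
refine (unionE (oImpE (oAllE (mono pq1 cov) y) h) _) => r x qr hx n; apply: (unionI hx).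
refine (oExE n _) => r1 l1 u /oAndP [mu hy].
refine (oExE (refines r1 x u (le_trans pq (le_trans qr l1)) mu) _) => r2 l2 u0 k2.
refine (oExE k2 _) => r3 l3 w /oAndP [mu0 /oAndP [_ /oAndP [su _]]].
apply: (oExI (x := u0)); apply: (oAndI mu0); exact: subsetE su (mono (le_trans l2 l3) hy).
Qed.

Lemma forced_main p : p ⊩ @sMain P.
Proof. exact: oAndI (@forced_CH L p) (oAndI (@forced_2_aleph1 L p) (@forced_dspaces p)). Qed.
End Final.

Local Close Scope om_scope.
Local Open Scope zf_scope.

Theorem corollary2p17 :
  consistent ZFC ->
  consistent (extend ZFC (sentence
    (CH
     ∧ TwoToAleph1GtAleph2
     ∧ (∀ X, ∀ t,
          IsTopology X t
          ⇒ Hausdorff X t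
          ⇒ LocallyCountable X t
          ⇒ CardLeAleph2 X
          ⇒ (∀ U', ONA U' X t ⇒
               ∃ U, ONA U X t ∧ Finer U U' X
                 ∧ (∀ Y ∈ t, CardLeAleph1 Y ⇒ SubspaceStronglyD Y t U))
          ⇒ IsDSpace X t)))).
Proof.
move=> _; have [L] := scale_exists.
have v : countable (fun _ : coord L * L => @None real) /\ @valid L (fun _ => None).
  by split=> [|k y r] //; exists (fun _ => None) => k [].
pose p0 : Cond L := exist (fun p : @pcond L => countable p /\ valid p) (fun _ => None) v.
apply: (soundness_consistent (p0 := p0) (fun _ => numeral 0)) => A [hA|->] e; first exact: forced_ZFC.
(* By conversion the meaning of the named sentence is [sMain]. *)
exact (@forced_main L p0).
Qed.
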